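(* In the setting of the context (weights satisfying (H1)–(H4), (K1), (K2), (K3)), let $H(\mathbb N^2)$ be the real vector space of functions $h:\mathbb Z^2\to\mathbb R$ with $\Delta(h)(i,j)=0$ for all $i,j\ge1$ and $h(i,j)=0$ whenever $i\le0$ or $j\le0$, and let $\mathbb R_0[[t]]$ be the vector space of real formal power series with vanishing constant term. Then $H(\mathbb N^2)$ is isomorphic to $\mathbb R_0[[t]]$ through the isomorphism $$\Phi:\ \mathbb R_0[[t]]\longrightarrow H(\mathbb N^2),\qquad \sum_{n\ge1}a_nt^n\longmapsto\sum_{n\ge1}a_nh_n .$$
   Context: $\mathbb N=\{1,2,3,\dots\}$. Let $\{p_{k,\ell}\}_{(k,\ell)\in\mathbb Z^2}$ be non-negative reals with sum $1$ such that: (H1) $p_{k,\ell}=0$ if $k\ge2$ or $\ell\ge2$; (H2) if $|\sum p_{k,\ell}x^ky^\ell|=1$ and $|x|=|y|=1$ then $x=y=1$; (H3) $\sum(k^2+\ell^2)p_{k,\ell}<\infty$; (H4) $\sum kp_{k,\ell}=\sum\ell p_{k,\ell}=0$. For $h:\mathbb Z^2\to\mathbb R$ put $\Delta(h)(i,j)=\sum_{k,\ell}p_{k,\ell}h(i+k,j+\ell)-h(i,j)$. Kernel: $K(x,y)=xy-\sum p_{k,\ell}x^{-k+1}y^{-\ell+1}$ for $|x|,|y|\le1$. $\mathcal C$ and $\mathcal C^+$ are the unit circle and the open unit disk. For each $s\in\mathcal C$, $\eta\mapsto K(\eta s,\eta s^{-1})$ has exactly two roots in the closed unit disk. If $p_{1,1}=0$,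 one root is identically $0$; the other, $\eta(s)$, is continuous in $s\in\mathcal C$, with $\eta(1)=-\eta(-1)=1$. If $p_{1,1}\neq0$, the roots are continuous functions $\eta(s),\eta_2(s)$ of $s\in\mathcal C$, with $\eta(1)=1$, $\eta_2(1)\in(-1,0)$ and $\eta_2(s)=-\eta(-s)$. Let $\mathcal S_1=\{\eta(s)s:|s|=1\}$, $\mathcal S_2=\{\eta(s)s^{-1}:|s|=1\}$. (K1): $\mathcal S_1,\mathcal S_2$ are non-self-intersecting (Jordan curves); as $s$ traverses $\mathcal C$, $\eta(s)s$ and $\eta(s)s^{-1}$ move on $\mathcal S_1$ and $\mathcal S_2$ in opposite orientations, and they have non-vanishing derivatives in $s$ for every $s\in\mathcal C\setminus\{\pm1\}$ (if $p_{1,1}=0$), resp. $s\in\mathcal C\setminus\{1\}$ (if $p_{1,1}\ne0$), given that the derivatives exist. $\mathcal S_i^+$ and $\mathcal S_i^-$ denote the interior and exterior of $\mathcal S_i$. Let $X:\mathcal S_2\to\mathcal S_1$ be the bijection $\eta(s)s^{-1}\mapsto\eta(s)s$. (K2): $-\sum p_{k,\ell}k\ell<\sum p_{k,\ell}k^2$ and $-\sum p_{k,\ell}k\ell<\sum p_{k,\ell}\ell^2$. Let $\pi_i$ ($i=1,2$) be the conformal map from $\mathcal S_i^+$ onto $\mathcal C^+$ with $\pi_i(r_i)=0$, $\pi_i'(r_i)>0$ for some fixed $r_i\in\mathcal S_i^+\cap\mathbb R$; a superscript $+$ denotes continuous extension to the boundary (one has $\pi_i^+(1)=1$). Let $\phi(z)=-i\frac{z+1}{z-1}$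 and $\alpha(z)=\phi\circ\pi_1^+\circ X\circ(\pi_2^{-1})^+\circ\phi^{-1}(-z)$ for $z\in\mathbb R$. (K3): there are $q\in\mathbb R$ and a non-zero constant $\kappa$ with $\alpha'(z)=\kappa|z|^q+o(|z|^q)$ as $z\to\pm\infty$. Maps $\psi_1,\psi_2$: under these assumptions there is a non-self-intersecting curve $\mathcal L\subset\mathbb C$, both ends of which go to $\infty$, dividing $\mathbb C$ into two domains $\mathcal L^+$ and $\mathcal L^-$, and conformal bijections $\psi_1:\mathcal S_1^+\to\mathcal L^+$, $\psi_2:\mathcal S_2^+\to\mathcal L^-$ whose extensions $\psi_i^+$ to the boundary (continuous, values in $\mathbb C\cup\{\infty\}$) satisfy: $\psi_1^+(X(y))=\psi_2^+(y)$ for $y\in\mathcal S_2$; $\psi_1^+(1)=\psi_2^+(1)=\infty$; $\psi_i(\overline z)=\overline{\psi_i(z)}$ for $z\in\mathcal{S}_i^+$. Fix such a pair. Near $0$, $\psi_1,\psi_2$ are understood as follows: if $p_{1,1}\ne0$, $0\in\mathcal S_1^+\cap\mathcal S_2^+$. If $p_{1,1}=0$, $p_{1,0}=p_{0,1}$, then $0\in\mathcal S_1\cap\mathcal S_2$ and $\psi_1,\psi_2$ extend analytically to a neighborhood of $0$. If $p_{1,1}=0$, $p_{0,1}>p_{1,0}$, then $0\in\mathcal S_1^+\cap\mathcal S_2^-$ and $\psi_2$ is extended analytically from $\mathcal S_2^+$ to $0$ along the real line; if $p_{0,1}<p_{1,0}$, the roles of the indices are exchanged. Polynomials: $P_{2n+1}(X)=(X-\psi_1(0))^{n+1}(X-\psi_2(0))^n$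 for $n\ge0$ and $P_{2n}(X)=(X-\psi_1(0))^n(X-\psi_2(0))^n$ for $n\ge1$. Functions $h_n$ ($n\ge1$): $H_n(x,y)=\frac{P_n(\psi_1(x))-P_n(\psi_2(y))}{K(x,y)}$ is, around $(0,0)$, a power series $\sum_{i,j\ge1}h_n(i,j)x^{i-1}y^{j-1}$, and $h_n$, extended by $0$ outside $\mathbb N^2$, belongs to $H(\mathbb N^2)$. The infinite sum $\sum_{n\ge1}a_nh_n$ is understood pointwise: at each $(i,j)$ only finitely many terms $h_n(i,j)$ are non-zero. *)

(* Defs.v *)
(* MathComp / MathComp-Analysis; complex numbers are R[i] over R : realType. *)
From HB Require Import structures.
From mathcomp Require Import all_boot all_order all_algebra.
From mathcomp Require Import finmap complex.
From mathcomp Require Import all_classical all_reals all_analysis.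
From mathcomp.analysis.showcase Require summability.

Set Implicit Arguments.
Unset Strict Implicit.
Unset Printing Implicit Defensive.

Import Order.TTheory GRing.Theory Num.Theory numFieldNormedType.Exports.

Local Open Scope classical_set_scope.
Local Open Scope complex_scope.
Local Open Scope ring_scope.

(* R[i] as a normed module over itself, with the topology of the modulus, so
   that [derivable f z 1] is complex differentiability for f : R[i] -> R[i]. *)
HB.instance Definition _ (R : realType) := NormedModule.copy R[i] R[i]^o.

(* Unordered sums over an arbitrary index type: limits of the finite partial
   sums along the filter of finite subsets (in R and in R[i] this is absolute
   convergence).  [usum] is only meaningful when the family is summable. *)
Definition has_usum (I : choiceType) (K : numFieldType) (V : normedModType K)
    (f : I -> V) (v : V) : Prop :=
  summability.partial_sum f A @[A --> summability.totally] --> v.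

Definition usum (I : choiceType) (K : numFieldType) (V : normedModType K)
    (f : I -> V) : V := summability.sum f.

Section Weights.
Variable R : realType.
Implicit Types (p h : int -> int -> R) (x y : R[i]).

Record admissible_weights p : Prop := AdmissibleWeights {
  weights_ge0 : forall k l, 0 <= p k l ;
  weights_sum1 : has_usum (fun kl : int * int => p kl.1 kl.2) 1 ;
  weights_small_pos_jumps : forall k l : int, 2 <= k \/ 2 <= l -> p k l = 0 ;
  weights_aperiodic : forall x y, `|x| = 1 -> `|y| = 1 ->
    `|usum (fun kl : int * int =>
        (p kl.1 kl.2)%:C * x ^ kl.1 * y ^ kl.2)| = 1 ->
    x = 1 /\ y = 1 ;
  weights_moment2 : exists m : R,
    has_usum (fun kl : int * int => (kl.1 ^+ 2 + kl.2 ^+ 2)%:~R * p kl.1 kl.2) m ;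
  weights_drift1 : has_usum (fun kl : int * int => kl.1%:~R * p kl.1 kl.2) 0 ;
  weights_drift2 : has_usum (fun kl : int * int => kl.2%:~R * p kl.1 kl.2) 0
}.

Definition covariance_condition p : Prop :=
  let c := usum (fun kl : int * int => p kl.1 kl.2 * kl.1%:~R * kl.2%:~R) in
  - c < usum (fun kl : int * int => p kl.1 kl.2 * kl.1%:~R ^+ 2) /\
  - c < usum (fun kl : int * int => p kl.1 kl.2 * kl.2%:~R ^+ 2).

Definition laplacian p h (i j : int) : R :=
  usum (fun kl : int * int => p kl.1 kl.2 * h (i + kl.1) (j + kl.2)) - h i j.

Definition harmonic_quadrant p : set (int -> int -> R) :=
  [set h | (forall i j : int, 1 <= i -> 1 <= j -> laplacian p h i j = 0) /\
           (forall i j : int, i <= 0 \/ j <= 0 -> h i j = 0)].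

(* For |x|, |y| <= 1; exponents of non-zero terms are >= 0, and 0 ^ 0 = 1. *)
Definition walk_kernel p x y : R[i] :=
  x * y - usum (fun kl : int * int =>
    (p kl.1 kl.2)%:C * x ^ (1 - kl.1) * y ^ (1 - kl.2)).

End Weights.

Section ComplexPlane.
Variable R : realType.
Local Notation C := R[i].
Implicit Types (S A B : set C) (f g : C -> C) (z : C).

Definition circle : set C := [set s | `|s| = 1].
Definition disk : set C := [set z | `|z| < 1].
Definition closed_disk : set C := [set z | `|z| <= 1].

(* Interior and exterior of a Jordan curve: the points of its complement lying
   in a bounded, resp. unbounded, connected component. *)
Definition curve_int S : set C :=
  [set z | ~ S z /\ bounded_set (connected_component (~` S) z)].
Definition curve_ext S : set C :=
  [set z | ~ S z /\ ~ bounded_set (connected_component (~` S) z)].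

Definition expi (t : R) : C := cos t +i* sin t.

(* n is the winding number about z of the closed curve t |-> f (expi t),
   0 <= t <= 2 pi: the total variation of a continuous argument is 2 pi n. *)
Definition winding f z (n : int) : Prop := exists th : R -> R,
  [/\ {within `[0, 2 * pi], continuous th},
      forall t, 0 <= t <= 2 * pi ->
        f (expi t) - z = `|f (expi t) - z| * expi (th t) &
      th (2 * pi) - th 0 = 2 * pi * n%:~R].

(* l is the derivative at s of f, viewed as a function on the circle. *)
Definition circle_derive f (s l : C) : Prop :=
  (f t - f s) / (t - s) @[t --> within circle s^'] --> l.

Definition analytic_at f z : Prop := \forall w \near z, derivable f w (1 : C).

Definition conformal A B f : Prop :=
  (forall z, A z -> derivable f z (1 : C)) /\ set_bij A B f.

(* f is the conformal map from the interior of S onto the unit disk sending r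
   to 0 with positive derivative there, together with its continuous extension
   to the boundary; 0 < w in R[i] means that w is real and positive. *)
Definition riemann_map S (r : R) f : Prop :=
  [/\ curve_int S r%:C, conformal (curve_int S) disk f,
      f r%:C = 0, 0 < 'D_(1 : C) f r%:C &
      {within curve_int S `|` S, continuous f}].

(* g is the inverse of f on the disk, continuously extended to the circle. *)
Definition riemann_inverse S f g : Prop :=
  {within closed_disk, continuous g} /\
  forall z, curve_int S z -> g (f z) = z.

Definition cayley z : C := - 'i * (z + 1) / (z - 1).
Definition cayley_inv (w : C) : C := (w - 'i) / (w + 'i).

(* L is a simple curve with both ends at infinity dividing the plane into the
   domains Lp and Lm. *)
Definition dividing_curve (L Lp Lm : set C) : Prop :=
  [/\ exists l : R -> C,
        [/\ continuous l, injective l, range l = L,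
            `|l t| @[t --> +oo] --> +oo & `|l t| @[t --> -oo] --> +oo],
      [/\ open Lp, connected Lp & Lp !=set0],
      [/\ open Lm, connected Lm & Lm !=set0],
      Lp `&` Lm = set0 &
      Lp `|` Lm = ~` L].

(* F is the extension of f to the closure of the interior of S, continuous
   with values in the Riemann sphere ([None] is the point at infinity). *)
Definition sphere_extension S f (F : C -> one_point_compactification C) : Prop :=
  {within curve_int S `|` S, continuous F} /\
  forall z, curve_int S z -> F z = Some (f z).

(* g is the analytic continuation of f, from the domain A to 0, along a
   segment of the real line. *)
Definition continued_to_0 A f g : Prop := exists r : R,
  [/\ A r%:C, \forall z \near r%:C, g z = f z &
      forall t : R, 0 <= t <= 1 -> analytic_at g (t * r)%:C].

End ComplexPlane.

Arguments circle {R}.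
Arguments disk {R}.
Arguments closed_disk {R}.

Section Setting.
Variable R : realType.
Local Notation C := R[i].
Implicit Types (p : int -> int -> R) (eta : C -> C).

(* eta is the branch of roots in the closed disk of z |-> K(z s, z / s) with
   eta(1) = 1; the other one is 0 if p_{1,1} = 0, and s |-> - eta(- s)
   otherwise. *)
Definition root_branch p eta : Prop :=
  let roots s :=
    [set z : C | `|z| <= 1 /\ walk_kernel p (z * s) (z * s^-1) = 0] in
  [/\ {within circle, continuous eta}, eta 1 = 1,
      p 1 1 = 0 -> eta (- 1) = - 1 /\
        forall s, circle s -> roots s = [set 0; eta s] &
      p 1 1 != 0 -> - 1 < - eta (- 1) < 0 /\
        forall s, circle s -> roots s = [set eta s; - eta (- s)]].

Definition gamma1 eta (s : C) : C := eta s * s.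
Definition gamma2 eta (s : C) : C := eta s * s^-1.
Definition S1 eta : set C := gamma1 eta @` circle.
Definition S2 eta : set C := gamma2 eta @` circle.

(* If p_{1,1} = 0 then eta(- s) = - eta(s), so both curves are run through
   exactly twice when s runs through the circle; this is the only repetition
   allowed.  Orientations are given by the sign of the winding numbers about
   the interior points, of absolute value the number of turns. *)
Definition jordan_condition p eta : Prop :=
  let turns : int := if p 1 1 == 0 then 2 else 1 in
  let simple f := forall s t : C, circle s -> circle t -> f s = f t ->
    t = s \/ p 1 1 = 0 /\ t = - s in
  let regular f := forall s l : C, circle s -> s != 1 ->
    (p 1 1 = 0 -> s != - 1) -> circle_derive f s l -> l != 0 in
  [/\ simple (gamma1 eta) /\ simple (gamma2 eta),
      exists e : int, [/\ e = 1 \/ e = - 1,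
        forall z, curve_int (S1 eta) z -> winding (gamma1 eta) z (e * turns) &
        forall z, curve_int (S2 eta) z -> winding (gamma2 eta) z (- e * turns)]
      & regular (gamma1 eta) /\ regular (gamma2 eta)].

Definition boundary_bijection eta (X : C -> C) : Prop :=
  set_bij (S2 eta) (S1 eta) X /\
  forall s, circle s -> X (gamma2 eta s) = gamma1 eta s.

(* The argument of Re is real: all boundary maps have values in the circle. *)
Definition alpha (pi1 X pi2inv : C -> C) (z : R) : R :=
  complex.Re (cayley (pi1 (X (pi2inv (cayley_inv (- z)%:C))))).

Definition growth_condition (a : R -> R) : Prop :=
  exists q kappa : R, kappa != 0 /\
    forall F : set_system R, F = +oo \/ F = -oo ->
      (\forall z \near F, derivable a z 1) /\
      (derive1 a z - kappa * `|z| `^ q) / `|z| `^ q @[z --> F] --> (0 : R).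

Definition gluing_pair eta (X psi1 psi2 : C -> C) : Prop :=
  exists L Lp Lm : set C,
  exists psi1b psi2b : C -> one_point_compactification C,
  [/\ dividing_curve L Lp Lm,
      conformal (curve_int (S1 eta)) Lp psi1 /\
        conformal (curve_int (S2 eta)) Lm psi2,
      sphere_extension (S1 eta) psi1 psi1b /\
        sphere_extension (S2 eta) psi2 psi2b,
      (forall y, S2 eta y -> psi1b (X y) = psi2b y) /\
        (psi1b 1 = None /\ psi2b 1 = None) &
      (forall z, curve_int (S1 eta) z -> psi1 z^*%C = (psi1 z)^*%C) /\
        (forall z, curve_int (S2 eta) z -> psi2 z^*%C = (psi2 z)^*%C)].

(* g1 and g2 are what psi1 and psi2 stand for near 0. *)
Definition germs_at_0 p eta (psi1 psi2 g1 g2 : C -> C) : Prop :=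
  let I1 := curve_int (S1 eta) in let I2 := curve_int (S2 eta) in
  [/\ p 1 1 != 0 ->
        [/\ I1 0, I2 0, \forall z \near 0, g1 z = psi1 z &
            \forall z \near 0, g2 z = psi2 z],
      p 1 1 = 0 -> p 1 0 = p 0 1 ->
        [/\ S1 eta 0 /\ S2 eta 0, analytic_at g1 0, analytic_at g2 0,
            \forall z \near 0, I1 z -> g1 z = psi1 z &
            \forall z \near 0, I2 z -> g2 z = psi2 z],
      p 1 1 = 0 -> p 1 0 < p 0 1 ->
        [/\ I1 0, curve_ext (S2 eta) 0, \forall z \near 0, g1 z = psi1 z &
            continued_to_0 I2 psi2 g2] &
      p 1 1 = 0 -> p 0 1 < p 1 0 ->
        [/\ curve_ext (S1 eta) 0, I2 0, continued_to_0 I1 psi1 g1 &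
            \forall z \near 0, g2 z = psi2 z]].

(* uphalf (2m+1) = m+1, uphalf (2m) = m and n./2 = m in both cases. *)
Definition basis_poly (a b : C) (n : nat) : {poly C} :=
  ('X - a%:P) ^+ uphalf n * ('X - b%:P) ^+ n./2.

(* (P_n(g1 x) - P_n(g2 y)) / K(x, y) is the sum near (0, 0) of the power series
   sum_{i, j >= 1} h(i, j) x^(i-1) y^(j-1).  The identity is multiplied by
   K(x, y), which vanishes at the origin if p_{1,1} = 0. *)
Definition harmonic_expansion p (g1 g2 : C -> C) (n : nat)
    (h : int -> int -> R) : Prop :=
  let P := basis_poly (g1 0) (g2 0) n in
  (forall i j : int, i <= 0 \/ j <= 0 -> h i j = 0) /\
  \forall x \near (0 : C) & y \near (0 : C),
    exists2 v : C,
      has_usum (fun ij : nat * nat =>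
        (h ij.1.+1%:Z ij.2.+1%:Z)%:C * x ^+ ij.1 * y ^+ ij.2) v &
      walk_kernel p x y * v = P.[g1 x] - P.[g2 y].

(* Formal power series are given by their coefficient sequences. *)
Definition series0 : set (nat -> R) := [set a | a 0%N = 0].

(* [\sum_(n \in A)] sums the finitely many non-zero terms. *)
Definition Phi (h : nat -> int -> int -> R) (a : nat -> R) : int -> int -> R :=
  fun i j => \sum_(n \in [set n | (0 < n)%N]) a n * h n i j.

End Setting.

Arguments series0 {R}.

(* Main.v *)
Require Import Defs.
From mathcomp Require Import all_boot all_order all_algebra.
From mathcomp Require Import finmap complex.
From mathcomp Require Import all_classical all_reals all_analysis.
From mathcomp Require Import ring lra zify.
From mathcomp.analysis.showcase Require summability.
Import Order.TTheory GRing.Theory Num.Theory numFieldNormedType.Exports.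
Local Open Scope classical_set_scope.
Local Open Scope complex_scope.
Local Open Scope ring_scope.

Set Implicit Arguments.
Unset Strict Implicit.
Unset Printing Implicit Defensive.

(* Multiplying by K and comparing Taylor coefficients, the generating function
   H of a function vanishing outside N^2 satisfies K H = F(x) - G(y) exactly
   when that function is harmonic.  A harmonic function is determined by its
   values on the two axes of N^2 if p_{1,1} <> 0, and on one axis alone if
   p_{1,1} = 0; as P_n(g1) and P_n(g2) vanish to orders uphalf n and n./2, the
   family h_n is triangular with respect to a suitable enumeration of these
   boundary cells, provided that the germs g1 and g2 have order one at 0.

   The order is one because g - g(0) = A z^m + ... with m >= 2 and A real takes
   a real value at some non-real z, hence equal values at z and its conjugate,
   against the injectivity of psi.  If 0 lies on the curves, only a sector
   around the positive half-line is available and m = 2 has to be excluded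
   otherwise: g1 and g2 then have the same quadratic coefficient, so that the
   images of psi1 and psi2, which are disjoint, would share real values. *)

(** * Complex modulus *)

(** The power series of [g1] and [g2] are read off [h 1]: since P_1 = X - psi_1(0), the case n = 1
    is K H_1 = g1(x) - g2(y), and its restrictions to y = 0 and x = 0 expand both germs. The
    coefficients are real because [h 1] is, whence the symmetry of the germs under conjugation.
    Coefficients in two variables are compared along the lines y = w x: in each degree d the
    right-hand side contributes only w^0 and w^d. The arc on which a germ of order m takes a real
    value runs from argument pi/(2m) to 5 pi/(4m). For m >= 3 it stays within 5 pi/12 < pi/2, but
    for m = 2 it reaches 5 pi/8, beyond the imaginary axis. When 0 lies on the curves, these are
    tangent to the imaginary axis there, so that only sectors strictly inside the right half-plane
    are known to be interior; hence the separate argument for m = 2. The common quadratic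
    coefficient comes from the harmonicity of h_1 at (1, 1), and (K2) provides p_{0,1} > 0 in that
    case. *)

Section Modulus.
Variable R : realType.
Implicit Types (x y z : R[i]) (a : R).

(** The norm of [R[i]] has values in [R[i]]; taking the real part makes the order and the arithmetic
    of [R] available for estimates. *)
Definition modulus z : R := complex.Re `|z|.

Lemma normC_modulus z : `|z| = (modulus z)%:C.
Proof. by rewrite /modulus normc_def. Qed.

Lemma modulus_ge0 z : 0 <= modulus z.
Proof. by rewrite -ler0c -normC_modulus. Qed.

Lemma modulus_eq0 z : (modulus z == 0) = (z == 0).
Proof. by rewrite -(inj_eq (@complexI R)) -normC_modulus normr_eq0. Qed.

Lemma modulus0 : modulus 0 = 0.
Proof. by apply/eqP; rewrite modulus_eq0. Qed.

Lemma modulus1 : modulus 1 = 1.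
Proof. by apply: (@complexI R); rewrite -normC_modulus normr1. Qed.

Lemma modulus_gt0 z : (0 < modulus z) = (z != 0).
Proof. by rewrite lt_def modulus_eq0 modulus_ge0 andbT. Qed.

Lemma modulusM x y : modulus (x * y) = modulus x * modulus y.
Proof.
by apply: (@complexI R); rewrite -normC_modulus normrM !normC_modulus rmorphM.
Qed.

Lemma modulusX x n : modulus (x ^+ n) = modulus x ^+ n.
Proof. by elim: n => [|n IH]; rewrite ?expr0 ?modulus1 // !exprS modulusM IH. Qed.

Lemma modulusN x : modulus (- x) = modulus x.
Proof. by apply: (@complexI R); rewrite -!normC_modulus normrN. Qed.

Lemma modulusB x y : modulus (x - y) = modulus (y - x).
Proof. by rewrite -modulusN opprB. Qed.

Lemma modulusV x : modulus x^-1 = (modulus x)^-1.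
Proof. by apply: (@complexI R); rewrite -normC_modulus normfV normC_modulus fmorphV. Qed.

Lemma modulusD x y : modulus (x + y) <= modulus x + modulus y.
Proof. by rewrite -lecR rmorphD /= -!normC_modulus ler_normD. Qed.

Lemma modulusBD x y : modulus (x - y) <= modulus x + modulus y.
Proof. by rewrite -(modulusN y) modulusD. Qed.

Lemma modulusJ x : modulus x^*%C = modulus x.
Proof. by apply: (@complexI R); rewrite -!normC_modulus normcJ. Qed.

Lemma modulus_real a : modulus a%:C = `|a|.
Proof. by rewrite /modulus normc_def /= expr0n addr0 sqrtr_sqr. Qed.

Lemma modulus_sum (I : Type) (s : seq I) (P : pred I) (F : I -> R[i]) :
  modulus (\sum_(i <- s | P i) F i) <= \sum_(i <- s | P i) modulus (F i).
Proof.
elim/big_rec2: _ => [|i u v _ le_vu]; first by rewrite modulus0.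
by apply: le_trans (modulusD _ _) _; rewrite lerD2l.
Qed.

Lemma sqr_modulus z : modulus z ^+ 2 = complex.Re z ^+ 2 + complex.Im z ^+ 2.
Proof. by rewrite /modulus normc_def /= sqr_sqrtr // addr_ge0 ?sqr_ge0. Qed.

Lemma normRe_modulus z : `|complex.Re z| <= modulus z.
Proof. by rewrite -lecR -normC_modulus normc_ge_Re. Qed.

Lemma normIm_modulus z : `|complex.Im z| <= modulus z.
Proof.
rewrite -(ler_pXn2r (n := 2)) ?nnegrE ?modulus_ge0 // sqr_modulus.
by rewrite real_normK ?num_real // lerDr sqr_ge0.
Qed.

Lemma modulus_ReIm z : modulus z <= `|complex.Re z| + `|complex.Im z|.
Proof.
rewrite -(ler_pXn2r (n := 2)) ?nnegrE ?modulus_ge0 ?addr_ge0 // sqr_modulus.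
rewrite sqrrD !real_normK ?num_real // lerD2r lerDl.
by rewrite mulrn_wge0 // mulr_ge0.
Qed.

Lemma nearCP z (P : R[i] -> Prop) :
  (\forall w \near z, P w) <->
  exists2 e : R, 0 < e & forall w, modulus (w - z) < e -> P w.
Proof.
split.
- move=> /nbhs_normP[e /= e0 He].
  have eE : e = (complex.Re e)%:C by rewrite RRe_real // gtr0_real.
  exists (complex.Re e); first by rewrite -ltcR -eE.
  by move=> w wz; apply: He => /=; rewrite normC_modulus modulusB eE ltcR.
- move=> [e e0 He]; apply/nbhs_normP; exists e%:C; first by rewrite /= ltcR.
  by move=> w /=; rewrite normC_modulus modulusB ltcR => /He.
Qed.

End Modulus.

(** * Unordered sums *)

Section UnorderedSums.
Local Existing Instance summability.totally_filter.
Local Open Scope fset_scope.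
Local Open Scope ring_scope.

Lemma partial_sumE (I : choiceType) (V : zmodType) (f : I -> V) (A : {fset I}) :
  summability.partial_sum f A = \sum_(i <- A) f i.
Proof. by rewrite (big_seq_fsetE _ _ predT f). Qed.

Lemma has_usumP (I : choiceType) (K : numFieldType) (V : normedModType K)
    (f : I -> V) (v : V) :
  has_usum f v <-> forall e : K, 0 < e ->
    exists B : {fset I}, forall A, B `<=` A -> `|v - \sum_(i <- A) f i| < e.
Proof.
split.
- move=> /cvgrPdist_lt H e /H [B _ HB]; exists B => A BA.
  by have := HB A BA; rewrite /= partial_sumE.
- move=> H; apply/cvgrPdist_lt => e /H [B HB]; exists B => // A /HB.
  by rewrite /= partial_sumE.
Qed.

Lemma has_usum_unique (I : choiceType) (K : numFieldType) (V : normedModType K)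
    (f : I -> V) (v : V) : has_usum f v -> usum f = v.
Proof. by move=> H; apply: cvg_lim => //; exact: norm_hausdorff. Qed.

Lemma has_usum_fin (I : choiceType) (K : numFieldType) (V : normedModType K)
    (f : I -> V) (B : {fset I}) :
  (forall i, i \notin B -> f i = 0) -> has_usum f (\sum_(i <- B) f i).
Proof.
move=> fB; apply/has_usumP => e e0; exists B => A BA.
suff -> : \sum_(i <- A) f i = \sum_(i <- B) f i by rewrite subrr normr0.
by apply/esym/big_fset_incl => // i _ /fB.
Qed.

Lemma big_fset_split (I : choiceType) (V : zmodType) (f : I -> V) (A B : {fset I}) :
  B `<=` A -> \sum_(i <- A) f i = \sum_(i <- B) f i + \sum_(i <- A `\` B) f i.
Proof.
move=> BA; rewrite (big_fsetID _ (mem B)) /=; congr (_ + _); apply: eq_fbigl => i.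
  by rewrite !inE /=; apply: andb_idl => /(fsubsetP BA).
by rewrite !inE andbC.
Qed.

Lemma mem_fset_seq (I : choiceType) (s : seq I) i :
  (i \in [fset i in s]) = (i \in s).
Proof. by rewrite !inE. Qed.

Lemma big_fset_seq (I : choiceType) (V : zmodType) (f : I -> V) (s : seq I) :
  uniq s -> \sum_(i <- [fset i in s]) f i = \sum_(i <- s) f i.
Proof.
move=> us; apply: perm_big; apply: uniq_perm; rewrite ?fset_uniq // => i.
by rewrite !inE.
Qed.

Lemma has_usumD (I : choiceType) (K : numFieldType) (V : normedModType K)
    (f g : I -> V) (u v : V) :
  has_usum f u -> has_usum g v -> has_usum (fun i => f i + g i) (u + v).
Proof.
move=> /has_usumP Hf /has_usumP Hg; apply/has_usumP => e e0.
have e20 : 0 < e / 2 by rewrite divr_gt0.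
have [B1 H1] := Hf _ e20; have [B2 H2] := Hg _ e20.
exists (B1 `|` B2) => A; rewrite fsubUset => /andP[/H1 {}H1 /H2 {}H2].
rewrite big_split opprD addrACA (splitr e).
by apply: le_lt_trans (ler_normD _ _) _; apply: ltrD.
Qed.

Lemma has_usumN (I : choiceType) (K : numFieldType) (V : normedModType K)
    (f : I -> V) (v : V) :
  has_usum f v -> has_usum (fun i => - f i) (- v).
Proof.
move=> /has_usumP Hf; apply/has_usumP => e /Hf[B HB]; exists B => A /HB.
by rewrite sumrN -opprD normrN.
Qed.

(** Serves to pass from sums over the steps (k, l) to sums over the exponents (1 - k, 1 - l), the
    weights being zero off the range. *)
Lemma has_usum_reindex (I J : choiceType) (K : numFieldType)
    (V : normedModType K) (f : I -> V) (phi : J -> I) (v : V) :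
  injective phi -> (forall i, (forall j, phi j <> i) -> f i = 0) ->
  has_usum f v -> has_usum (f \o phi) v.
Proof.
move=> phiI f0 /has_usumP H; apply/has_usumP => e /H [B HB].
(* A partial inverse of [phi]; it pulls a finite set of indices back to [J], dropping those outside
   the range, whose terms are zero. *)
have /boolp.choice[psi psiP] : forall i, exists o : option J,
    if o is Some j then phi j = i else forall j, phi j <> i.
  move=> i; have [[j ji]|H'] := pselect (exists j, phi j = i).
    by exists (Some j).
  by exists None => j ji; apply: H'; exists j.
have pK : forall j, psi (phi j) = Some j.
  move=> j; have := psiP (phi j); case: (psi _) => [k /phiI ->//|/(_ j)//].
exists [fset j | j in pmap psi B] => A BA.
have := HB (B `|` phi @` A) (fsubsetUl _ _).
suff -> : \sum_(i <- B `|` phi @` A) f i = \sum_(i <- A) (f \o phi) i by [].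
transitivity (\sum_(i <- phi @` A) f i).
  apply/esym/big_fset_incl; first exact: fsubsetUr.
  move=> i; rewrite inE => /orP[iB|->//] iA; apply: f0 => j ji.
  move/negP: iA; apply; apply/imfsetP; exists j => //=.
  apply: (fsubsetP BA); rewrite !inE /= mem_pmap; apply/mapP; exists i => //.
  by rewrite -ji pK.
by rewrite big_imfset //= => x y _ _ /phiI.
Qed.

Variable R : realType.

Lemma has_usumCP (I : choiceType) (f : I -> R[i]) v :
  has_usum f v <-> forall e : R, 0 < e ->
    exists B : {fset I}, forall A, B `<=` A -> modulus (v - \sum_(i <- A) f i) < e.
Proof.
split.
- move=> /has_usumP H e e0; have [|B HB] := H e%:C; first by rewrite ltcR.
  by exists B => A /HB; rewrite normC_modulus ltcR.
- move=> H; apply/has_usumP => e e0.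
  have eE : e = (complex.Re e)%:C by rewrite RRe_real // gtr0_real.
  have [|B HB] := H (complex.Re e); first by rewrite -ltcR -eE.
  by exists B => A /HB; rewrite normC_modulus eE ltcR.
Qed.

(** The remainder after [B] is a limit of finite sums over sets disjoint from [B], so tails are
    estimated through finite sums only. *)
Lemma has_usum_tail (I : choiceType) (f : I -> R[i]) v (B : {fset I}) (c : R) :
  has_usum f v ->
  (forall A : {fset I}, [disjoint A & B] -> modulus (\sum_(i <- A) f i) <= c) ->
  modulus (v - \sum_(i <- B) f i) <= c.
Proof.
move=> /has_usumCP H HB; apply/ler_addgt0Pr => e /H [D HD].
have := HD _ (fsubsetUr B D); rewrite (big_fset_split _ (fsubsetUl B D)).
set A := (_ `\` _) => HA.
have /HB HA' : [disjoint A & B].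
  by apply/fdisjointP => i; rewrite !inE => /andP[].
set s := \sum_(i <- B) f i in HA *; set t := \sum_(i <- A) f i in HA HA' *.
have -> : v - s = (v - (s + t)) + t by rewrite opprD addrA subrK.
by apply: le_trans (modulusD _ _) _; rewrite addrC lerD // ltW.
Qed.

Lemma has_usum_bounded (I : choiceType) (f : I -> R[i]) v :
  has_usum f v -> exists M : R, forall i, modulus (f i) <= M.
Proof.
move=> /has_usumCP H; have [B HB] := H 1 ltr01.
(* A term outside [B] is the difference of the sums over [B] and over [B] with [i] added, both
   within 1 of [v]. *)
exists (2 + \sum_(i <- B) modulus (f i)) => i.
have [iB|iB] := boolP (i \in B).
  rewrite (big_fsetD1 i) //=; apply: ler_wpDl => //; rewrite lerDl.
  by rewrite sumr_ge0 // => *; exact: modulus_ge0.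
have -> : f i = (v - \sum_(j <- B) f j) - (v - \sum_(j <- i |` B) f j).
  by rewrite big_fsetU1 //=; ring.
apply: le_trans (modulusBD _ _) _.
have H1 := HB _ (fsubset_refl B); have H2 := HB _ (fsubsetU1 i B).
have : 0 <= \sum_(j <- B) modulus (f j) by rewrite sumr_ge0 // => *; exact: modulus_ge0.
lra.
Qed.

Lemma has_usumJ (I : choiceType) (f : I -> R[i]) v :
  has_usum f v -> has_usum (fun i => (f i)^*%C) v^*%C.
Proof.
move=> /has_usumCP H; apply/has_usumCP => e /H [B HB]; exists B => A /HB.
by rewrite -rmorph_sum -rmorphB modulusJ.
Qed.

Lemma has_usum_ge0_sum_le (I : choiceType) (f : I -> R) v (A : {fset I}) :
  (forall i, 0 <= f i) -> has_usum f v -> \sum_(i <- A) f i <= v.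
Proof.
move=> f0 /has_usumP H; apply/ler_addgt0Pr => e /H [B HB].
have := HB _ (fsubsetUr A B); rewrite (big_fset_split _ (fsubsetUl A B)).
set t := \sum_(i <- _ `\` _) _.
have : 0 <= t by rewrite sumr_ge0.
by rewrite ltr_distl => t0 /andP[]; lra.
Qed.

(** Comparison test, obtained from the completeness of [R] applied to the real and imaginary parts.
    It gives a meaning to [usum], which is a default value for families that are not summable. *)
Lemma usum_dominated (I : choiceType) (f : I -> R[i]) (g : I -> R) (s : R) :
  (forall i, modulus (f i) <= g i) -> has_usum g s -> has_usum f (usum f).
Proof.
move=> fg Hg.
suff [v Hv] : exists v, has_usum f v by rewrite (has_usum_unique Hv).
have key (h : I -> R) : (forall i, `|h i| <= g i) -> exists u, has_usum h u.
  move=> hg.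
  have /cauchy_cvg/cvg_ex[u Hu] : cauchy (summability.partial_sum h @ summability.totally).
    apply: cauchy_exP => e e0.
    move/has_usumP: Hg => /(_ (e / 2) ltac:(by rewrite divr_gt0)) [B HB].
    exists (\sum_(i <- B) h i); exists B => //= A BA.
    rewrite -ball_normE /= partial_sumE.
    rewrite (big_fset_split _ BA) opprD addNKr normrN.
    apply: le_lt_trans (ler_norm_sum _ _ _) _.
    apply: (@le_lt_trans _ _ (\sum_(i <- A `\` B) g i)); first exact: ler_sum.
    have := HB _ BA; have := HB _ (fsubset_refl B).
    rewrite (big_fset_split _ BA) !ltr_distl => /andP[? ?] /andP[? ?].
    lra.
  by exists u.
have [|u /has_usumP Hu] := key (fun i => complex.Re (f i)).
  by move=> i; apply: le_trans (fg i); exact: normRe_modulus.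
have [|w /has_usumP Hw] := key (fun i => complex.Im (f i)).
  by move=> i; apply: le_trans (fg i); exact: normIm_modulus.
exists (u +i* w); apply/has_usumCP => e e0.
have e20 : 0 < e / 2 by rewrite divr_gt0.
have [B1 H1] := Hu _ e20; have [B2 H2] := Hw _ e20.
exists (B1 `|` B2) => A; rewrite fsubUset => /andP[/H1 {}H1 /H2 {}H2].
apply: le_lt_trans (modulus_ReIm _) _; rewrite (splitr e).
have ReS : complex.Re (\sum_(i <- A) f i) = \sum_(i <- A) complex.Re (f i).
  by apply: (big_morph (@complex.Re R)) => // -[? ?] [].
have ImS : complex.Im (\sum_(i <- A) f i) = \sum_(i <- A) complex.Im (f i).
  by apply: (big_morph (@complex.Im R)) => // -[? ?] [].
move: ReS ImS H1 H2; case: (\sum_(i <- A) f i) => a b /= <- <-.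
exact: ltrD.
Qed.

End UnorderedSums.

(** * Power series with real coefficients *)

Section RealPowerSeries.
Variable R : realType.
Implicit Types (f g : R[i] -> R[i]) (c d : nat -> R) (x : R[i]).

Definition partial_series c x N : R[i] := \sum_(i < N) (c i)%:C * x ^+ i.

(* The constants do not depend on [N]: unlike an asymptotic expansion, this
   forces [f = 0] near [0] when all coefficients vanish. *)
Definition has_series f c : Prop := exists M q : R, [/\ 0 <= M, 0 < q &
  forall x N, q * modulus x <= 1 ->
    modulus (f x - partial_series c x N) <= M * (q * modulus x) ^+ N].

Definition cauchy_product c d n : R := \sum_(i < n.+1) c i * d (n - i)%N.

Lemma partial_seriesS c x N :
  partial_series c x N.+1 = partial_series c x N + (c N)%:C * x ^+ N.
Proof. exact: big_ord_recr. Qed.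

Lemma has_series_ext f g c (e : R) : 0 < e ->
  (forall x, modulus x < e -> f x = g x) -> has_series f c -> has_series g c.
Proof.
move=> e0 fg [M [q [M0 q0 H]]].
(* Adding [2 / e] to [q] makes the condition on [x] imply [modulus x <= e / 2], where [f] and [g]
   agree. *)
exists M, (q + 2 / e); split=> //; first by rewrite addr_gt0 ?divr_gt0.
move=> x N Hx; have x0 := modulus_ge0 x.
have He : 0 < e^-1 by rewrite invr_gt0.
have Hxe : modulus x < e.
  have : 2 / e * modulus x <= 1.
    by apply: le_trans Hx; rewrite (mulrDl q) lerDr mulr_ge0 // ltW.
  rewrite mulrAC ler_pdivrMr // mul1r; lra.
have Hq : q * modulus x <= (q + 2 / e) * modulus x.
  by rewrite (mulrDl q) lerDl mulr_ge0 // ltW // divr_gt0.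
rewrite -fg //; apply: le_trans (H x N (le_trans Hq Hx)) _.
by rewrite ler_wpM2l // lerXn2r // nnegrE ?mulr_ge0 // ltW // addr_gt0 // divr_gt0.
Qed.

(** A term is the difference of two consecutive remainders; the second one is no larger than the
    bound of the first, hence the factor 2. *)
Lemma has_series_coef f c (M q : R) x i : 
  (forall x N, q * modulus x <= 1 ->
    modulus (f x - partial_series c x N) <= M * (q * modulus x) ^+ N) ->
  0 <= M -> 0 < q -> q * modulus x <= 1 ->
  modulus ((c i)%:C * x ^+ i) <= 2 * M * (q * modulus x) ^+ i.
Proof.
move=> H M0 q0 qx.
have -> : (c i)%:C * x ^+ i =
    (f x - partial_series c x i) - (f x - partial_series c x i.+1).
  by rewrite partial_seriesS; ring.
apply: le_trans (modulusBD _ _) _.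
apply: le_trans (lerD (H x i qx) (H x i.+1 qx)) _.
have t0 : 0 <= q * modulus x by rewrite mulr_ge0 ?modulus_ge0 // ltW.
rewrite exprS; set t := q * modulus x in t0 qx *.
have : 0 <= t ^+ i by rewrite exprn_ge0.
have : t * t ^+ i <= t ^+ i by rewrite ler_piMl // exprn_ge0.
nra.
Qed.

Lemma has_series_const (a : R) :
  has_series (fun=> a%:C) (fun i => if i is 0 then a else 0).
Proof.
exists `|a|, 1; split=> // x [|N] _.
  by rewrite /partial_series big_ord0 subr0 expr0 mulr1 modulus_real.
rewrite /partial_series big_ord_recl /= expr0 mulr1 big1 ?addr0; last first.
  by move=> i _; rewrite mul0r.
by rewrite subrr modulus0 !mulr_ge0 // exprn_ge0 // mulr_ge0 // modulus_ge0.
Qed.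

Lemma has_series2 f g c d : has_series f c -> has_series g d ->
  exists M q : R, [/\ 0 <= M, 0 < q,
    forall x N, q * modulus x <= 1 ->
      modulus (f x - partial_series c x N) <= M * (q * modulus x) ^+ N &
    forall x N, q * modulus x <= 1 ->
      modulus (g x - partial_series d x N) <= M * (q * modulus x) ^+ N].
Proof.
move=> [M1 [q1 [M10 q10 H1]]] [M2 [q2 [M20 q20 H2]]].
have q120 : 0 <= q1 + q2 by rewrite ltW // addr_gt0.
exists (M1 + M2), (q1 + q2); split; [exact: addr_ge0|exact: addr_gt0| |];
  move=> x N qx; have x0 := modulus_ge0 x.
- have Hq : q1 * modulus x <= (q1 + q2) * modulus x.
    by rewrite (mulrDl _ _ (modulus x)) lerDl mulr_ge0 // ltW.
  apply: le_trans (H1 x N (le_trans Hq qx)) _.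
  have [? ?] : 0 <= q1 * modulus x /\ 0 <= (q1 + q2) * modulus x.
    by split; rewrite mulr_ge0 // ltW.
  by rewrite ler_pM ?exprn_ge0 ?lerXn2r ?nnegrE // lerDl.
- have Hq : q2 * modulus x <= (q1 + q2) * modulus x.
    by rewrite (mulrDl _ _ (modulus x)) lerDr mulr_ge0 // ltW.
  apply: le_trans (H2 x N (le_trans Hq qx)) _.
  have [? ?] : 0 <= q2 * modulus x /\ 0 <= (q1 + q2) * modulus x.
    by split; rewrite mulr_ge0 // ltW.
  by rewrite ler_pM ?exprn_ge0 ?lerXn2r ?nnegrE // lerDr.
Qed.

Lemma has_seriesD f g c d : has_series f c -> has_series g d ->
  has_series (fun x => f x + g x) (fun i => c i + d i).
Proof.
move=> Hf Hg; have [M [q [M0 q0 H1 H2]]] := has_series2 Hf Hg.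
exists (M + M), q; split=> //; first exact: addr_ge0.
move=> x N qx.
have -> : partial_series (fun i => c i + d i) x N =
    partial_series c x N + partial_series d x N.
  by rewrite /partial_series -big_split; apply: eq_bigr => i _; rewrite rmorphD mulrDl.
rewrite opprD addrACA mulrDl; apply: le_trans (modulusD _ _) _.
exact: lerD (H1 _ _ qx) (H2 _ _ qx).
Qed.

Lemma has_seriesN f c : has_series f c ->
  has_series (fun x => - f x) (fun i => - c i).
Proof.
move=> [M [q [M0 q0 H]]]; exists M, q; split=> // x N qx.
have -> : partial_series (fun i => - c i) x N = - partial_series c x N.
  by rewrite /partial_series -sumrN; apply: eq_bigr => i _; rewrite rmorphN mulNr.
by rewrite -opprD modulusN H.
Qed.

(** In this form the remainder of a product splits into remainders of the factors: the term of
    degree [i] of the first meets the truncation of the second at [N - i]. *)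
Lemma partial_series_cauchy_product c d x N :
  partial_series (cauchy_product c d) x N =
  \sum_(i < N) (c i)%:C * x ^+ i * partial_series d x (N - i).
Proof.
elim: N => [|N IH]; first by rewrite /partial_series !big_ord0.
rewrite partial_seriesS IH big_ord_recr /= subSnn.
rewrite [cauchy_product c d N]big_ord_recr /= rmorphD mulrDl addrA; congr (_ + _); last first.
  rewrite subnn /partial_series big_ord_recl big_ord0 addr0 /= expr0 mulr1.
  by rewrite rmorphM; ring.
rewrite rmorph_sum mulr_suml -big_split; apply: eq_bigr => i _ /=.
rewrite subSn; last exact: ltnW.
rewrite partial_seriesS mulrDr; congr (_ + _).
rewrite rmorphM -[N in x ^+ N](subnKC (ltnW (ltn_ord i))) exprD; ring.
Qed.

Lemma has_seriesM f g c d : has_series f c -> has_series g d ->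
  has_series (fun x => f x * g x) (cauchy_product c d).
Proof.
move=> Hf Hg; have [M [q [M0 q0 H1 H2]]] := has_series2 Hf Hg.
(* The estimate produces (1 + 2 N) M^2 t^N with t = q |x|; since 1 + 2 N <= 2 * 2^N, doubling [q]
   absorbs the factor that grows with [N]. *)
exists (2 * M ^+ 2), (2 * q); split; [by rewrite mulr_ge0 ?exprn_ge0|by rewrite mulr_gt0|].
move=> x N q2x; have x0 := modulus_ge0 x.
have t0 : 0 <= q * modulus x by rewrite mulr_ge0 // ltW.
have qx : q * modulus x <= 1 by apply: le_trans q2x; rewrite -mulrA; lra.
rewrite partial_series_cauchy_product.
have -> : f x * g x - \sum_(i < N) (c i)%:C * x ^+ i * partial_series d x (N - i) =
    (f x - partial_series c x N) * g x +
    \sum_(i < N) (c i)%:C * x ^+ i * (g x - partial_series d x (N - i)).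
  under [in RHS]eq_bigr do rewrite mulrBr.
  by rewrite sumrB -mulr_suml -/(partial_series c x N); ring.
apply: le_trans (modulusD _ _) _; rewrite modulusM.
set t := q * modulus x in t0 qx *.
have Hg0 : modulus (g x) <= M.
  by have := H2 x 0 qx; rewrite /partial_series big_ord0 subr0 expr0 mulr1.
apply: (@le_trans _ _ (M * t ^+ N * M + \sum_(i < N) 2 * M ^+ 2 * t ^+ N)).
  apply: lerD; first by rewrite ler_pM ?modulus_ge0 // H1.
  apply: le_trans (modulus_sum _ _ _) _; apply: ler_sum => i _.
  rewrite modulusM -[N in t ^+ N](subnKC (ltnW (ltn_ord i))) exprD.
  apply: (@le_trans _ _ ((2 * M * t ^+ i) * (M * t ^+ (N - i)))).
    by rewrite ler_pM ?modulus_ge0 // ?H2 //; exact: (has_series_coef _ H1).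
  by rewrite expr2 le_eqVlt; apply/orP; left; apply/eqP; ring.
rewrite sumr_const card_ord.
have N2 : (1 + 2 * N%:R : R) <= 2 * 2 ^+ N.
  rewrite -natrX -!natrM -[1]/(1%:R) -natrD ler_nat.
  by elim: (N) => // k IH; rewrite expnS; lia.
have tN : 0 <= M ^+ 2 * t ^+ N by rewrite mulr_ge0 ?exprn_ge0.
rewrite -[2 * q * _]mulrA -/t (exprMn N 2 t).
rewrite [X in X <= _](_ : _ = (1 + 2 * N%:R) * (M ^+ 2 * t ^+ N)); last first.
  by rewrite -(mulr_natr _ N); ring.
rewrite [X in _ <= X](_ : _ = (2 * 2 ^+ N) * (M ^+ 2 * t ^+ N)); last by ring.
exact: ler_wpM2r.
Qed.

Lemma has_series_coef_eq0 f c : has_series f c ->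
  (exists2 e : R, 0 < e & forall x, modulus x < e -> f x = 0) ->
  forall i, c i = 0.
Proof.
move=> [M [q [M0 q0 H]]] [e e0 fe]; elim/ltn_ind => n IH.
apply/eqP/negPn/negP; rewrite -normr_gt0 => cn0.
(* With [n] the first non-zero coefficient, the remainder bound at a real point [a] gives |c_n| <= M
   q^(n+1) a. The three parts of [D] make a = |c_n| / D satisfy q a <= 1, a < e and M q^(n+1) a <
   |c_n|. *)
set D := (q + 2 * e^-1) * `|c n| + M * q ^+ n.+1 + 1.
have ei : 0 < e^-1 by rewrite invr_gt0.
have qn : 0 < q ^+ n.+1 by rewrite exprn_gt0.
have Mq : 0 <= M * q ^+ n.+1 by rewrite mulr_ge0 // ltW.
have D0 : 0 < D.
  apply: ltr_wpDl => //; apply: addr_ge0 => //.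
  by rewrite ltW // mulr_gt0 // addr_gt0 // mulr_gt0.
set a := `|c n| / D; have a0 : 0 < a by rewrite divr_gt0.
have aD : a * D = `|c n| by rewrite /a mulfVK // gt_eqF.
have xa : modulus a%:C = a by rewrite modulus_real gtr0_norm.
have qa : q * a <= 1.
  rewrite /a mulrA ler_pdivrMr // mul1r /D mulrDl.
  have := mulr_gt0 ei cn0; lra.
have ae : a < e.
  rewrite /a ltr_pdivrMr // /D.
  have h1 : e * e^-1 = 1 by rewrite divff // gt_eqF.
  have h2 : 0 <= e * (q * `|c n| + M * q ^+ n.+1 + 1).
    by rewrite mulr_ge0 ?addr_ge0 ?mulr_ge0 // ltW.
  have -> : e * ((q + 2 * e^-1) * `|c n| + M * q ^+ n.+1 + 1) =
    2 * (e * e^-1) * `|c n| + e * (q * `|c n| + M * q ^+ n.+1 + 1) by ring.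
  rewrite h1; lra.
clearbody a; have := H a%:C n.+1; rewrite xa => /(_ qa).
rewrite fe ?xa // sub0r modulusN partial_seriesS /partial_series big1 ?add0r; last first.
  by move=> i _; rewrite IH // mul0r.
rewrite modulusM modulusX xa modulus_real exprMn [a ^+ n.+1]exprS.
have an : 0 < a ^+ n by rewrite exprn_gt0.
rewrite [X in _ <= X](_ : _ = M * q ^+ n.+1 * a * a ^+ n); last by ring.
rewrite ler_pM2r //; apply/negP; rewrite -ltNge -aD mulrC ltr_pM2l // /D.
have : 0 < (q + 2 * e^-1) * `|c n| by rewrite mulr_gt0 ?addr_gt0 ?mulr_gt0.
lra.
Qed.

Lemma has_series_unique f g c d (e : R) : 0 < e ->
  (forall x, modulus x < e -> f x = g x) ->
  has_series f c -> has_series g d -> c = d.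
Proof.
move=> e0 fg Hf Hg; apply/funext => i; apply/subr0_eq.
apply: (has_series_coef_eq0 (has_seriesD Hf (has_seriesN Hg))).
by exists e => // x /fg ->; rewrite subrr.
Qed.

(** For |x| < 1 / (2 q) the bounds read |f(x)| <= M 2^(-N) for every [N], with the same [M]. *)
Lemma has_series_eq0 f c : has_series f c -> (forall i, c i = 0) ->
  exists2 e : R, 0 < e & forall x, modulus x < e -> f x = 0.
Proof.
move=> [M [q [M0 q0 H]]] c0; exists (2 * q)^-1; first by rewrite invr_gt0 mulr_gt0.
move=> x; rewrite -[_^-1]mul1r ltr_pdivlMr ?mulr_gt0 // => xq.
have t2 : q * modulus x <= 2^-1.
  by rewrite -[2^-1]mul1r ler_pdivlMr // ltW //; lra.
have t0 : 0 <= q * modulus x by rewrite mulr_ge0 ?modulus_ge0 // ltW.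
apply/eqP; rewrite -modulus_eq0; apply/eqP/le_anti; rewrite modulus_ge0 andbT.
have Hf N : modulus (f x) <= M * 2^-1 ^+ N.
  have := H x N; rewrite /partial_series big1 ?subr0; last first.
    by move=> i _; rewrite c0 mul0r.
  move=> /(_ ltac:(lra)) /le_trans; apply.
  by rewrite ler_wpM2l // lerXn2r // nnegrE.
rewrite leNgt; apply/negP => v0.
have := archi_boundP (divr_ge0 M0 (ltW v0)); move: (Num.bound _) => N.
rewrite ltr_pdivrMr // => MN; have := Hf N.
rewrite exprVn ler_pdivlMr ?exprn_gt0 //; apply/negP; rewrite -ltNge.
apply: lt_le_trans MN _; rewrite mulrC ler_pM2l // -natrX ler_nat.
exact/ltnW/ltn_expl.
Qed.

Lemma has_series_lead f c k : has_series f c -> (forall i, (i < k)%N -> c i = 0) ->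
  exists C e : R, [/\ 0 <= C, 0 < e & forall x, modulus x < e ->
    modulus (f x - (c k)%:C * x ^+ k) <= C * modulus x ^+ k.+1].
Proof.
move=> [M [q [M0 q0 H]]] ck; exists (M * q ^+ k.+1), q^-1.
split; [by rewrite mulr_ge0 // exprn_ge0 // ltW|by rewrite invr_gt0|].
move=> x; rewrite -[_^-1]mul1r ltr_pdivlMr // mulrC => /ltW /(H x k.+1).
rewrite partial_seriesS /partial_series big1 ?add0r; last first.
  by move=> i _; rewrite ck // mul0r.
by rewrite exprMn mulrA.
Qed.

Lemma conjcB x y : (x - y)^*%C = x^*%C - y^*%C.
Proof. exact: (rmorphB (@conjc R)). Qed.

Lemma conjcM x y : (x * y)^*%C = x^*%C * y^*%C.
Proof. exact: (rmorphM (@conjc R)). Qed.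

Lemma conjcX x n : (x ^+ n)^*%C = x^*%C ^+ n.
Proof. exact: (rmorphXn (@conjc R)). Qed.

Lemma partial_seriesJ c x N : partial_series c x^*%C N = (partial_series c x N)^*%C.
Proof.
rewrite /partial_series (rmorph_sum (@conjc R)); apply: eq_bigr => i _.
by rewrite /= conjcM conjcX conjc_real.
Qed.

(** Conjugating both argument and value gives a function with the same real coefficients, so the
    difference has the zero series and vanishes near 0. *)
Lemma has_seriesJ f c : has_series f c ->
  exists2 e : R, 0 < e & forall x, modulus x < e -> f x^*%C = (f x)^*%C.
Proof.
move=> Hf.
have HJ : has_series (fun x => (f x^*%C)^*%C) c.
  have [M [q [M0 q0 H]]] := Hf; exists M, q; split=> // x N qx.
  rewrite -(modulusJ x); apply: le_trans (H x^*%C N _); last by rewrite modulusJ.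
  by rewrite -[X in _ <= X]modulusJ conjcB partial_seriesJ conjcK.
have [|e e0 He] := has_series_eq0 (has_seriesD Hf (has_seriesN HJ)).
  by move=> i; rewrite subrr.
exists e => // x xe; apply/eqP; rewrite -subr_eq0.
by have := He x^*%C; rewrite modulusJ => /(_ xe); rewrite conjcK => ->.
Qed.

End RealPowerSeries.

(** * Double series along lines *)

Section DoubleSeries.
Variable R : realType.
Implicit Types (c : nat -> nat -> R) (x y t : R[i]).

Lemma ler_sum_subseq (I : eqType) (s s' : seq I) (g : I -> R) :
  uniq s -> uniq s' -> {subset s <= s'} -> (forall i, 0 <= g i) ->
  \sum_(i <- s) g i <= \sum_(i <- s') g i.
Proof.
move=> us us' ss' g0.
have ps : perm_eq s [seq i <- s' | i \in s].
  apply: uniq_perm => //; first exact: filter_uniq.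
  by move=> i; rewrite mem_filter andb_idr // => /ss'.
rewrite (perm_big _ ps) big_filter big_mkcond /=; apply: ler_sum => i _.
by case: ifP.
Qed.

Lemma sum_geometric_half (D : nat) : \sum_(i <- iota 0 D) (2^-1 : R) ^+ i <= 2.
Proof.
suff -> : \sum_(i <- iota 0 D) (2^-1 : R) ^+ i = 2 - 2 * 2^-1 ^+ D.
  have : 0 <= (2^-1 : R) ^+ D by rewrite exprn_ge0.
  lra.
elim: D => [|D IH]; first by rewrite big_nil expr0 mulr1 subrr.
rewrite -addn1 iotaD big_cat /= big_cons big_nil IH add0n addr0 addn1 exprS.
lra.
Qed.

Lemma sum_geometric2_half (A : {fset nat * nat}) :
  \sum_(ij <- A) (2^-1 : R) ^+ (ij.1 + ij.2) <= 4.
Proof.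
pose D := (\max_(ij <- enum_fset A) maxn ij.1 ij.2).+1.
pose s := [seq (i, j) | i <- iota 0 D, j <- iota 0 D].
apply: (@le_trans _ _ (\sum_(ij <- s) (2^-1 : R) ^+ (ij.1 + ij.2))).
  apply: ler_sum_subseq => //.
  - by apply: allpairs_uniq; rewrite ?iota_uniq // => -[? ?] [? ?].
  - move=> [i j] ijA; apply/allpairsP; exists (i, j).
    have : (maxn i j < D)%N by rewrite ltnS (leq_bigmax_seq (F := fun ij => maxn ij.1 ij.2) (i, j)).
    by rewrite gtn_max => /andP[iD jD]; split; rewrite ?mem_iota.
rewrite /s big_allpairs; clearbody D.
under eq_bigr do (under eq_bigr do rewrite exprD); rewrite /=.
under eq_bigr do rewrite -mulr_sumr.
rewrite -mulr_suml (_ : 4 = 2 * 2); last by ring.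
apply: ler_pM; try exact: sum_geometric_half.
all: by apply: sumr_ge0 => *; rewrite exprn_ge0.
Qed.

(** The coefficient of t^d in the double series taken along the line t -> (t u, t w). *)
Definition diag_coef c (u w : R) d : R :=
  \sum_(b < d.+1) c (d - b)%N b * u ^+ (d - b) * w ^+ b.

Definition double_family c x y (ij : nat * nat) : R[i] :=
  (c ij.1 ij.2)%:C * x ^+ ij.1 * y ^+ ij.2.

(** Listed by antidiagonals, so that a sum over it is a truncation, at order [N], of the series
    along a line. *)
Definition triangle N : seq (nat * nat) :=
  [seq ((d - b)%N, b) | d <- iota 0 N, b <- iota 0 d.+1].

Lemma triangle_uniq N : uniq (triangle N).
Proof.
apply: allpairs_uniq_dep; rewrite ?iota_uniq //; first by move=> *; exact: iota_uniq.
case=> d b [d' b'] /allpairsPdep[x [y [_ hy e]]] /allpairsPdep[x' [y' [_ hy' e']]].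
move: hy hy'; rewrite !mem_iota => hy hy'.
case: e hy => -> -> hy; case: e' hy' => -> -> hy' /= [].
move=> e1 e2; rewrite e2; congr (existT (fun=> nat) _ y'); lia.
Qed.

Lemma mem_triangle N i j : ((i, j) \in triangle N) = (i + j < N)%N.
Proof.
apply/allpairsPdep/idP => [[d [b [+ + [-> ->]]]]|ijN].
  by rewrite !mem_iota; lia.
by exists (i + j)%N, j; rewrite !mem_iota addnK; split => //; lia.
Qed.

Lemma sum_triangle c (u w : R) t N :
  \sum_(ij <- triangle N) double_family c (t * u%:C) (t * w%:C) ij =
  partial_series (diag_coef c u w) t N.
Proof.
rewrite /triangle big_allpairs_dep /partial_series.
rewrite -[N in iota 0 N]subn0 -/(index_iota 0 N) big_mkord; apply: eq_bigr => d _.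
rewrite -[X in iota 0 X]subn0 -/(index_iota 0 d.+1) big_mkord.
rewrite rmorph_sum mulr_suml.
apply: eq_bigr => b _; rewrite /double_family /=.
rewrite !rmorphM !rmorphXn /= !exprMn.
rewrite -[in X in _ = _ * X](subnK (n := d) (m := b)) ?exprD; last by rewrite -ltnS.
by ring.
Qed.

(** Mere summability at the real point (e/2, e/2) bounds its terms, which gives |c_ij| <= M
    (2/e)^(i+j) and geometric tails along every line. *)
Lemma has_series_diag c (F : R[i] -> R[i] -> R[i]) (e : R) : 0 < e ->
  (forall x y, modulus x < e -> modulus y < e ->
     has_usum (double_family c x y) (F x y)) ->
  forall u w : R, 0 <= u <= 1 -> 0 <= w <= 1 ->
  has_series (fun t => F (t * u%:C) (t * w%:C)) (diag_coef c u w).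
Proof.
move=> e0 HF u w /andP[u0 u1] /andP[w0 w1].
have e20 : 0 < e / 2 by rewrite divr_gt0.
have m2 : modulus (e / 2)%:C = e / 2 by rewrite modulus_real gtr0_norm.
have [||M HM] := has_usum_bounded (HF (e / 2)%:C (e / 2)%:C _ _).
- by rewrite m2; lra.
- by rewrite m2; lra.
set r := (e / 2)^-1.
have r0 : 0 < r by rewrite invr_gt0.
have Mge0 : 0 <= M by apply: le_trans (HM (0%N, 0%N)); exact: modulus_ge0.
have cM i j : `|c i j| <= M * r ^+ (i + j).
  have := HM (i, j); rewrite /double_family /= !modulusM !modulusX m2 modulus_real.
  by rewrite -mulrA -exprD -ler_pdivlMr ?exprn_gt0 // -exprVn.
(* With s = r |t| and i + j >= N one has s^(i+j) <= (4 s)^N 2^(-(i+j)), and the powers 2^(-(i+j))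
   have sum at most 4 over all pairs. *)
exists (4 * M), (4 * r); split; [by rewrite mulr_ge0|by rewrite mulr_gt0|].
move=> t N rt; have t0 := modulus_ge0 t.
have te : modulus t < e.
  have : r * modulus t <= 1.
    by apply: le_trans rt; rewrite -mulrA ler_peMl ?mulr_ge0 ?ler1n // ltW.
  rewrite /r mulrC ler_pdivrMr // mul1r; lra.
have le1 (a : R) : 0 <= a <= 1 -> modulus (t * a%:C) <= modulus t.
  by move=> /andP[a0 a1]; rewrite modulusM modulus_real ger0_norm // ler_piMr.
have xt := le1 u ltac:(by rewrite u0 u1); have yt := le1 w ltac:(by rewrite w0 w1).
rewrite -sum_triangle.
have trE : \sum_(ij <- [fset ij in triangle N]%fset)
    double_family c (t * u%:C) (t * w%:C) ij =
    \sum_(ij <- triangle N) double_family c (t * u%:C) (t * w%:C) ij.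
  exact/big_fset_seq/triangle_uniq.
rewrite -trE; apply: has_usum_tail.
  by apply: HF; apply: le_lt_trans te.
move=> A /fdisjointP AB.
set s := r * modulus t.
have s0 : 0 <= s by rewrite mulr_ge0 // ltW.
have s4 : 4 * s <= 1 by rewrite mulrA.
apply: le_trans (modulus_sum _ _ _) _.
apply: (@le_trans _ _ (\sum_(ij <- A) M * (4 * s) ^+ N * 2^-1 ^+ (ij.1 + ij.2))).
  rewrite big_seq [X in _ <= X]big_seq; apply: ler_sum => -[i j] ijA.
  have := AB _ ijA; rewrite !inE /= mem_triangle -leqNgt => Nij.
  rewrite /double_family /= !modulusM !modulusX modulus_real.
  apply: (@le_trans _ _ (M * s ^+ (i + j))).
    apply: (@le_trans _ _ (M * r ^+ (i + j) * modulus t ^+ i * modulus t ^+ j)).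
      by rewrite !ler_pM ?mulr_ge0 ?exprn_ge0 ?modulus_ge0 // ?lerXn2r ?nnegrE ?modulus_ge0 // -modulusM.
    by rewrite /s exprMn !exprD; rewrite le_eqVlt; apply/orP; left; apply/eqP; ring.
  rewrite -mulrA ler_wpM2l //.
  rewrite (_ : s = 2 * s * 2^-1); last by field.
  rewrite exprMn ler_wpM2r ?exprn_ge0 //.
  apply: (@le_trans _ _ ((4 * (2 * s * 2^-1)) ^+ (i + j))).
    by apply: lerXn2r; rewrite ?nnegrE ?mulr_ge0 //; lra.
  by apply: ler_wiXn2l => //; lra.
rewrite -mulr_sumr mulrAC [4 * M]mulrC -[4 * r * _]mulrA -/s.
apply: ler_wpM2r; first by rewrite exprn_ge0 // mulr_ge0.
by rewrite ler_wpM2l // sum_geometric2_half.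
Qed.

End DoubleSeries.

(** * Taylor coefficients in the equation K(x, y) V(x, y) = F(x) - G(y) *)

Section Products.
Variable R : realType.
Implicit Types (k H : nat -> nat -> R) (x y t : R[i]) (F G : R[i] -> R[i]).

Definition conv2 k H i j : R :=
  \sum_(a < i.+1) \sum_(b < j.+1) k a b * H (i - a)%N (j - b)%N.

Lemma diag_coef10 k d : diag_coef k 1 0 d = k d 0%N.
Proof.
rewrite /diag_coef big_ord_recl big1 => [|b _]; last by rewrite expr0n mulr0.
by rewrite subn0 expr1n expr0 !mulr1 addr0.
Qed.

Lemma diag_coef01 k d : diag_coef k 0 1 d = k 0%N d.
Proof.
rewrite /diag_coef big_ord_recr big1 /= => [|b _].
  by rewrite subnn expr1n expr0 !mulr1 add0r.
by rewrite expr0n subn_eq0 leqNgt ltn_ord mulr0 mul0r.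
Qed.

Lemma has_series_scale F (c : nat -> R) (w : R) : 0 <= w <= 1 -> has_series F c ->
  has_series (fun t => F (t * w%:C)) (fun d => c d * w ^+ d).
Proof.
move=> /andP[w0 w1] [M [q [M0 q0 HF]]]; exists M, q; split=> // t N qt.
have twt : modulus (t * w%:C) <= modulus t.
  by rewrite modulusM modulus_real ger0_norm // ler_piMr // modulus_ge0.
have qtw : q * modulus (t * w%:C) <= q * modulus t by rewrite ler_pM2l.
have -> : partial_series (fun d => c d * w ^+ d) t N = partial_series c (t * w%:C) N.
  apply: eq_bigr => i _; rewrite rmorphM rmorphXn /= exprMn; ring.
apply: le_trans (HF _ _ (le_trans qtw qt)) _.
by rewrite ler_wpM2l // lerXn2r // nnegrE mulr_ge0 ?modulus_ge0 // ltW.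
Qed.

(** The homogeneous part of degree [d] at (1, w), as a polynomial in the slope w: identities on all
    lines become polynomial identities. *)
Definition diagonal_poly k d : {poly R} := \poly_(b < d.+1) k (d - b)%N b.

Lemma horner_diagonal_poly k d w : (diagonal_poly k d).[w] = diag_coef k 1 w d.
Proof.
by rewrite horner_poly; apply: eq_bigr => b _; rewrite expr1n mulr1.
Qed.

(** The total degree i + j and the power j of the slope determine the monomial, so both exponents
    can be recovered from the lines. *)
Lemma coef_conv_diagonal_poly k H i j :
  (\sum_(e < (i + j).+1) diagonal_poly k e * diagonal_poly H (i + j - e))`_j =
  conv2 k H i j.
Proof.
rewrite coef_sum; under eq_bigr do rewrite coefM.
rewrite exchange_big /conv2 [RHS]exchange_big /=; apply: eq_bigr => b _.
have bj : (b <= j)%N by rewrite -ltnS.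
rewrite -(big_mkord xpredT (fun e => (diagonal_poly k e)`_b *
  (diagonal_poly H (i + j - e))`_(j - b))).
rewrite -(big_mkord xpredT (fun a => k a b * H (i - a)%N (j - b)%N)).
(* For fixed [b] only b <= e <= i + b contributes: below, [b] exceeds the degree of the first
   factor, and above, [j - b] exceeds that of the second. Then e = a + b. *)
rewrite (big_cat_nat (n := b)) //=; last lia.
rewrite [\sum_(0 <= e < b) _]big_nat_cond big1 ?add0r => [|e /andP[/andP[_ eb] _]]; last first.
  by rewrite coef_poly ltnS leqNgt eb mul0r.
rewrite (big_cat_nat (n := (i + b).+1)) //=; try lia.
rewrite [\sum_((i + b).+1 <= e < _) _]big_nat_cond [\sum_((i + b).+1 <= e < _ | _) _]big1 ?addr0 => [|e /andP[/andP[eb eij] _]]; last first.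
  rewrite [X in _ * X]coef_poly ifF ?mulr0 //; lia.
rewrite -{1}[b : nat]add0n -addSn big_addn addnK.
rewrite !big_nat; apply: eq_bigr => a /= ai.
rewrite !coef_poly !ifT; try lia.
by congr (k _ _ * H _ _); lia.
Qed.

(** The points 1/(n+1) provide more roots than the degree allows. Slopes are confined to [0, 1] so
    that the lines do not leave the bidisk. *)
Lemma poly_eq0_unit_interval (Q : {poly R}) :
  (forall w : R, 0 <= w <= 1 -> Q.[w] = 0) -> Q = 0.
Proof.
move=> Q0; pose s := [seq (n.+1%:R)^-1 : R | n <- iota 0 (size Q)].
apply/eqP; apply: contraT => Qn0.
have := @max_poly_roots R Q s Qn0; rewrite size_map size_iota ltnn => H.
apply: H; first by apply/allP => w /mapP[n _ ->]; rewrite rootE Q0 // invr_ge0 ler0n /= invf_le1 ?ltr0Sn // ler1n.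
rewrite map_inj_uniq ?iota_uniq // => m n /invr_inj /eqP.
by rewrite eqr_nat => /eqP[].
Qed.

Lemma has_series_at0 F (c : nat -> R) : has_series F c -> F 0 = (c 0%N)%:C.
Proof.
move=> [M [q [M0 q0 HF]]]; apply/eqP; rewrite -subr_eq0 -modulus_eq0.
have := HF 0 1%N; rewrite modulus0 mulr0 ler01 expr1 mulr0 => /(_ isT).
rewrite /partial_series big_ord1 expr0 mulr1 => le0.
by apply/eqP/le_anti; rewrite le0 modulus_ge0.
Qed.

Section Expansion.
Variables (k H : nat -> nat -> R) (Kf Vf : R[i] -> R[i] -> R[i]).
Variables (F G : R[i] -> R[i]) (e : R).
Hypothesis e_gt0 : 0 < e.
Hypothesis HK : forall x y, modulus x < e -> modulus y < e ->
  has_usum (double_family k x y) (Kf x y).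
Hypothesis HV : forall x y, modulus x < e -> modulus y < e ->
  has_usum (double_family H x y) (Vf x y).
Hypothesis KV : forall x y, modulus x < e -> modulus y < e ->
  Kf x y * Vf x y = F x - G y.

Let in01 : (0 <= (0 : R) <= 1) * (0 <= (1 : R) <= 1).
Proof. by rewrite !lexx ler01. Qed.

Lemma product_series (u w : R) : 0 <= u <= 1 -> 0 <= w <= 1 ->
  has_series (fun t => F (t * u%:C) - G (t * w%:C))
             (cauchy_product (diag_coef k u w) (diag_coef H u w)).
Proof.
move=> u01 w01.
have := has_seriesM (has_series_diag e_gt0 HK u01 w01)
                    (has_series_diag e_gt0 HV u01 w01).
have le1 t (a : R) : 0 <= a <= 1 -> modulus t < e -> modulus (t * a%:C) < e.
  move=> /andP[a0 a1]; apply: le_lt_trans.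
  by rewrite modulusM modulus_real ger0_norm // ler_piMr // modulus_ge0.
apply: (has_series_ext e_gt0) => t te.
by rewrite KV // le1.
Qed.

Lemma first_axis_series : has_series (fun x => F x - G 0) (fun i => conv2 k H i 0).
Proof.
have := product_series in01.2 in01.1.
have -> : cauchy_product (diag_coef k 1 0) (diag_coef H 1 0) = (fun i => conv2 k H i 0).
  apply/funext => i; apply: eq_bigr => a _.
  by rewrite !diag_coef10 big_ord1 subn0.
by apply: (has_series_ext e_gt0) => t _; rewrite mulr1 mulr0.
Qed.

Lemma second_axis_series : has_series (fun y => F 0 - G y) (fun j => conv2 k H 0 j).
Proof.
have := product_series in01.1 in01.2.
have -> : cauchy_product (diag_coef k 0 1) (diag_coef H 0 1) = (fun j => conv2 k H 0 j).
  apply/funext => i; rewrite /conv2 big_ord1; apply: eq_bigr => a _.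
  by rewrite !diag_coef01 subn0.
by apply: (has_series_ext e_gt0) => t _; rewrite mulr1 mulr0.
Qed.

(** On the line y = w x, the coefficient of degree d = i + j of F(x) - G(w x) is A + B w^d, where A
    and B come from the two axes. Since 0 < j < d, the power w^j is absent. *)
Lemma conv2_interior i j : (0 < i)%N -> (0 < j)%N -> conv2 k H i j = 0.
Proof.
move=> i0 j0; pose d := (i + j)%N.
pose Q := \sum_(e < d.+1) diagonal_poly k e * diagonal_poly H (d - e).
pose A := conv2 k H d 0; pose B := conv2 k H 0 d.
have QE : Q - A%:P - B *: 'X^d = 0.
  apply: poly_eq0_unit_interval => w w01.
  have H1 := product_series in01.2 w01.
  (* The sum of the two axis series counts the value at the origin twice; the correction affects
     degree 0 only. *)
  have Hc : has_series (fun=> - (F 0 - G 0))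
      (fun i => - (if i is 0 then conv2 k H 0 0 else 0)).
    rewrite (has_series_at0 first_axis_series).
    exact/has_seriesN/has_series_const.
  have H2 := has_seriesD (has_seriesD first_axis_series
    (has_series_scale w01 second_axis_series)) Hc.
  have E t : modulus t < e -> F (t * 1%:C) - G (t * w%:C) =
      F t - G 0 + (F 0 - G (t * w%:C)) + - (F 0 - G 0).
    by move=> _; rewrite mulr1; ring.
  have /(congr1 (fun f : nat -> R => f d)) /= := has_series_unique e_gt0 E H1 H2.
  have -> : cauchy_product (diag_coef k 1 w) (diag_coef H 1 w) d = Q.[w].
    rewrite /Q horner_sum; apply: eq_bigr => a _.
    by rewrite hornerM !horner_diagonal_poly.
  rewrite !hornerE => ->.
  have -> : (if d is 0 then conv2 k H 0 0 else 0) = 0 by rewrite /d; case: (i) i0.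
  rewrite -/A -/B; ring.
rewrite -coef_conv_diagonal_poly -/d -/Q.
have -> : Q = A%:P + B *: 'X^d by apply/eqP; rewrite -subr_eq0 opprD addrA QE.
by rewrite coefD coefC coefZ coefXn gtn_eqF // ltn_eqF ?mulr0 ?addr0 // /d -{1}[j]add0n ltn_add2r.
Qed.

End Expansion.
End Products.

(** * The kernel and the discrete Laplacian *)

Section Kernel.
Variables (R : realType) (p : int -> int -> R).
Hypothesis Hp : admissible_weights p.
Implicit Types (x y : R[i]) (h : int -> int -> R).

(* The coefficient of [x ^ a * y ^ b] in [x * y - K(x, y)]. *)
Definition jump (a b : nat) : R := p (1 - a%:Z) (1 - b%:Z).

Definition kernel_coef (a b : nat) : R := ((a == 1%N) && (b == 1%N))%:R - jump a b.

(** By (H1) all the weight lies on the range of this map, so the integer powers in the kernel become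
    natural ones. *)
Definition jump_index (ab : nat * nat) : int * int := (1 - ab.1%:Z, 1 - ab.2%:Z).

Lemma jump_index_inj : injective jump_index.
Proof. by move=> [a b] [a' b'] /= [] h1 h2; congr (_, _); lia. Qed.

Lemma weights_off_jump_index (k l : int) :
  (forall ab, jump_index ab <> (k, l)) -> p k l = 0.
Proof.
move=> H; apply: (weights_small_pos_jumps Hp); apply: contrapT => kl.
have [k2 l2] : k <= 1 /\ l <= 1.
  by split; rewrite leNgt; apply/negP => ?; apply: kl; [left|right]; lia.
apply: (H (absz (1 - k), absz (1 - l))); rewrite /jump_index /=.
by congr (_, _); lia.
Qed.

Lemma jump_ge0 a b : 0 <= jump a b.
Proof. exact: weights_ge0 Hp _ _. Qed.

Lemma sum_jump_le1 (A : {fset nat * nat}) : \sum_(ab <- A) jump ab.1 ab.2 <= 1.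
Proof.
apply: has_usum_ge0_sum_le; first by move=> ab; exact: jump_ge0.
apply: (has_usum_reindex jump_index_inj _ (weights_sum1 Hp)) => -[k l].
exact: weights_off_jump_index.
Qed.

(** On the closed bidisk the terms are dominated by the weights, whose sum is 1; hence the [usum] in
    the kernel is a genuine sum. *)
Lemma walk_kernel_jump x y : modulus x <= 1 -> modulus y <= 1 ->
  has_usum (double_family jump x y) (x * y - walk_kernel p x y).
Proof.
move=> x1 y1; rewrite /walk_kernel opprB addrCA subrr addr0.
set f := fun kl : int * int => _.
have -> : double_family jump x y = f \o jump_index.
  apply/funext => -[a b]; rewrite /double_family /f /=.
  have E (n : nat) : 1 - (1 - n%:Z) = n%:Z by lia.
  by rewrite !E.
have f0 kl : (forall ab, jump_index ab <> kl) -> f kl = 0.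
  by case: kl => k l /weights_off_jump_index pkl; rewrite /f /= pkl !mul0r.
apply: (has_usum_reindex jump_index_inj f0).
apply: usum_dominated (weights_sum1 Hp) => kl.
have [[[a b] <-]|H] := pselect (exists ab, jump_index ab = kl); last first.
  rewrite f0 ?modulus0; first exact: weights_ge0 Hp _ _.
  by move=> ab E; apply: H; exists ab.
rewrite /f /=.
have E (n : nat) : 1 - (1 - n%:Z) = n%:Z by lia.
rewrite !E -!exprnP !modulusM !modulusX modulus_real ger0_norm ?(weights_ge0 Hp) //.
rewrite -mulrA ler_piMr ?(weights_ge0 Hp) //.
by rewrite mulr_ile1 ?exprn_ge0 ?modulus_ge0 // exprn_ile1 ?modulus_ge0.
Qed.

Lemma walk_kernel_series x y : modulus x <= 1 -> modulus y <= 1 ->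
  has_usum (double_family kernel_coef x y) (walk_kernel p x y).
Proof.
move=> x1 y1; have /has_usumN Hj := walk_kernel_jump x1 y1.
pose d := fun a b : nat => ((a == 1%N) && (b == 1%N))%:R : R.
have : has_usum (double_family d x y)
    (\sum_(ab <- [fset (1%N, 1%N)]%fset) double_family d x y ab).
  apply: has_usum_fin => -[a b]; rewrite inE /double_family /d /=.
  by rewrite -[_ == _]/((_ == _) && (_ == _)) => /negbTE ->; rewrite !mul0r.
rewrite big_seq_fset1 /double_family /d /= !mul1r !expr1 => Hd.
have := has_usumD Hd Hj; rewrite opprB addrCA subrr addr0.
congr (has_usum _ _); apply/funext => ab.
by rewrite /double_family /kernel_coef rmorphB; ring.
Qed.

Definition shifted h (i j : nat) : R := h i.+1%:Z j.+1%:Z.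

(** In K H the monomial x y of the kernel shifts the coefficients of H by (1, 1), and x^(1-k)
    y^(1-l) turns this shift into a step (k, l); the sign is that of K. *)
Lemma laplacian_conv2 h (i j : nat) :
  (forall i j : int, i <= 0 \/ j <= 0 -> h i j = 0) ->
  laplacian p h i.+1%:Z j.+1%:Z = - conv2 kernel_coef (shifted h) i.+1 j.+1.
Proof.
move=> h0.
pose f := fun kl : int * int => p kl.1 kl.2 * h (i.+1%:Z + kl.1) (j.+1%:Z + kl.2).
(* The steps from (i+1, j+1) that remain in the quadrant: all the others meet [h = 0] or a zero
   weight, so the Laplacian is a finite sum. *)
pose s := [seq jump_index (a, b) | a <- iota 0 i.+2, b <- iota 0 j.+2].
have us : uniq s.
  by apply: allpairs_uniq; rewrite ?iota_uniq // => -[? ?] [? ?] _ _ /jump_index_inj.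
have f0 kl : kl \notin [fset kl in s]%fset -> f kl = 0.
  have [[[a b] <-]|H _] := pselect (exists ab, jump_index ab = kl); last first.
    rewrite /f; case: kl H => k l H /=; rewrite weights_off_jump_index ?mul0r //.
    by move=> ab E; apply: H; exists ab.
  rewrite mem_fset_seq => abs; rewrite /f /= h0 ?mulr0 //.
  apply: contrapT => /not_orP[/negP + /negP]; rewrite /= => ai bj.
  move/negP: abs; apply.
  by apply/allpairsP; exists (a, b); split; rewrite // mem_iota /=; lia.
have := has_usum_fin f0; rewrite big_fset_seq // => /has_usum_unique.
rewrite /laplacian => ->.
have -> : \sum_(kl <- s) f kl = conv2 jump (shifted h) i.+1 j.+1.
  rewrite /s big_allpairs_dep -[X in iota 0 X]subn0 -/(index_iota 0 _) big_mkord.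
  apply: eq_bigr => a _.
  rewrite -[X in iota 0 X]subn0 -/(index_iota 0 _) big_mkord; apply: eq_bigr => b _.
  rewrite /f /jump /shifted /=; congr (_ * h _ _).
    by have := ltn_ord a; lia.
  by have := ltn_ord b; lia.
have -> : conv2 kernel_coef (shifted h) i.+1 j.+1 =
    shifted h i j - conv2 jump (shifted h) i.+1 j.+1.
  have -> : shifted h i j =
      conv2 (fun a b => ((a == 1%N) && (b == 1%N))%:R) (shifted h) i.+1 j.+1.
    rewrite /conv2 2!big_ord_recl /= big1 => [|b _]; last by rewrite mul0r.
    rewrite add0r 2!big_ord_recl /= mul0r mul1r add0r !subn1 /=.
    rewrite big1 => [|b _]; last by rewrite mul0r.
    by rewrite big1 ?addr0 // => a _; rewrite big1 // => b _; rewrite mul0r.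
  rewrite /conv2 -sumrB; apply: eq_bigr => a _.
  by rewrite -sumrB; apply: eq_bigr => b _; rewrite mulrBl.
by rewrite opprB.
Qed.

Lemma harmonic_quadrantP h : (forall i j : int, i <= 0 \/ j <= 0 -> h i j = 0) ->
  harmonic_quadrant p h <->
  (forall i j, (0 < i)%N -> (0 < j)%N -> conv2 kernel_coef (shifted h) i j = 0).
Proof.
move=> h0; split.
  move=> [Lh _] [|i] [|j] // _ _; apply: oppr_inj; rewrite -laplacian_conv2 // oppr0.
  exact: Lh.
move=> H; split=> // -[[|i]|i] [[|j]|j] // _ _.
by rewrite laplacian_conv2 // H // oppr0.
Qed.

End Kernel.

(** * Triangular families of harmonic functions *)

Section LocalUniqueness.
Variable R : realType.
Implicit Types k D : nat -> nat -> R.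

Lemma conv2_single k D i j a0 b0 : (a0 <= i)%N -> (b0 <= j)%N ->
  (forall a b, (a <= i)%N -> (b <= j)%N -> (a, b) <> (a0, b0) ->
     k a b * D (i - a)%N (j - b)%N = 0) ->
  conv2 k D i j = k a0 b0 * D (i - a0)%N (j - b0)%N.
Proof.
rewrite -ltnS -[(b0 <= j)%N]ltnS => ia jb H; rewrite /conv2.
rewrite (bigD1 (Ordinal ia)) //= (bigD1 (Ordinal jb)) //= big1 => [|b /eqP nb].
  rewrite big1 ?addr0 // => a /eqP na; rewrite big1 // => b _.
  rewrite H // -1?ltnS // => -[e _]; apply: na; exact: val_inj.
rewrite H // -1?ltnS // => -[e]; apply: nb; exact: val_inj.
Qed.

(** The coefficient equation at (i, j) expresses D(i, j) through values of smaller total degree in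
    the rectangle below it, so the square of side [N] is never left. *)
Lemma vanish_from_axes k D N : k 0%N 0%N != 0 ->
  (forall i j, (0 < i)%N -> (0 < j)%N -> conv2 k D i j = 0) ->
  (forall i, (i <= N)%N -> D i 0%N = 0 /\ D 0%N i = 0) ->
  forall i j, (i <= N)%N -> (j <= N)%N -> D i j = 0.
Proof.
move=> k0 HD ax i j; have [d] := ubnP (i + j).
elim: d i j => // d IH [|i] [|j] ijd iN jN; try by have [] := ax _ iN; have [] := ax _ jN.
have := HD i.+1 j.+1 isT isT.
rewrite (@conv2_single _ _ _ _ 0 0) // => [|a b ai bj ab].
  by rewrite !subn0 => /eqP; rewrite mulf_eq0 (negbTE k0) => /eqP.
rewrite IH ?mulr0 //; try lia.
suff : ~ (a = 0 /\ b = 0)%N by lia.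
by move=> [ea eb]; apply: ab; rewrite ea eb.
Qed.

(** The equation at (i+1, j) expresses D(i, j) through the same row further left and through lower
    rows up to column i+1. Each row down may cost one column to the right; hence the bound on i +
    j. *)
Lemma vanish_from_axis k D N : k 0%N 0%N = 0 -> k 1%N 0%N != 0 ->
  (forall i j, (0 < i)%N -> (0 < j)%N -> conv2 k D i j = 0) ->
  (forall i, (i <= N)%N -> D i 0%N = 0) ->
  forall i j, (i + j <= N)%N -> D i j = 0.
Proof.
move=> k0 k1 HD ax i j; elim/ltn_ind: j i => j IHj i.
elim/ltn_ind: i => i IHi ijN.
have [j0|j0] := posnP j; first by rewrite j0 ax //; lia.
have := HD i.+1 j isT j0.
rewrite (@conv2_single _ _ _ _ 1 0) // => [|a b ai bj ab].
  by rewrite subn0 subSS subn0 => /eqP; rewrite mulf_eq0 (negbTE k1) => /eqP.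
have [b0|b0] := posnP b; last by rewrite IHj ?mulr0 //; lia.
have [a0|a0] := posnP a; first by rewrite a0 b0 k0 mul0r.
rewrite b0 subn0 IHi ?mulr0 //; try lia.
  suff : a <> 1%N by lia.
  by move=> a1; apply: ab; rewrite a1 b0.
Qed.

End LocalUniqueness.

Section TriangularBasis.
Variables (R : realType) (p : int -> int -> R).
Hypothesis Hp : admissible_weights p.
(** [cell] enumerates the boundary cells on which a harmonic function may be prescribed freely. By
    [vanish], its value at (i, j) depends on the first [bound i j] of them only; this locality makes
    the sums pointwise finite. [H n] stands for h_(n+1). *)
Variables (h : nat -> int -> int -> R) (cell : nat -> nat * nat).
Variable bound : nat -> nat -> nat.
Let H n := shifted (h n.+1).
Let kap := kernel_coef p.
Hypothesis h_harmonic : forall n, harmonic_quadrant p (h n.+1).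
Hypothesis H_cell_lt : forall m n, (m < n)%N -> H n (cell m).1 (cell m).2 = 0.
Hypothesis H_cell_eq : forall n, H n (cell n).1 (cell n).2 != 0.
Hypothesis vanish : forall D : nat -> nat -> R,
  (forall i j, (0 < i)%N -> (0 < j)%N -> conv2 kap D i j = 0) ->
  forall i j, (forall m, (m < bound i j)%N -> D (cell m).1 (cell m).2 = 0) -> D i j = 0.

Lemma conv2_basis n i j : (0 < i)%N -> (0 < j)%N -> conv2 kap (H n) i j = 0.
Proof.
by have [_ h0] := h_harmonic n; have /(harmonic_quadrantP Hp h0) := h_harmonic n; apply.
Qed.

(** [H n] vanishes on the cells before [n], and these already determine its value at (i, j). *)
Lemma basis_eq0 n i j : (bound i j <= n)%N -> H n i j = 0.
Proof.
move=> ijn; apply: vanish; first exact: conv2_basis.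
by move=> m mij; apply: H_cell_lt; apply: leq_trans ijn.
Qed.

Lemma basis_eventually0 i j : exists M, forall n, (M <= n)%N -> h n.+1 i j = 0.
Proof.
have [ij0|] := pselect (i <= 0 \/ j <= 0).
  by exists 0%N => n _; have [_ ->] := h_harmonic n.
case: i j => [[|i]|i] [[|j]|j] ij; try by exfalso; apply: ij; lia.
by exists (bound i j) => n /basis_eq0.
Qed.

Lemma Phi_sum (a : nat -> R) i j M : (forall n, (M <= n)%N -> h n.+1 i j = 0) ->
  Phi h a i j = \sum_(n < M) a n.+1 * h n.+1 i j.
Proof.
move=> HM; rewrite /Phi fsbig_mkcond.
rewrite -(@fsbig_widen _ _ _ _ `I_M.+1 [set: nat]) //; last first.
  move=> n [_ /= /negP]; rewrite -leqNgt /patch => Mn.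
  case: ifP => //; case: n Mn => // n Mn _.
  by rewrite HM ?mulr0.
rewrite -fsbig_ord big_ord_recl /= {1}/patch ifF ?add0r; last first.
  by apply/negP; rewrite inE.
by apply: eq_bigr => n _; rewrite /patch ifT // inE.
Qed.

Lemma Phi_linear (c : R) (a b : nat -> R) :
  Phi h (fun n => c * a n + b n) = (fun i j => c * Phi h a i j + Phi h b i j).
Proof.
apply/funext => i; apply/funext => j.
have [M HM] := basis_eventually0 i j.
rewrite !(Phi_sum _ HM) mulr_sumr -big_split; apply: eq_bigr => n _ /=; ring.
Qed.

Lemma Phi_shifted (a : nat -> R) i j M : (bound i j <= M)%N ->
  shifted (Phi h a) i j = \sum_(n < M) a n.+1 * H n i j.
Proof.
by move=> ijM; apply: Phi_sum => n Mn; apply: basis_eq0; apply: leq_trans Mn.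
Qed.

Lemma Phi_harmonic (a : nat -> R) : harmonic_quadrant p (Phi h a).
Proof.
have Phi0 (i j : int) : i <= 0 \/ j <= 0 -> Phi h a i j = 0.
  move=> ij; rewrite (@Phi_sum a i j 0) ?big_ord0 // => n _.
  by have [_ ->] := h_harmonic n.
apply/(harmonic_quadrantP Hp Phi0) => i j i0 j0.
(* One cutoff for all points entering the convolution at (i, j), so that it can be exchanged with a
   finite sum over [n]. *)
pose M := (\max_(i' < i.+1) \max_(j' < j.+1) bound i' j')%N.
have HM i' j' : (i' <= i)%N -> (j' <= j)%N -> (bound i' j' <= M)%N.
  rewrite -ltnS -[(j' <= j)%N]ltnS => i'i j'j.
  apply: leq_trans (leq_bigmax (F := fun i' : 'I_i.+1 => \max_(j' < j.+1) bound i' j') (Ordinal i'i)).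
  exact: (leq_bigmax (F := fun j' : 'I_j.+1 => bound i' j') (Ordinal j'j)).
transitivity (\sum_(n < M) a n.+1 * conv2 kap (H n) i j); last first.
  by apply: big1 => n _; rewrite conv2_basis // mulr0.
under [RHS]eq_bigr do rewrite /conv2 mulr_sumr.
rewrite exchange_big; apply: eq_bigr => i' _ /=.
under [RHS]eq_bigr do rewrite mulr_sumr.
rewrite exchange_big; apply: eq_bigr => j' _ /=.
rewrite (@Phi_shifted a _ _ M) ?mulr_sumr; last by apply: HM; exact: leq_subr.
by apply: eq_bigr => n _; rewrite mulrCA.
Qed.

Lemma Phi_cell (a : nat -> R) n :
  shifted (Phi h a) (cell n).1 (cell n).2 =
  \sum_(m < n) a m.+1 * H m (cell n).1 (cell n).2 + a n.+1 * H n (cell n).1 (cell n).2.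
Proof.
rewrite /shifted (@Phi_sum a _ _ n.+1) ?big_ord_recr // => m nm.
exact: H_cell_lt.
Qed.

(** Forward substitution for the triangular system with right-hand side [v]. Stage [n] carries the
    whole sequence found so far, as each coefficient depends on all earlier ones; index 0 keeps the
    value 0 required by [series0]. *)
Fixpoint triangular_solution (v : nat -> R) (n : nat) : nat -> R :=
  if n is n'.+1 then
    let a := triangular_solution v n' in
    fun m => if m == n'.+1 then
      (v n' - \sum_(m < n') a m.+1 * H m (cell n').1 (cell n').2) /
        H n' (cell n').1 (cell n').2
    else a m
  else fun=> 0.

Lemma triangular_solution_stable v n m : (m <= n)%N ->
  triangular_solution v n m = triangular_solution v m m.
Proof.
elim: n => [|n IH]; first by rewrite leqn0 => /eqP ->.
rewrite leq_eqVlt ltnS => /predU1P[->//|mn] /=.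
by rewrite ltn_eqF ?ltnS // IH.
Qed.

Lemma triangular_basis :
  [/\ forall i j : int, finite_set [set n | (0 < n)%N /\ h n i j != 0],
      forall (c : R) (a b : nat -> R), series0 a -> series0 b ->
        Phi h (fun n => c * a n + b n) =
        (fun i j => c * Phi h a i j + Phi h b i j) &
      set_bij series0 (harmonic_quadrant p) (Phi h)].
Proof.
split.
- move=> i j; have [M HM] := basis_eventually0 i j.
  apply: (sub_finite_set _ (finite_II M.+1)) => -[|n] [//= _].
  by apply: contraNT; rewrite -leqNgt => /HM ->.
- by move=> c a b _ _; exact: Phi_linear.
split.
- by move=> a _; exact: Phi_harmonic.
- move=> a b a0 b0 ab; move/set_mem: a0 => a0; move/set_mem: b0 => b0.
  apply/funext => n.
  case: n => [|n]; first by rewrite a0 b0.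
  elim/ltn_ind: n => n IH.
  have := Phi_cell a n; rewrite ab Phi_cell.
  rewrite [X in X + _](eq_bigr (fun m : 'I_n => a m.+1 * H m (cell n).1 (cell n).2)).
    by move/addrI/(mulIf (H_cell_eq n)).
  by move=> m _; rewrite IH.
(* Surjectivity: the series is solved for on the cells, and its difference with [f] is harmonic with
   zero values on all cells, hence zero by [vanish]. *)
- move=> f Hf; pose v n := shifted f (cell n).1 (cell n).2.
  pose a n := triangular_solution v n n.
  exists a => //=.
  have Pf n : shifted (Phi h a) (cell n).1 (cell n).2 = v n.
    rewrite Phi_cell {2}/a /= eqxx mulfVK //.
    rewrite [X in X + _](eq_bigr (fun m : 'I_n =>
      triangular_solution v n m.+1 * H m (cell n).1 (cell n).2)).
      by rewrite addrC subrK.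
    by move=> m _; rewrite triangular_solution_stable.
  have Hd : harmonic_quadrant p (fun i j => Phi h a i j - f i j).
    have [_ Pa0] := Phi_harmonic a; have [_ f0] := Hf.
    have d0 i j : i <= 0 \/ j <= 0 -> Phi h a i j - f i j = 0.
      by move=> ij; rewrite Pa0 // f0 // subrr.
    apply/(harmonic_quadrantP Hp d0) => i j i0 j0.
    have /(harmonic_quadrantP Hp Pa0)/(_ i j i0 j0) cP := Phi_harmonic a.
    have /(harmonic_quadrantP Hp f0)/(_ i j i0 j0) cf := Hf.
    rewrite -[RHS](subrr 0) -{1}cP -cf -sumrB; apply: eq_bigr => i' _.
    by rewrite -sumrB; apply: eq_bigr => j' _; rewrite -mulrBr.
  apply/funext => i; apply/funext => j.
  have [[_ Pa] [_ fa]] := (Phi_harmonic a, Hf).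
  have [ij|] := pselect (i <= 0 \/ j <= 0); first by rewrite Pa ?fa.
  case: i j => [[|i]|i] [[|j]|j] ij; try by exfalso; apply: ij; lia.
  apply/subr0_eq.
  have [_ d0] := Hd; move/(harmonic_quadrantP Hp d0): Hd => /vanish; apply.
  by move=> m _; rewrite /shifted; apply/eqP; rewrite subr_eq0; apply/eqP/Pf.
Qed.

End TriangularBasis.

(** * Orders of vanishing *)

Section Orders.
Variable R : realType.
Implicit Types (c d : nat -> R) (f g : R[i] -> R[i]).

Lemma cauchy_product_low c d l k i : (forall a, (a < l)%N -> c a = 0) ->
  (forall b, (b < k)%N -> d b = 0) -> (i < l + k)%N -> cauchy_product c d i = 0.
Proof.
move=> cl dk ilk; apply: big1 => a _.
have [al|la] := ltnP a l; first by rewrite cl // mul0r.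
by rewrite dk ?mulr0 //; have := ltn_ord a; lia.
Qed.

Lemma cauchy_product_lead c d l k : (forall a, (a < l)%N -> c a = 0) ->
  (forall b, (b < k)%N -> d b = 0) -> cauchy_product c d (l + k) = c l * d k.
Proof.
move=> cl dk; have llk : (l < (l + k).+1)%N by lia.
rewrite /cauchy_product (bigD1 (Ordinal llk)) //= addKn big1 ?addr0 // => a al.
have {}al : nat_of_ord a <> l by move=> e; move/eqP: al; apply; exact: val_inj.
have [al'|la] := ltnP a l; first by rewrite cl // mul0r.
by rewrite dk ?mulr0 //; have := ltn_ord a; lia.
Qed.

Lemma deconvolution c d l k : (forall a, (a < l)%N -> c a = 0) -> c l != 0 ->
  (forall i, (i < l + k)%N -> cauchy_product c d i = 0) ->
  forall b, (b < k)%N -> d b = 0.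
Proof.
move=> cl cl0 cd b; elim/ltn_ind: b => b IH bk.
have : cauchy_product c d (l + b) = 0 by apply: cd; rewrite ltn_add2l.
rewrite cauchy_product_lead // => [/eqP|b' b'b].
  by rewrite mulf_eq0 (negbTE cl0) => /eqP.
by apply: IH => //; apply: ltn_trans bk.
Qed.

Definition leading c k (A : R) := (forall i, (i < k)%N -> c i = 0) /\ c k = A.

Lemma leadingM c d k l A B : leading c k A -> leading d l B ->
  leading (cauchy_product c d) (k + l) (A * B).
Proof.
move=> [c0 <-] [d0 <-]; split; last exact: cauchy_product_lead.
by move=> i; exact: cauchy_product_low.
Qed.

(** Divides the kernel out on an axis: the exact order of K H there, less the order of K, is the
    exact order of H. *)
Lemma leading_deconvolution c d l k C : leading c l C -> C != 0 ->
  forall S, leading (cauchy_product c d) (l + k) S -> S != 0 ->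
  leading d k (d k) /\ d k != 0.
Proof.
move=> [c0 cl] C0 S [cd0 cdS] S0; rewrite -cl in C0.
have d0 := deconvolution c0 C0 cd0.
split=> //; move: S0; rewrite -cdS cauchy_product_lead //.
by rewrite mulf_eq0 negb_or => /andP[].
Qed.

Lemma has_seriesX f c k A : has_series f c -> leading c k A ->
  forall n, exists2 d, has_series (fun x => f x ^+ n) d & leading d (n * k) (A ^+ n).
Proof.
move=> Hf Hc; elim=> [|n [d Hd Hl]].
  exists (fun i => if i is 0 then 1 else 0); last by split.
  exact: (has_series_const 1).
exists (cauchy_product c d); last by rewrite mulSn exprS; apply: leadingM.
apply: (has_series_ext ltr01 _ (has_seriesM Hf Hd)) => x _.
by rewrite exprS.
Qed.

End Orders.

(** * Boundary values of the [h n] and the three enumerations of cells *)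

Section Expansions.
Variables (R : realType) (p : int -> int -> R).
Hypothesis Hp : admissible_weights p.
Variables (g1 g2 : R[i] -> R[i]).
Let kap := kernel_coef p.

Lemma harmonic_expansion_series n (h : int -> int -> R) :
  harmonic_expansion p g1 g2 n h ->
  let P := basis_poly (g1 0) (g2 0) n in
  [/\ harmonic_quadrant p h,
      has_series (fun x => P.[g1 x] - P.[g2 0]) (fun i => conv2 kap (shifted h) i 0) &
      has_series (fun y => P.[g1 0] - P.[g2 y]) (fun j => conv2 kap (shifted h) 0 j)].
Proof.
move=> [h0 Hnear] P.
(* One radius for both variables, kept below 1 so that the kernel series converges on the bidisk as
   well. *)
have [e /andP[e0 e1] He] : exists2 e : R, 0 < e < 1 & forall x y : R[i],
    modulus x < e -> modulus y < e -> exists2 v : R[i],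
      has_usum (double_family (shifted h) x y) v &
      walk_kernel p x y * v = P.[g1 x] - P.[g2 y].
  case: Hnear => -[U V] /= [/nearCP[e1 e10 HU] /nearCP[e2 e20 HV]] UV.
  exists (Num.min (Num.min e1 e2) 2^-1).
    by rewrite !lt_min e10 e20 invr_gt0 ltr0n /= !gt_min invf_lt1 ?ltr1n ?orbT.
  move=> x y; rewrite !lt_min => /andP[/andP[xe1 _] _] /andP[/andP[_ ye2] _].
  have /= [v Hv Kv] := UV (x, y) (conj (HU x ltac:(by rewrite subr0)) (HV y ltac:(by rewrite subr0))).
  by exists v.
pose V x y := usum (double_family (shifted h) x y).
have HK x y : modulus x < e -> modulus y < e ->
    has_usum (double_family kap x y) (walk_kernel p x y).
  by move=> xe ye; apply: walk_kernel_series => //; apply/ltW; apply: lt_trans e1.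
have HV x y : modulus x < e -> modulus y < e ->
    has_usum (double_family (shifted h) x y) (V x y).
  by move=> xe ye; have [v Hv _] := He x y xe ye; rewrite /V (has_usum_unique Hv).
have KV x y : modulus x < e -> modulus y < e ->
    walk_kernel p x y * V x y = P.[g1 x] - P.[g2 y].
  by move=> xe ye; have [v Hv <-] := He x y xe ye; rewrite /V (has_usum_unique Hv).
split.
- apply/(harmonic_quadrantP Hp h0) => i j i0 j0.
  exact: (conv2_interior (F := fun x => P.[g1 x]) (G := fun y => P.[g2 y]) e0 HK HV KV i0 j0).
- exact: (first_axis_series (F := fun x => P.[g1 x]) (G := fun y => P.[g2 y]) e0 HK HV KV).
- exact: (second_axis_series (F := fun x => P.[g1 x]) (G := fun y => P.[g2 y]) e0 HK HV KV).
Qed.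

Lemma conv2_first_axis k (D : nat -> nat -> R) i :
  conv2 k D i 0 = cauchy_product (k^~ 0%N) (D^~ 0%N) i.
Proof. by apply: eq_bigr => a _; rewrite big_ord1 subn0. Qed.

Lemma conv2_second_axis k (D : nat -> nat -> R) j :
  conv2 k D 0 j = cauchy_product (k 0%N) (D 0%N) j.
Proof. by rewrite /conv2 big_ord1; apply: eq_bigr => a _; rewrite subn0. Qed.

Lemma conv2_transpose (k D : nat -> nat -> R) i j :
  conv2 k D i j = conv2 (fun a b => k b a) (fun a b => D b a) j i.
Proof. exact: exchange_big. Qed.

Lemma horner_basis_poly (a b z : R[i]) n :
  (basis_poly a b n).[z] = (z - a) ^+ uphalf n * (z - b) ^+ n./2.
Proof. by rewrite hornerM !horner_exp !hornerXsubC. Qed.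

Variable h : nat -> int -> int -> R.
Hypothesis Hh : forall n, (0 < n)%N -> harmonic_expansion p g1 g2 n (h n).
Let H n := shifted (h n).

(** The coefficients of K H_1 on an axis are those of g1(x) - g2(0); clearing the constant term
    leaves g1(x) - g1(0). On the other axis the sign changes. *)
Definition germ1_coef i : R := if i is 0 then 0 else conv2 kap (H 1) i 0.
Definition germ2_coef j : R := if j is 0 then 0 else - conv2 kap (H 1) 0 j.

(** The case n = 1 at the origin: the difference is always real, and it is zero as soon as K(0, 0) =
    0. *)
Lemma germ1_at0 : g1 0 - g2 0 = (kap 0%N 0%N * H 1 0%N 0%N)%:C.
Proof.
have [_ /has_series_at0 + _] := harmonic_expansion_series (Hh (n := 1) isT).
rewrite !horner_basis_poly /= !expr1 !expr0 !mulr1 subrr sub0r opprB => ->.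
by rewrite /conv2 !big_ord1.
Qed.

Lemma germ1_series : has_series (fun x => g1 x - g1 0) germ1_coef.
Proof.
have [_ H1 _] := harmonic_expansion_series (Hh (n := 1) isT).
have := has_seriesD H1 (has_seriesN (has_series_const (kap 0%N 0%N * H 1 0%N 0%N))).
have -> : (fun i => conv2 kap (shifted (h 1)) i 0 +
   - (if i is 0 then kap 0%N 0%N * H 1 0%N 0%N else 0)) = germ1_coef.
  apply/funext => -[|i] /=; last by rewrite subr0.
  by rewrite /conv2 !big_ord1 subrr.
apply: (has_series_ext ltr01) => x _.
rewrite !horner_basis_poly /= !expr1 !expr0 !mulr1 -germ1_at0; ring.
Qed.

Lemma germ2_series : has_series (fun y => g2 y - g2 0) germ2_coef.
Proof.
have [_ _ H1] := harmonic_expansion_series (Hh (n := 1) isT).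
have := has_seriesD (has_seriesN H1) (has_series_const (kap 0%N 0%N * H 1 0%N 0%N)).
have -> : (fun j => - conv2 kap (shifted (h 1)) 0 j +
   (if j is 0 then kap 0%N 0%N * H 1 0%N 0%N else 0)) = germ2_coef.
  apply/funext => -[|i] /=; last by rewrite addr0.
  by rewrite /conv2 !big_ord1 addNr.
apply: (has_series_ext ltr01) => x _.
rewrite !horner_basis_poly /= !expr1 !expr0 !mulr1 -germ1_at0; ring.
Qed.

Let h_harmonic n : harmonic_quadrant p (h n.+1).
Proof. by have [] := harmonic_expansion_series (Hh (n := n.+1) isT). Qed.

Let result := [/\ forall i j : int, finite_set [set n | (0 < n)%N /\ h n i j != 0],
      forall (c : R) (a b : nat -> R), series0 a -> series0 b ->
        Phi h (fun n => c * a n + b n) =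
        (fun i j => c * Phi h a i j + Phi h b i j) &
      set_bij series0 (harmonic_quadrant p) (Phi h)].

(** Here g1(0) = g2(0), so P_(n+1)(g1(x)) is the power n+1 of g1(x) - g1(0), of order exactly n+1.
    On this axis K has order 1, which leaves order exactly n for h_(n+1): the cells are (n, 0). *)
Lemma basis_order1 : kap 0%N 0%N = 0 -> kap 1%N 0%N != 0 -> germ1_coef 1 != 0 -> result.
Proof.
move=> k0 k1 A0.
have E : g1 0 = g2 0 by apply/subr0_eq; rewrite germ1_at0 k0 mul0r.
have key n : leading ((H n.+1)^~ 0%N) n (H n.+1 n 0%N) /\ H n.+1 n 0%N != 0.
  have [_ Hs _] := harmonic_expansion_series (Hh (n := n.+1) isT).
  have L1 : leading germ1_coef 1 (germ1_coef 1) by split=> // -[].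
  have [d Hd Ld] := has_seriesX germ1_series L1 n.+1.
  have Es x : modulus x < 1 -> (basis_poly (g1 0) (g2 0) n.+1).[g1 x] -
      (basis_poly (g1 0) (g2 0) n.+1).[g2 0] = (g1 x - g1 0) ^+ n.+1.
    move=> _; rewrite !horner_basis_poly -E subrr -!exprD.
    by rewrite (_ : (_ + _)%N = n.+1) ?expr0n ?subr0 //; lia.
  have ds := has_series_unique ltr01 Es Hs Hd.
  have Lk : leading (kap^~ 0%N) 1 (kap 1%N 0%N) by split=> // -[].
  apply: (leading_deconvolution Lk k1 (S := germ1_coef 1 ^+ n.+1)).
    rewrite (_ : (1 + n)%N = (n.+1 * 1)%N); last by rewrite muln1.
    move: Ld; rewrite -ds.
    by move=> [L0 L1']; split=> [i ik|]; rewrite -conv2_first_axis; [exact: L0|exact: L1'].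
  by rewrite expf_neq0.
apply: (triangular_basis Hp (cell := fun n => (n, 0%N))
  (bound := fun i j => (i + j).+1)) => //.
- by move=> m n mn /=; have [[L0 _] _] := key n; exact: L0.
- by move=> n /=; have [] := key n.
- move=> D HD i j Dc; apply: (vanish_from_axis k0 k1 HD (N := (i + j)%N)) => //.
Qed.

Lemma basis_order2 : kap 0%N 0%N = 0 -> kap 0%N 1%N != 0 -> germ2_coef 1 != 0 -> result.
Proof.
move=> k0 k1 A0.
have E : g1 0 = g2 0 by apply/subr0_eq; rewrite germ1_at0 k0 mul0r.
have key n : leading (H n.+1 0%N) n (H n.+1 0%N n) /\ H n.+1 0%N n != 0.
  have [_ _ Hs] := harmonic_expansion_series (Hh (n := n.+1) isT).
  have L1 : leading germ2_coef 1 (germ2_coef 1) by split=> // -[].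
  have [d Hd Ld] := has_seriesX germ2_series L1 n.+1.
  have Es x : modulus x < 1 -> (basis_poly (g1 0) (g2 0) n.+1).[g1 0] -
      (basis_poly (g1 0) (g2 0) n.+1).[g2 x] = - (g2 x - g2 0) ^+ n.+1.
    move=> _; rewrite !horner_basis_poly E subrr -!exprD.
    by rewrite (_ : (_ + _)%N = n.+1) ?expr0n ?sub0r //; lia.
  have ds := has_series_unique ltr01 Es Hs (has_seriesN Hd).
  have Lk : leading (kap 0%N) 1 (kap 0%N 1%N) by split=> // -[].
  apply: (leading_deconvolution Lk k1 (S := - germ2_coef 1 ^+ n.+1)).
    rewrite (_ : (1 + n)%N = (n.+1 * 1)%N); last by rewrite muln1.
    move: Ld => [L0 L1'].
    split=> [i /L0 di|]; rewrite -conv2_second_axis -[LHS]/((fun j => conv2 kap (shifted (h n.+1)) 0 j) _) ds.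
      by rewrite di oppr0.
    by rewrite L1'.
  by rewrite oppr_eq0 expf_neq0.
apply: (triangular_basis Hp (cell := fun n => (0%N, n))
  (bound := fun i j => (j + i).+1)) => //.
- by move=> m n mn /=; have [[L0 _] _] := key n; exact: L0.
- by move=> n /=; have [] := key n.
- move=> D HD i j Dc.
  (* The mirror image of the recursion: the axes are exchanged by transposing both kernel and
     function. *)
  apply: (@vanish_from_axis _ (fun a b => kap b a) (fun a b => D b a) (j + i) k0 k1) => //.
  by move=> a b a0 b0; rewrite -conv2_transpose HD.
Qed.

(** K has order 0 on both axes, and each factor of P_n vanishes at the value of only one germ. For n
    >= 2, h_n thus has order exactly [uphalf n] on the first axis and [n./2] on the second, the
    other factor contributing a power of g1(0) - g2(0) up to sign. *)
Lemma basis_order12 : kap 0%N 0%N != 0 -> g1 0 != g2 0 ->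
  germ1_coef 1 != 0 -> germ2_coef 1 != 0 -> result.
Proof.
move=> k0 E A0 B0; set A := germ1_coef 1 in A0; set B := germ2_coef 1 in B0.
pose d := kap 0%N 0%N * H 1 0%N 0%N.
have dE : g1 0 - g2 0 = d%:C := germ1_at0.
have dNE : (- d)%:C = g2 0 - g1 0 by rewrite -opprB dE -rmorphN.
have d0 : d != 0 by apply: contra E => /eqP d0; rewrite -subr_eq0 dE d0.
have L1 : leading germ1_coef 1 A by split=> // -[].
have L2 : leading germ2_coef 1 B by split=> // -[].
have shift f c (e : R) : e != 0 -> has_series f c -> c 0%N = 0 ->
    exists2 c', has_series (fun x => f x + e%:C) c' & leading c' 0 e.
  move=> e0 Hf c0; exists (fun i => c i + if i is 0 then e else 0).
    exact: has_seriesD Hf (has_series_const e).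
  by split=> //; rewrite c0 add0r.
(* The case n = 1 is apart: P_1 lacks the factor X - g2(0) and does not vanish at g2(0), so [h 1] is
   non-zero at the corner. *)
have H10 : H 1 0%N 0%N != 0 by apply: contra d0 => /eqP H10; rewrite /d H10 mulr0.
have key n : (0 < n)%N ->
    [/\ forall i, (i < uphalf n.+1)%N -> H n.+1 i 0%N = 0, H n.+1 (uphalf n.+1) 0%N != 0,
        forall j, (j < n.+1./2)%N -> H n.+1 0%N j = 0 & H n.+1 0%N n.+1./2 != 0].
  move=> n0; have [u0 l0] : (0 < uphalf n.+1)%N /\ (0 < n.+1./2)%N by lia.
  have [_ Hs1 Hs2] := harmonic_expansion_series (Hh (n := n.+1) isT).
  set u := uphalf n.+1 in u0 *; set l := n.+1./2 in l0 *.
  have Lk1 : leading (kap^~ 0%N) 0 (kap 0%N 0%N) by [].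
  have Lk2 : leading (kap 0%N) 0 (kap 0%N 0%N) by [].
  have [a1 Ha1 La1] := has_seriesX germ1_series L1 u.
  have [b1 Hb1 Lb1] := shift _ _ d d0 germ1_series erefl.
  have [c1 Hc1 Lc1] := has_seriesX Hb1 Lb1 l.
  have [a2 Ha2 La2] := has_seriesX germ2_series L2 l.
  have dN0 : - d != 0 by rewrite oppr_eq0.
  have [b2 Hb2 Lb2] := shift _ _ (- d) dN0 germ2_series erefl.
  have [c2 Hc2 Lc2] := has_seriesX Hb2 Lb2 u.
  have E1 x : modulus x < 1 -> (basis_poly (g1 0) (g2 0) n.+1).[g1 x] -
      (basis_poly (g1 0) (g2 0) n.+1).[g2 0] =
      (g1 x - g1 0) ^+ u * (g1 x - g1 0 + d%:C) ^+ l.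
    move=> _; rewrite !horner_basis_poly subrr -/u -/l (expr0n _ l) gtn_eqF //.
    by rewrite mulr0 subr0 -dE addrA subrK.
  have E2 x : modulus x < 1 -> (basis_poly (g1 0) (g2 0) n.+1).[g1 0] -
      (basis_poly (g1 0) (g2 0) n.+1).[g2 x] =
      - ((g2 x - g2 0) ^+ l * (g2 x - g2 0 + (- d)%:C) ^+ u).
    move=> _; rewrite !horner_basis_poly subrr -/u -/l (expr0n _ u) gtn_eqF //.
    by rewrite mul0r sub0r dNE addrA subrK [X in - X]mulrC.
  have ds1 := has_series_unique ltr01 E1 Hs1 (has_seriesM Ha1 Hc1).
  have ds2 := has_series_unique ltr01 E2 Hs2 (has_seriesN (has_seriesM Ha2 Hc2)).
  have [] := @leading_deconvolution _ _ ((H n.+1)^~ 0%N) 0 u _ Lk1 k0 (A ^+ u * d ^+ l).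
  - move: (leadingM La1 Lc1); rewrite -ds1 muln1 muln0 addn0 add0n => -[l1 l2].
    by split=> [i iu|]; rewrite -conv2_first_axis; [exact: l1|exact: l2].
  - by rewrite mulf_neq0 // expf_neq0.
  move=> [? _] ?; have [] := @leading_deconvolution _ _ (H n.+1 0%N) 0 l _ Lk2 k0
    (- (B ^+ l * (- d) ^+ u)).
  - have [l1 l2] := leadingM La2 Lc2; rewrite muln1 muln0 addn0 in l1 l2.
    have cE j : conv2 kap (shifted (h n.+1)) 0 j = - cauchy_product a2 c2 j.
      by rewrite -[LHS]/((fun j => conv2 kap (shifted (h n.+1)) 0 j) j) ds2.
    rewrite add0n; split=> [i iu|]; rewrite -conv2_second_axis cE ?l2 //.
    by rewrite l1 // oppr0.
  - by rewrite oppr_eq0 mulf_neq0 // expf_neq0.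
  by move=> [? _] ?; split.
(* The order is (0,0), (1,0), (0,1), (2,0), (0,2), ...: each further factor of P_n raises the order
   on one axis, just past the cell last used. The cells up to distance N on both axes are the first
   2 N + 1. *)
pose cell n := if odd n then (uphalf n, 0%N) else (0%N, n./2).
apply: (triangular_basis Hp (cell := cell)
  (bound := fun i j => (2 * maxn i j).+1)) => //.
- move=> m n mn; have [k1 _ k3 _] := key n ltac:(lia).
  rewrite /cell; case: ifP => /= om; [apply: k1|apply: k3]; lia.
- move=> [|n]; first exact: H10.
  have [_ k2 _ k4] := key n.+1 isT.
  have -> : cell n.+1 = if odd n.+1 then (uphalf n.+2, 0%N) else (0%N, n.+2./2).
    by rewrite /cell; case: ifP => on; congr (_, _); lia.
  by case: ifP.
- move=> D HD i j Dc; apply: (vanish_from_axes k0 HD (N := maxn i j)); last 2 first.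
  + exact: leq_maxl.
  + exact: leq_maxr.
  move=> m mij; split.
    case: m mij => [|m] mij; first exact: (Dc 0%N).
    have := Dc (2 * m).+1 ltac:(lia); rewrite /cell ifT; last lia.
    by rewrite (_ : uphalf (2 * m).+1 = m.+1); last lia.
  have := Dc (2 * m)%N ltac:(lia); rewrite /cell ifF; last lia.
  by rewrite (_ : (2 * m)./2 = m); last lia.
Qed.

End Expansions.

(** * Germs of injective functions *)

Section Arcs.
Variable R : realType.
Implicit Types (f psi : R[i] -> R[i]) (z w : R[i]) (t r : R).

Lemma expiD t t' : expi (t + t') = expi t * expi t'.
Proof. by rewrite /expi cosD sinD; apply/eqP; rewrite eq_complex /= eqxx addrC eqxx. Qed.

Lemma expi0 : expi (0 : R) = 1.
Proof. by rewrite /expi cos0 sin0. Qed.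

Lemma expiX t n : expi t ^+ n = expi (t *+ n).
Proof. by elim: n => [|n IH]; rewrite ?expr0 ?mulr0n ?expi0 // exprS mulrS expiD IH. Qed.

Lemma modulus_expi t : modulus (expi t) = 1.
Proof.
apply/eqP; rewrite -(eqrXn2 (n := 2)) ?modulus_ge0 // sqr_modulus expr1n.
by rewrite /= cos2Dsin2.
Qed.

Definition continuous_at_modulus f z := forall e : R, 0 < e ->
  exists2 d : R, 0 < d & forall w, modulus (w - z) < d -> modulus (f w - f z) < e.

Lemma derivable_continuous_modulus f z :
  derivable f z (1 : R[i]) -> continuous_at_modulus f z.
Proof.
move=> /derivable1_diffP/differentiable_continuous fz e e0.
have /cvgrPdist_lt/(_ e%:C) : f w @[w --> z] --> f z by exact: fz.
rewrite ltcR => /(_ e0) /nearCP[d d0 Hd].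
by exists d => // w /Hd; rewrite normC_modulus modulusB ltcR.
Qed.

(** [pr] stands for the real or the imaginary part; the result is a real function to which the
    intermediate value theorem applies. *)
Lemma continuous_path_component (pr : R[i] -> R) f (c s : R -> R) (t : R) :
  (forall z, `|pr z| <= modulus z) -> (forall z w, pr (z - w) = pr z - pr w) ->
  continuous_at_modulus f (c t +i* s t) ->
  {for t, continuous c} -> {for t, continuous s} ->
  {for t, continuous (fun t => pr (f (c t +i* s t)))}.
Proof.
move=> pr1 prB fc cc cs; apply/cvgrPdist_lt => e e0.
have [d d0 Hd] := fc e e0.
have d20 : 0 < d / 2 by rewrite divr_gt0.
have Hc : \forall u \near t, `|c t - c u| < d / 2 by move/cvgrPdist_lt: cc; exact.
have Hs : \forall u \near t, `|s t - s u| < d / 2 by move/cvgrPdist_lt: cs; exact.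
near=> u.
rewrite distrC -prB; apply: le_lt_trans (pr1 _) _; apply: Hd.
apply: le_lt_trans (modulus_ReIm _) _; rewrite (splitr d) /=.
by rewrite distrC [X in _ + X]distrC ltrD //; near: u.
Unshelve. all: by end_near.
Qed.

(* At the end points of the arc, [z ^ m] has argument [pi / 2] and [5 * pi / 4],
   so that the imaginary part changes sign in between. *)
Lemma arc_real_value f (m : nat) (A C r : R) : (0 < m)%N -> A != 0 -> 0 < r ->
  C * r < `|A| * sin (pi / 4) ->
  (forall t, pi / (2 * m%:R) <= t <= 5 * pi / (4 * m%:R) ->
    continuous_at_modulus f (r%:C * expi t) /\
    modulus (f (r%:C * expi t) - A%:C * (r%:C * expi t) ^+ m) <= C * r ^+ m.+1) ->
  exists2 t, pi / (2 * m%:R) <= t <= 5 * pi / (4 * m%:R) &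
    complex.Im (f (r%:C * expi t)) = 0.
Proof.
move=> m0 A0 r0 Cr Hf.
have m0' : (0 : R) < m%:R by rewrite ltr0n.
have pi0 := pi_gt0 R.
set t1 := pi / _ in Hf *; set t2 := 5 * pi / _ in Hf *.
have t12 : t1 <= t2.
  rewrite /t1 /t2 ler_pdivrMr ?mulr_gt0 // mulrAC.
  rewrite (_ : 5 * pi * (2 * m%:R) = (4 * m%:R) * (5 * pi / 2)); last by field.
  rewrite mulrAC divff ?mulf_neq0 ?gt_eqF // mul1r; lra.
pose g t := complex.Im (f (r * cos t +i* (r * sin t))).
have rE t : r%:C * expi t = r * cos t +i* (r * sin t).
  by apply/eqP; rewrite eq_complex /= !mul0r subr0 addr0 !eqxx.
have gc t : t1 <= t <= t2 -> {for t, continuous g}.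
  move=> /Hf[]; rewrite rE => fc _.
  apply: (@continuous_path_component (@complex.Im R) f (fun t => r * cos t) (fun t => r * sin t)) => //.
  - exact: normIm_modulus.
  - by move=> [? ?] [? ?].
  - by apply: continuousM; [exact: cst_continuous|exact: continuous_cos].
  - by apply: continuousM; [exact: cst_continuous|exact: continuous_sin].
have val t : t1 <= t <= t2 -> `|g t - A * r ^+ m * sin (t *+ m)| <= C * r ^+ m.+1.
  move=> /Hf[_]; apply: le_trans; apply: le_trans (normIm_modulus _).
  rewrite exprMn expiX rE -rmorphXn /= mulrA -rmorphM /=.
  by rewrite /g; case: (f _) => u v /=; rewrite mul0r addr0.
have rm : 0 < r ^+ m by rewrite exprn_gt0.
have s0 : 0 < sin (pi / 4) :> R.
  by apply: sin_gt0_pi; apply/andP; split; lra.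
(* The sines at the two end points are 1 and - sin(pi/4); the smaller absolute value decides how
   small the error has to be. *)
have small : C * r ^+ m.+1 < `|A| * r ^+ m * sin (pi / 4).
  rewrite exprS mulrA (_ : `|A| * _ * _ = `|A| * sin (pi / 4) * r ^+ m); last by ring.
  by rewrite ltr_pM2r.
have v1 := val t1 ltac:(by rewrite lexx t12).
have v2 := val t2 ltac:(by rewrite lexx t12).
have e1 : t1 *+ m = pi / 2.
  by rewrite -mulr_natr /t1; field; rewrite gt_eqF.
have e2 : t2 *+ m = pi / 4 + pi.
  by rewrite -mulr_natr /t2; field; rewrite gt_eqF.
rewrite e1 sin_pihalf mulr1 in v1; rewrite e2 sinDpi mulrN in v2.
have s1 : sin (pi / 4) <= 1 :> R by exact: sin_le1.
have [c c12 gc0] : exists2 c, c \in `[t1, t2] & g c = 0.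
  apply: IVT => //.
    apply: continuous_in_subspaceT => t; rewrite inE /= in_itv /=; exact: gc.
  have [A1|A1] := ltP 0 A.
    rewrite gtr0_norm // in small.
    have S1 : A * r ^+ m * sin (pi / 4) <= A * r ^+ m by rewrite ler_piMr // ltW // mulr_gt0.
    have g1 : 0 < g t1 by move: v1; rewrite ler_distl => /andP[]; lra.
    have g2 : g t2 < 0 by move: v2; rewrite ler_distl => /andP[]; lra.
    by rewrite ge_min le_max (ltW g1) (ltW g2) orbT.
  rewrite ler0_norm // in small.
  have A2 : 0 < - A by rewrite oppr_gt0 lt_neqAle A0.
  have S1 : - A * r ^+ m * sin (pi / 4) <= - A * r ^+ m by rewrite ler_piMr // ltW // mulr_gt0.
  rewrite !mulNr in small S1.
  have g1 : g t1 < 0 by move: v1; rewrite ler_distl => /andP[]; lra.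
  have g2 : 0 < g t2 by move: v2; rewrite ler_distl => /andP[]; lra.
  by rewrite ge_min le_max (ltW g1) (ltW g2) orbT.
by exists c; [move: c12; rewrite in_itv|rewrite rE].
Qed.

(** [I] has to contain the arc and its conjugate, where psi would take equal values; only these arcs
    are required, so that a sector may suffice. *)
Lemma injective_germ_leading psi g (I : set R[i]) (c : nat -> R) (m : nat) (e : R) :
  (1 < m)%N -> (forall i, (i < m)%N -> c i = 0) -> c m != 0 ->
  has_series (fun z => g z - g 0) c ->
  (forall z, I z -> derivable psi z (1 : R[i])) -> {in I &, injective psi} ->
  0 < e -> (forall z, modulus z < e -> I z -> g z = psi z) ->
  (forall r t, 0 < r < e -> pi / (2 * m%:R) <= `|t| <= 5 * pi / (4 * m%:R) ->
     I (r%:C * expi t)) ->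
  False.
Proof.
move=> m1 c0 cm Hg Dpsi Ipsi e0 gpsi HI.
have pi0 := pi_gt0 R.
have m0 : (0 : R) < m%:R by rewrite ltr0n ltnW.
have [e1 e10 Hconj] := has_seriesJ Hg.
have [C [e2 [C0 e20 Hlead]]] := has_series_lead Hg c0.
pose s := sin (pi / 4) : R.
have s0 : 0 < s by apply: sin_gt0_pi; apply/andP; split; lra.
pose b := `|c m| * s / (C + 1).
have b0 : 0 < b by rewrite /b divr_gt0 ?mulr_gt0 ?normr_gt0 // ltr_wpDl.
(* The four bounds ensure, in turn, that g = psi, that g commutes with conjugation, that the leading
   term dominates, and that its sign is visible at the ends of the arc. *)
have [r r0 [re re1 re2 rb]] : exists2 r, 0 < r & [/\ r < e, r < e1, r < e2 & r < b].
  exists (Num.min (Num.min e e1) (Num.min e2 b) / 2).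
    by rewrite divr_gt0 // !lt_min e0 e10 e20 b0.
  have mn (x y : R) : 0 < x -> x <= y -> x / 2 < y by lra.
  by split; apply: mn; rewrite ?ge_min ?lt_min ?lexx ?orbT ?e0 ?e10 ?e20 ?b0.
have Cr : C * r < `|c m| * s.
  move: rb; rewrite /b ltr_pdivlMr ?ltr_wpDl // mulrDr mulr1 [r * C]mulrC; lra.
have zr t : modulus (r%:C * expi t) = r.
  by rewrite modulusM modulus_expi mulr1 modulus_real gtr0_norm.
have t1pos : 0 < pi / (2 * m%:R) :> R by rewrite divr_gt0 ?mulr_gt0.
have Harc t : pi / (2 * m%:R) <= t <= 5 * pi / (4 * m%:R) ->
    continuous_at_modulus (fun z => psi z - g 0) (r%:C * expi t) /\
    modulus (psi (r%:C * expi t) - g 0 - (c m)%:C * (r%:C * expi t) ^+ m) <=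
      C * r ^+ m.+1.
  move=> tI; have t0 : 0 < t by case/andP: tI => t1 _; exact: lt_le_trans t1.
  have Iz : I (r%:C * expi t) by apply: HI; rewrite ?r0 // gtr0_norm.
  split.
    move=> d /(derivable_continuous_modulus (Dpsi _ Iz))[d' d'0 Hd].
    by exists d' => // w /Hd; rewrite (_ : psi w - psi _ = psi w - g 0 - (psi (r%:C * expi t) - g 0)) //; ring.
  by rewrite -gpsi ?zr //; have := Hlead (r%:C * expi t); rewrite zr; exact.
have [t tI Imt] := arc_real_value (ltnW m1) cm r0 Cr Harc.
have t0 : 0 < t by case/andP: tI => t1 _; exact: lt_le_trans t1.
have Iz : I (r%:C * expi t) by apply: HI; rewrite ?r0 // gtr0_norm.
have Izc : I (r%:C * expi (- t)) by apply: HI; rewrite ?r0 // normrN gtr0_norm.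
have zJ : (r%:C * expi t)^*%C = r%:C * expi (- t).
  by rewrite conjcM conjc_real /expi cosN sinN.
have : r%:C * expi t = r%:C * expi (- t).
  apply: Ipsi; rewrite ?inE // -!gpsi ?zr //; apply: (addIr (- g 0)).
  rewrite -zJ Hconj ?zr // (gpsi _ _ Iz) ?zr //.
  by case: (psi _ - _) Imt => u v /= ->; rewrite /conjc oppr0.
move=> /(mulfI _) -/(_ ltac:(by rewrite -modulus_eq0 modulus_real normr_eq0 gt_eqF)).
move=> /(congr1 (@complex.Im R)) /= /eqP; rewrite sinN -addr_eq0 -mulr2n mulrn_eq0 /=.
(* The point is not real: 5 pi/(4m) < pi because m >= 2. *)
rewrite gt_eqF //; apply: sin_gt0_pi; rewrite t0 /=.
have /andP[_ t2] := tI; apply: le_lt_trans t2 _.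
rewrite ltr_pdivrMr ?mulr_gt0 // mulrC ltr_pM2l //.
have : (2 : R) <= m%:R by rewrite ler_nat.
lra.
Qed.

End Arcs.

(** * Interiors of closed curves *)

Section Interior.
Variable R : realType.
Implicit Types (S : set R[i]) (z w : R[i]) (t r : R).

Lemma segment_component S z0 z :
  (forall t, 0 <= t <= 1 -> ~ S (z0 + t%:C * (z - z0))) ->
  connected_component (~` S) z0 z.
Proof.
move=> H.
pose f t := z0 + t%:C * (z - z0).
have fc : continuous f.
  move=> t; apply/cvgrPdist_lt => e e0.
  have eE : e = (complex.Re e)%:C by rewrite RRe_real // gtr0_real.
  have re0 : 0 < complex.Re e by rewrite -ltcR -eE.
  have d0 : 0 < complex.Re e / (modulus (z - z0) + 1).
    by rewrite divr_gt0 // ltr_wpDl // modulus_ge0.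
  near=> u.
  rewrite normC_modulus eE ltcR /f.
  have -> : z0 + t%:C * (z - z0) - (z0 + u%:C * (z - z0)) = (t - u)%:C * (z - z0).
    by rewrite rmorphB /=; ring.
  rewrite modulusM modulus_real.
  have : `|t - u| < complex.Re e / (modulus (z - z0) + 1).
    by near: u; move: (@cvg_id _ (nbhs t)) => /cvgrPdist_lt; apply.
  rewrite ltr_pdivlMr ?ltr_wpDl ?modulus_ge0 // mulrDr mulr1.
  by apply: le_lt_trans; rewrite lerDl.
have cD : connected (f @` `[0, 1]).
  apply: connected_continuous_connected; first exact: segment_connected.
  exact: continuous_subspaceT.
have f0 : f 0 = z0 by rewrite /f mul0r addr0.
have f1 : f 1 = z by rewrite /f mul1r addrC subrK.
have Dz0 : (f @` `[0, 1]) z0 by exists 0 => //=; rewrite in_itv /= lexx ler01.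
have Dz : (f @` `[0, 1]) z by exists 1 => //=; rewrite in_itv /= lexx ler01.
have DS : f @` `[0, 1] `<=` ~` S by move=> _ [t + <-]; rewrite /= in_itv /=; exact: H.
exact: (connected_component_max Dz0 DS cD Dz).
Unshelve. all: by end_near.
Qed.

Lemma curve_int_segment S z0 z : curve_int S z0 ->
  (forall t, 0 <= t <= 1 -> ~ S (z0 + t%:C * (z - z0))) -> curve_int S z.
Proof.
move=> [Sz0 bz0] H; split.
  by have := H 1; rewrite ler01 lexx mul1r addrC subrK; exact.
by rewrite -(same_connected_component (segment_component H)).
Qed.

(** A horizontal ray missing [S] lies in one component of the complement, which is then
    unbounded. *)
Lemma curve_int_ray S z (u : R) : curve_int S z -> u != 0 ->
  (forall t, 0 <= t -> ~ S (z + (t * u)%:C)) -> False.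
Proof.
move=> zS u0 H; have [_ /pinfty_ex_gt0[M M0 HM]] := zS.
have ME : M = (complex.Re M)%:C by rewrite RRe_real // gtr0_real.
pose t := (complex.Re M + modulus z + 1) / `|u|.
have rM : 0 < complex.Re M by rewrite -ltcR -ME.
have t0 : 0 <= t.
  by rewrite /t divr_ge0 // !addr_ge0 ?modulus_ge0 // ltW.
have comp : connected_component (~` S) z (z + (t * u)%:C).
  apply: segment_component => v /andP[v0 _].
  rewrite [z + _ - z]addrC addKr -rmorphM /= mulrA.
  by apply: H; rewrite mulr_ge0.
have := HM _ comp; rewrite /= normC_modulus ME lecR.
have : modulus (t * u)%:C <= modulus (z + (t * u)%:C) + modulus z.
  rewrite -{1}[(t * u)%:C](addKr z) addrC; apply: le_trans (modulusD _ _) _.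
  by rewrite modulusN.
rewrite modulus_real normrM (ger0_norm t0) /t mulfVK ?normr_eq0 //.
lra.
Qed.

Lemma curve_int_disk S (d : R) : (forall z, S z -> d <= modulus z) ->
  curve_int S 0 -> forall z, modulus z < d -> curve_int S z.
Proof.
move=> Sd S0 z zd; apply: (curve_int_segment S0) => t /andP[t0 t1].
rewrite add0r subr0 => /Sd; apply/negP; rewrite -ltNge; apply: le_lt_trans zd.
by rewrite modulusM modulus_real ger0_norm // ler_piMl // modulus_ge0.
Qed.

(** The bound on the real part makes [S] tangent to the imaginary axis at 0. A path inside goes
    along the real axis from [r] to Re z, then vertically to [z]. *)
Lemma curve_int_sector S (r C : R) : curve_int S r%:C -> S 0 -> S 1 -> 0 <= C ->
  (forall z, S z -> complex.Im z = 0 -> z = 0 \/ z = 1) ->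
  (forall z, S z -> `|complex.Re z| <= C * modulus z ^+ 2) ->
  forall k : R, 0 < k -> exists2 e : R, 0 < e &
    forall z, z != 0 -> modulus z < e -> k * modulus z <= complex.Re z -> curve_int S z.
Proof.
move=> rS S0 S1 C0 Sreal SRe k k0.
have Sr (t : R) : S t%:C -> t = 0 \/ t = 1.
  by move=> St; have [//|/complexI ->|/complexI ->] := Sreal _ St; [left|right].
(* [S] meets the real axis only at 0 and 1, so a real point outside [0, 1] could escape to infinity
   along the axis. *)
have r01 : 0 < r < 1.
  have r0 : r != 0 by apply/eqP => r0; case: rS; rewrite r0.
  have r1 : r != 1 by apply/eqP => r1; case: rS; rewrite r1.
  apply/andP; split; rewrite ltNge; apply/negP => rle.
    apply: (@curve_int_ray S r%:C (-1) rS); first by rewrite oppr_eq0 oner_eq0.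
    move=> t t0; rewrite -rmorphD /= => /Sr[]; move/eqP: r0; lra.
  apply: (@curve_int_ray S r%:C 1 rS); first by rewrite oner_eq0.
  move=> t t0; rewrite -rmorphD /= => /Sr[]; move/eqP: r1; lra.
exists (Num.min 1 (k / (C + 1))).
  by rewrite lt_min ltr01 divr_gt0 // ltr_wpDl.
move=> z z0; rewrite lt_min => /andP[z1 zk] zRe.
have mz : 0 < modulus z by rewrite modulus_gt0.
have Rez0 : 0 < complex.Re z by apply: lt_le_trans zRe; rewrite mulr_gt0.
have Rez1 : complex.Re z < 1.
  by apply: le_lt_trans z1; apply: le_trans (normRe_modulus z); exact: ler_norm.
have xS : curve_int S (complex.Re z)%:C.
  apply: (curve_int_segment rS) => t t01.
  rewrite -rmorphB -rmorphM -rmorphD /= => /Sr.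
  set v := r + _.
  have : 0 < v < 1.
    have -> : v = (1 - t) * r + t * complex.Re z by rewrite /v; ring.
    case/andP: t01 => t0 t1; case/andP: r01 => r0 r1.
    have conv01 (a b : R) : 0 < a -> 0 < b -> 0 < (1 - t) * a + t * b.
      move=> a0 b0; have [t1'|t1'] := ltP t 1.
        by rewrite ltr_pwDl ?mulr_ge0 ?mulr_gt0 ?subr_gt0 // ltW.
      by rewrite (le_anti (introT andP (conj t1 t1'))) subrr mul0r add0r mul1r.
    rewrite conv01 //= -subr_gt0.
    have -> : 1 - ((1 - t) * r + t * complex.Re z) =
      (1 - t) * (1 - r) + t * (1 - complex.Re z) by ring.
    by rewrite conv01 // subr_gt0.
  by move=> /andP[v0 v1] [] ve; move: v0 v1; rewrite ve ?ltxx.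
(* A point w of [S] on the vertical segment has the real part of z and modulus at most |z|, so k |w|
   <= C |w|^2, against |z| < k / (C + 1). *)
apply: (curve_int_segment xS) => t /andP[t0 t1].
set w := _ + _ => Sw.
have Rew : complex.Re w = complex.Re z.
  by rewrite /w; case: (z) => a b /=; rewrite !mul0r; ring.
have Imw : complex.Im w = t * complex.Im z.
  by rewrite /w; case: (z) => a b /=; rewrite !mul0r; ring.
have wz : modulus w <= modulus z.
  rewrite -(ler_pXn2r (n := 2)) ?nnegrE ?modulus_ge0 // !sqr_modulus Rew Imw.
  rewrite lerD2l exprMn ler_piMl ?sqr_ge0 //.
  by rewrite exprn_ile1.
have w0 : 0 < modulus w.
  by rewrite modulus_gt0; apply/eqP => w0; move: Rew; rewrite w0 /= => e; rewrite -e ltxx in Rez0.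
have := SRe _ Sw; rewrite Rew gtr0_norm // => H.
have : k * modulus w <= C * modulus w ^+ 2.
  apply: le_trans H; apply: le_trans zRe; by rewrite ler_pM2l.
rewrite expr2 mulrA ler_pM2r // => kC.
move: zk; rewrite ltr_pdivlMr ?ltr_wpDl // mulrDr mulr1 => zk.
have : C * modulus w <= C * modulus z by rewrite ler_wpM2l.
lra.
Qed.

End Interior.

(** * The kernel curves near the origin *)

Section KernelCurves.
Variables (R : realType) (p : int -> int -> R).
Hypothesis Hp : admissible_weights p.
Implicit Types (x y z s : R[i]).

Lemma jump00 : jump p 0 0 = p 1 1.
Proof. by rewrite /jump subr0. Qed.

Lemma jump01 : jump p 0 1 = p 1 0.
Proof. by rewrite /jump subr0 subrr. Qed.

Lemma jump10 : jump p 1 0 = p 0 1.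
Proof. by rewrite /jump subr0 subrr. Qed.

Lemma walk_kernelJ x y : modulus x <= 1 -> modulus y <= 1 ->
  walk_kernel p x^*%C y^*%C = (walk_kernel p x y)^*%C.
Proof.
move=> x1 y1.
have /has_usumJ H1 := walk_kernel_series Hp x1 y1.
have := @walk_kernel_series _ _ Hp x^*%C y^*%C; rewrite !modulusJ => /(_ x1 y1) H2.
rewrite -(has_usum_unique H1) -(has_usum_unique H2); congr usum.
apply/funext => ab; rewrite /double_family conjcM conjcM !conjcX conjc_real //.
Qed.

(** The weights have total mass at most 1, so all terms of degree at least [n] together are bounded
    by rho^n, with constant 1. *)
Lemma walk_kernel_tail (B : seq (nat * nat)) n x y (rho : R) : uniq B ->
  modulus x <= rho -> modulus y <= rho -> rho <= 1 ->
  (forall a b, (a, b) \notin B -> (n <= a + b)%N) ->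
  modulus (x * y - walk_kernel p x y - \sum_(ab <- B) double_family (jump p) x y ab) <=
    rho ^+ n.
Proof.
move=> uB xr yr r1 HB; have r0 : 0 <= rho := le_trans (modulus_ge0 x) xr.
rewrite -(big_fset_seq _ uB); apply: has_usum_tail.
  by apply: (walk_kernel_jump Hp); apply: le_trans r1.
move=> A /fdisjointP AB; apply: le_trans (modulus_sum _ _ _) _.
apply: (@le_trans _ _ (\sum_(ab <- A) jump p ab.1 ab.2 * rho ^+ n)); last first.
  by rewrite -mulr_suml ler_piMl ?exprn_ge0 // sum_jump_le1.
rewrite big_seq [X in _ <= X]big_seq; apply: ler_sum => -[a b] /AB.
rewrite mem_fset_seq => /HB nab.
rewrite /double_family /= -mulrA !modulusM !modulusX modulus_real ger0_norm ?jump_ge0 //.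
rewrite ler_wpM2l ?jump_ge0 //.
apply: (@le_trans _ _ (rho ^+ (a + b))); last exact: ler_wiXn2l.
by rewrite exprD ler_pM ?exprn_ge0 ?modulus_ge0 // lerXn2r ?nnegrE ?modulus_ge0.
Qed.

Variable eta : R[i] -> R[i].
Hypothesis Heta : root_branch p eta.

Lemma circle_modulus s : circle s -> modulus s = 1.
Proof. by rewrite /circle /= normC_modulus => -[]. Qed.

Lemma modulus_circle s : modulus s = 1 -> circle s.
Proof. by rewrite /circle /= normC_modulus => ->. Qed.

Lemma circle_neq0 s : circle s -> s != 0.
Proof. by move=> /circle_modulus s1; rewrite -modulus_eq0 s1 oner_eq0. Qed.

Lemma circle_inv s : circle s -> s^-1 = s^*%C.
Proof.
move=> cs; apply: (mulfI (circle_neq0 cs)); rewrite divff ?circle_neq0 //.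
by rewrite -sqr_normc; move: cs; rewrite /circle /= => ->; rewrite expr1n.
Qed.

Lemma circleJ s : circle s -> circle s^*%C.
Proof. by move=> /circle_modulus s1; apply: modulus_circle; rewrite modulusJ. Qed.

Lemma circleN s : circle s -> circle (- s).
Proof. by move=> /circle_modulus s1; apply: modulus_circle; rewrite modulusN. Qed.

Lemma root_branch_root s : circle s ->
  modulus (eta s) <= 1 /\ walk_kernel p (gamma1 eta s) (gamma2 eta s) = 0.
Proof.
move=> cs; have [_ _ H0 H1] := Heta.
suff [] : `|eta s| <= 1 /\ walk_kernel p (gamma1 eta s) (gamma2 eta s) = 0.
  by rewrite normC_modulus lecR => -> ->.
rewrite /gamma1 /gamma2; have [p0|p0] := eqVneq (p 1 1) 0.
  have [_ /(_ s cs) E] := H0 p0.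
  by have /= -> := congr1 (fun A : set R[i] => A (eta s)) E; right.
have [_ /(_ s cs) E] := H1 p0.
by have /= -> := congr1 (fun A : set R[i] => A (eta s)) E; left.
Qed.

Lemma modulus_gamma1 s : circle s -> modulus (gamma1 eta s) = modulus (eta s).
Proof. by move=> /circle_modulus s1; rewrite /gamma1 modulusM s1 mulr1. Qed.

Lemma modulus_gamma2 s : circle s -> modulus (gamma2 eta s) = modulus (eta s).
Proof. by move=> /circle_modulus s1; rewrite /gamma2 modulusM modulusV s1 invr1 mulr1. Qed.

(** Keeps the curves at distance p_{1,1}/2 from 0: at a root, the constant term p_{1,1} is
    compensated by x y, of modulus |eta|^2 <= |eta|, and by terms of total size |eta|. *)
Lemma root_modulus_ge0 s : circle s -> p 1 1 <= 2 * modulus (eta s).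
Proof.
move=> cs; have [e1 K0] := root_branch_root cs.
have := @walk_kernel_tail [:: (0%N, 0%N)] 1 (gamma1 eta s) (gamma2 eta s) (modulus (eta s)) isT.
rewrite modulus_gamma1 // modulus_gamma2 // lexx e1 => /(_ isT isT isT).
rewrite K0 subr0 big_seq1 /double_family /= !expr0 !mulr1 jump00 expr1 => H.
have {}H : modulus (gamma1 eta s * gamma2 eta s - (p 1 1)%:C) <= modulus (eta s).
  by apply: H => -[|a] [|b].
have : modulus (p 1 1)%:C <= modulus (gamma1 eta s * gamma2 eta s) +
    modulus (gamma1 eta s * gamma2 eta s - (p 1 1)%:C).
  rewrite -{1}[(p 1 1)%:C](subKr (gamma1 eta s * gamma2 eta s)).
  exact: modulusBD.
rewrite modulus_real ger0_norm ?(weights_ge0 Hp) // modulusM modulus_gamma1 // modulus_gamma2 //.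
have : modulus (eta s) * modulus (eta s) <= modulus (eta s) by rewrite ler_piMr ?modulus_ge0.
lra.
Qed.

Hypothesis p11 : p 1 1 = 0.

(** Without constant term the kernel equation is divisible by eta; x y and the terms of degree at
    least 2 contribute |eta|^2 each. *)
Lemma root_linear_part s : circle s -> eta s != 0 ->
  modulus ((p 1 0)%:C * s^-1 + (p 0 1)%:C * s) <= 2 * modulus (eta s).
Proof.
move=> cs e0; have [e1 K0] := root_branch_root cs.
have := @walk_kernel_tail [:: (0%N, 0%N); (0%N, 1%N); (1%N, 0%N)] 2
  (gamma1 eta s) (gamma2 eta s) (modulus (eta s)) isT.
rewrite modulus_gamma1 // modulus_gamma2 // lexx e1 => /(_ isT isT isT).
rewrite K0 subr0 !big_cons big_nil /double_family /= jump00 jump01 jump10 p11.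
rewrite !expr0 !expr1 !mulr1 !addr0 add0r => H.
have {}H : modulus (gamma1 eta s * gamma2 eta s -
    eta s * ((p 1 0)%:C * s^-1 + (p 0 1)%:C * s)) <= modulus (eta s) ^+ 2.
  rewrite (_ : eta s * _ = (p 1 0)%:C * gamma2 eta s + (p 0 1)%:C * gamma1 eta s).
    by apply: H => -[|[|a]] [|[|b]]; rewrite ?inE //; lia.
  by rewrite /gamma1 /gamma2; ring.
set L := (p 1 0)%:C * s^-1 + _ in H *.
have m0 : 0 < modulus (eta s) by rewrite modulus_gt0.
rewrite -(ler_pM2l m0) -modulusM.
rewrite -[eta s * L](subKr (gamma1 eta s * gamma2 eta s)).
apply: le_trans (modulusBD _ _) _.
rewrite modulusM modulus_gamma1 // modulus_gamma2 //.
move: H; rewrite expr2; lra.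
Qed.

(** On the circle the linear part has modulus at least |p_{0,1} - p_{1,0}|; when these weights
    differ, non-zero roots stay away from 0. *)
Lemma root_modulus_ge s : circle s -> eta s != 0 ->
  `|p 0 1 - p 1 0| <= 2 * modulus (eta s).
Proof.
move=> cs e0; apply: le_trans (root_linear_part cs e0).
have s1 := circle_modulus cs.
have m1 : modulus ((p 1 0)%:C * s^-1) = p 1 0.
  by rewrite modulusM modulusV s1 invr1 mulr1 modulus_real ger0_norm ?(weights_ge0 Hp).
have m2 : modulus ((p 0 1)%:C * s) = p 0 1.
  by rewrite modulusM s1 mulr1 modulus_real ger0_norm ?(weights_ge0 Hp).
set u := (p 1 0)%:C * s^-1 in m1 *; set v := (p 0 1)%:C * s in m2 *.
have h1 : modulus u <= modulus (u + v) + modulus v.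
  by rewrite -{1}(addrK v u) modulusBD.
have h2 : modulus v <= modulus (u + v) + modulus u.
  by rewrite [u + v]addrC -{1}(addrK u v) modulusBD.
rewrite ler_norml; apply/andP; split; lra.
Qed.

(** The kernel equation at - s makes - eta(- s) a root at s, hence 0 or eta(s). If it is 0, the same
    dichotomy at - s gives eta(s) = 0 too. *)
Lemma root_branchN s : circle s -> eta (- s) = - eta s.
Proof.
move=> cs; have [_ _ /(_ p11)[_ H] _] := Heta.
have key t : circle t -> eta (- t) = 0 \/ eta (- t) = - eta t.
  move=> ct; have [e1 K0] := root_branch_root (circleN ct).
  have : [set 0; eta t] (- eta (- t)).
    have /= <- := congr1 (fun A : set R[i] => A (- eta (- t))) (H t ct); split; first by rewrite normrN normC_modulus lecR.
    by move: K0; rewrite /gamma1 /gamma2 mulrN mulNr invrN mulrN mulNr.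
  move=> [/= /eqP|/= <-]; last by right; rewrite opprK.
  by rewrite oppr_eq0 => /eqP; left.
have [e0|//] := key s cs; have [|] := key (- s) (circleN cs); rewrite opprK e0.
  by move=> ->; rewrite oppr0.
by rewrite oppr0 => ->; rewrite oppr0.
Qed.

(** The dichotomy between the two roots again, now with the conjugation symmetry of the kernel. *)
Lemma root_branchJ s : circle s -> eta s^*%C = (eta s)^*%C.
Proof.
move=> cs; have [_ _ /(_ p11)[_ H] _] := Heta.
have key t : circle t -> eta t^*%C = 0 \/ eta t^*%C = (eta t)^*%C.
  move=> ct; have [e1 K0] := root_branch_root (circleJ ct).
  have : [set 0; eta t] (eta t^*%C)^*%C.
    have /= <- := congr1 (fun A : set R[i] => A (eta t^*%C)^*%C) (H t ct); split; first by rewrite normC_modulus modulusJ lecR.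
    have E1 : (eta t^*%C)^*%C * t = (gamma1 eta t^*%C)^*%C by rewrite conjcM conjcK.
    have E2 : (eta t^*%C)^*%C * t^-1 = (gamma2 eta t^*%C)^*%C.
      by rewrite conjcM !circle_inv ?conjcK //; exact: circleJ.
    rewrite E1 E2 walk_kernelJ ?K0 ?conjc0 //.
      by rewrite modulus_gamma1 //; exact: circleJ.
    by rewrite modulus_gamma2 //; exact: circleJ.
  move=> [/= e|/= <-]; last by right; rewrite conjcK.
  by left; rewrite -[LHS]conjcK e conjc0.
have [e0|//] := key s cs; have [|] := key s^*%C (circleJ cs); rewrite conjcK e0.
  by move=> ->; rewrite conjc0.
by rewrite conjc0 => ->; rewrite conjc0.
Qed.

Lemma root_branch1 : eta 1 = 1. Proof. by have [] := Heta. Qed.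

(** A real value is also taken at the conjugate of s, so simplicity forces s = 1, -1, i or - i. The
    values there are 1 and gam(i), and the latter is 0 because 0 is on the curve. *)
Lemma curve_real_points (gam : R[i] -> R[i]) s :
  (forall s, circle s -> gam s^*%C = (gam s)^*%C) ->
  (forall s, circle s -> gam (- s) = gam s) -> gam 1 = 1 ->
  (forall s t, circle s -> circle t -> gam s = gam t -> t = s \/ t = - s) ->
  (exists2 s0, circle s0 & gam s0 = 0) ->
  circle s -> complex.Im (gam s) = 0 -> gam s = 0 \/ gam s = 1.
Proof.
move=> gJ gN g1 gI [s0 cs0 gs0] cs gs.
have real t : circle t -> complex.Im (gam t) = 0 ->
    gam t = 1 \/ gam t = gam 'i%C.
  move=> ct Imt.
  have gtt : gam t^*%C = gam t.
    by rewrite gJ //; case: (gam t) Imt => u v /= ->; rewrite /conjc oppr0.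
  have t2 := circle_modulus ct.
  have := sqr_modulus t; rewrite t2 expr1n => t2'.
  case: (gI _ _ (circleJ ct) ct gtt) => [tE|tE].
    left; have Im0 : complex.Im t = 0.
      by move: tE => /(congr1 (@complex.Im R)); case: (t) => a b /= ?; lra.
    move/eqP: t2'; rewrite Im0 expr0n addr0 eq_sym sqrf_eq1 => /orP[/eqP r1|/eqP r1].
      by rewrite (_ : t = 1) //; case: (t) r1 Im0 => a b /= -> ->.
    rewrite (_ : t = - 1) ?gN ?g1 //; last first.
      by case: (t) r1 Im0 => a b /= -> ->; apply/eqP; rewrite eq_complex /= oppr0 !eqxx.
    by apply: modulus_circle; rewrite modulus1.
  right; have Re0 : complex.Re t = 0.
    by move: tE => /(congr1 (@complex.Re R)); case: (t) => a b /= ?; lra.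
  have ci : circle ('i%C : R[i]).
    apply: modulus_circle; apply/eqP; rewrite -(eqrXn2 (n := 2)) ?modulus_ge0 //.
    by rewrite sqr_modulus /= expr0n add0r.
  move/eqP: t2'; rewrite Re0 expr0n add0r eq_sym sqrf_eq1 => /orP[/eqP r1|/eqP r1].
    by rewrite (_ : t = 'i%C) //; case: (t) r1 Re0 => a b /= -> ->.
  rewrite (_ : t = - 'i%C) ?gN //.
  by case: (t) r1 Re0 => a b /= -> ->; apply/eqP; rewrite eq_complex /= oppr0 !eqxx.
have [->|->] := real s cs gs; first by right.
left; have [||<-//] := real s0 cs0; first by rewrite gs0.
by rewrite gs0 => /eqP; rewrite eq_sym oner_eq0.
Qed.

(* Near its zeros at [s = i] and [s = - i], [eta] is real to first order:
   dividing the kernel equation by [eta] gives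
   [eta * (D0 + o(1)) = 2 * q * Re s] with [D0 > 0]. *)
Lemma root_Im_le s : p 1 0 = p 0 1 -> 0 < p 0 1 -> circle s ->
  let q := p 0 1 in
  eta s != 0 -> `|complex.Re s| <= modulus (eta s) / q /\
  `|complex.Im (eta s)| <= (1 + 4 / q) / (2 * q) * modulus (eta s) ^+ 2.
Proof.
move=> p10 q0 cs q e0; have [e1 K0] := root_branch_root cs.
have s1 := circle_modulus cs.
set e := eta s in e0 e1 *; set rho := modulus e in e1 *.
have rho0 : 0 < rho by rewrite /rho modulus_gt0.
have sJ : s + s^*%C = (2 * complex.Re s)%:C by rewrite addcJ rmorphM rmorph_nat.
have ssJ : s * s^*%C = 1 by rewrite -circle_inv // divff // circle_neq0.
have ReS : `|complex.Re s| <= rho / q.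
  have := root_linear_part cs e0; rewrite p10 -/q circle_inv // -mulrDr addrC sJ.
  rewrite -rmorphM modulus_real /= !normrM (gtr0_norm q0) ger0_norm // -/rho => H.
  by rewrite ler_pdivlMr // mulrC -(ler_pM2l (ltr0Sn R 1)) mulrCA.
split=> //.
pose j11 := jump p 1 1; pose j02 := jump p 0 2; pose j20 := jump p 2 0.
have j0 a b : 0 <= jump p a b by exact: jump_ge0.
have jle a b : jump p a b <= 1.
  by have := sum_jump_le1 Hp [fset (a, b)]%fset; rewrite big_seq_fset1.
have D0ge : 2 * q <= 1 - j11 + j02 + j20.
  have := sum_jump_le1 Hp [fset ab in [:: (1%N, 1%N); (0%N, 1%N); (1%N, 0%N)]]%fset.
  rewrite big_fset_seq // !big_cons big_nil /= jump01 jump10 p10 -/q -/j11.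
  have := j0 0%N 2; have := j0 2%N 0%N; rewrite -/j02 -/j20; lra.
(* The coefficient of eta^2 at s = i and s = - i, where s^2 = -1. It is at least 2 q since the
   weights j11, q, q have sum at most 1. [E] is its deviation at other s, a multiple of s + 1/s = 2
   Re s, and [W] gathers the terms of higher degree. *)
set D0 := 1 - j11 + j02 + j20 in D0ge.
pose E := j02%:C * (s^*%C * (s + s^*%C)) + j20%:C * (s * (s + s^*%C)).
pose W := e * (D0%:C - E) - (2 * q * complex.Re s)%:C.
have Wle : modulus W <= rho ^+ 2.
  have := @walk_kernel_tail [:: (0%N, 0%N); (0%N, 1%N); (1%N, 0%N); (1%N, 1%N);
    (0%N, 2); (2, 0%N)] 3 (gamma1 eta s) (gamma2 eta s) rho isT.
  rewrite modulus_gamma1 // modulus_gamma2 // lexx e1 => /(_ isT isT isT) H.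
  have {}H : modulus (e * W) <= rho ^+ 3.
    have <- : gamma1 eta s * gamma2 eta s - walk_kernel p (gamma1 eta s) (gamma2 eta s) -
       \sum_(ab <- [:: (0%N, 0%N); (0%N, 1%N); (1%N, 0%N); (1%N, 1%N);
          (0%N, 2); (2, 0%N)]) double_family (jump p) (gamma1 eta s) (gamma2 eta s) ab
      = e * W.
      rewrite K0 subr0 !big_cons big_nil /double_family /= jump00 jump01 jump10 p11 p10.
      rewrite !expr0 !expr1 !mulr1 !addr0 -/q -/j11 -/j02 -/j20 /gamma1 /gamma2 -/e.
      rewrite circle_inv // /W /E /D0.
      have -> : (2 * q * complex.Re s)%:C = q%:C * (s + s^*%C).
        by rewrite sJ -rmorphM /= mulrCA mulrA.
      rewrite !rmorphD rmorphN /=.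
      set t := s^*%C in ssJ *; apply/subr0_eq.
      transitivity (e ^+ 2 * (1 - j11%:C + j02%:C + j20%:C) * (s * t - 1)).
        by rewrite ?rmorph1; ring.
      by rewrite ssJ subrr mulr0.
    by apply: H => -[|[|[|a]]] [|[|[|b]]]; rewrite ?inE //; lia.
  move: H; rewrite modulusM -/rho exprS ler_pM2l //.
have Ele : modulus E <= 4 * (rho / q).
  have m2 : modulus (s + s^*%C) <= 2 * (rho / q).
    by rewrite sJ modulus_real normrM ger0_norm // ler_pM2l.
  apply: le_trans (modulusD _ _) _.
  rewrite !modulusM modulusJ s1 !mul1r !modulus_real !ger0_norm ?j0 //.
  have := ler_wpM2r (modulus_ge0 (s + s^*%C)) (jle 0%N 2).
  have := ler_wpM2r (modulus_ge0 (s + s^*%C)) (jle 2 0%N).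
  rewrite -/j02 -/j20; lra.
(* The term 2 q Re s is real and drops out; what remains is of order |eta|^2. *)
have ImE : complex.Im e * D0 = complex.Im W + complex.Im (e * E).
  have -> : W = e * D0%:C - e * E - (2 * q * complex.Re s)%:C by rewrite /W mulrBr.
  by case: (e * E) => u v; case: (e) => a b /=; ring.
have : `|complex.Im e| * D0 <= (1 + 4 / q) * rho ^+ 2.
  have D00 : 0 < D0 by apply: lt_le_trans D0ge; rewrite mulr_gt0.
  rewrite -[D0]gtr0_norm // -normrM ImE; apply: le_trans (ler_normD _ _) _.
  have h1 := le_trans (normIm_modulus W) Wle.
  have h2 : `|complex.Im (e * E)| <= 4 / q * rho ^+ 2.
    apply: le_trans (normIm_modulus _) _; rewrite modulusM -/rho.
    rewrite (_ : 4 / q * _ = rho * (4 * (rho / q))); last by rewrite expr2; ring.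
    by rewrite ler_pM2l.
  by rewrite mulrDl mul1r lerD.
have le1 : `|complex.Im e| * (2 * q) <= `|complex.Im e| * D0 by rewrite ler_wpM2l.
move=> /(le_trans le1); rewrite -ler_pdivlMr ?mulr_gt0 //.
by rewrite mulrAC.
Qed.

(** The real parts are Re eta Re s -/+ Im eta Im s. The first product is quadratic in |eta| since Re
    s is small, the second since Im eta is; their constants add up to [C]. *)
Lemma root_cone : p 1 0 = p 0 1 -> 0 < p 0 1 -> exists2 C : R, 0 <= C &
  forall s, circle s ->
    `|complex.Re (gamma1 eta s)| <= C * modulus (gamma1 eta s) ^+ 2 /\
    `|complex.Re (gamma2 eta s)| <= C * modulus (gamma2 eta s) ^+ 2.
Proof.
move=> p10 q0; set q := p 0 1 in q0 *.
exists (q^-1 + (1 + 4 / q) / (2 * q)).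
  have q1 : 0 < q^-1 by rewrite invr_gt0.
  apply: addr_ge0; first exact: ltW.
  by apply: divr_ge0; [rewrite addr_ge0 // mulr_ge0 // ltW|rewrite mulr_ge0 // ltW].
move=> s cs; rewrite modulus_gamma1 // modulus_gamma2 //.
rewrite /gamma1 /gamma2 circle_inv //.
have [->|e0] := eqVneq (eta s) 0; first by rewrite !mul0r modulus0 normr0 expr0n mulr0.
have [Res Ime] := root_Im_le p10 q0 cs e0; rewrite -/q in Res Ime.
have s1 := circle_modulus cs.
set rho := modulus (eta s) in Res Ime *.
have rho0 : 0 <= rho by exact: modulus_ge0.
have h1 : `|complex.Re (eta s) * complex.Re s| <= q^-1 * rho ^+ 2.
  rewrite normrM (_ : q^-1 * _ = rho * (rho / q)); last by rewrite expr2; ring.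
  by rewrite ler_pM // normRe_modulus.
have h2 : `|complex.Im (eta s) * complex.Im s| <= (1 + 4 / q) / (2 * q) * rho ^+ 2.
  by apply: le_trans Ime; rewrite normrM ler_piMr // -s1 normIm_modulus.
have E1 : complex.Re (eta s * s) =
    complex.Re (eta s) * complex.Re s - complex.Im (eta s) * complex.Im s.
  by case: (eta s) => ? ?; case: (s) => ? ?.
have E2 : complex.Re (eta s * s^*%C) =
    complex.Re (eta s) * complex.Re s + complex.Im (eta s) * complex.Im s.
  by case: (eta s) => ? ?; case: (s) => ? ? /=; rewrite mulrN opprK.
rewrite mulrDl; split.
  by rewrite [complex.Re _]E1; apply: le_trans (ler_normB _ _) _; rewrite lerD.
by rewrite [complex.Re _]E2; apply: le_trans (ler_normD _ _) _; rewrite lerD.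
Qed.

End KernelCurves.

(** * Order of vanishing of an injective germ at 0 *)

Section Germs.
Variable R : realType.
Variables (psi g : R[i] -> R[i]) (I : set R[i]) (c : nat -> R) (e : R).
Hypothesis c0 : c 0%N = 0.
Hypothesis Hg : has_series (fun z => g z - g 0) c.
Hypothesis Dpsi : forall z, I z -> derivable psi z (1 : R[i]).
Hypothesis Ipsi : {in I &, injective psi}.
Hypothesis e0 : 0 < e.
Hypothesis gpsi : forall z, modulus z < e -> I z -> g z = psi z.

(** With all coefficients zero, psi would be constant on a real interval, against injectivity. *)
Lemma injective_germ_nonconstant : (forall r : R, 0 < r < e -> I r%:C) ->
  exists m, [/\ (0 < m)%N, forall i, (i < m)%N -> c i = 0 & c m != 0].
Proof.
move=> HI.
have [[m cm]|H] := pselect (exists m, c m != 0); last first.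
  have cE i : c i = 0 by apply: contrapT => /eqP ci; apply: H; exists i.
  have [d d0 Hd] := has_series_eq0 Hg cE.
  pose r := Num.min e d / 2; have r0 : 0 < r by rewrite divr_gt0 // lt_min e0.
  have rm : r < Num.min e d by rewrite /r; have : 0 < Num.min e d by [rewrite lt_min e0]; lra.
  move: rm; rewrite lt_min => /andP[re rd].
  have key (x : R) : 0 < x <= r -> psi x%:C = g 0.
    move=> /andP[x0 xr]; have xm : modulus x%:C = x by rewrite modulus_real gtr0_norm.
    rewrite -gpsi ?xm; last 2 first.
    - exact: le_lt_trans re.
    - by apply: HI; rewrite x0 (le_lt_trans xr).
    by apply/subr0_eq/Hd; rewrite xm (le_lt_trans xr).
  have r2 : 0 < r / 2 <= r by apply/andP; split; lra.
  have : (r / 2)%:C = r%:C :> R[i].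
    case/andP: (r2) => r20 r2r.
    apply: Ipsi; rewrite ?inE.
    - by apply: HI; rewrite r20 (le_lt_trans r2r).
    - by apply: HI; rewrite r0.
    - by rewrite !key ?r0 ?lexx.
  by move=> /complexI; lra.
have Hex : exists m, c m != 0 by exists m.
exists (ex_minn Hex); case: ex_minnP => k ck kmin; split=> //.
- by rewrite lt0n; apply: contra ck => /eqP ->; rewrite c0.
- move=> i ik; apply: contrapT => /eqP ci; have := kmin _ ci; lia.
Qed.

Lemma injective_germ_disk : (forall z, modulus z < e -> I z) -> c 1%N != 0.
Proof.
move=> HI.
have modr (r : R) t : 0 < r -> modulus (r%:C * expi t) = r.
  by move=> r0; rewrite modulusM modulus_expi mulr1 modulus_real gtr0_norm.
have [|[|[|m]] [//= _ cm cm0]//] := injective_germ_nonconstant.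
  by move=> r /andP[r0 re]; apply: HI; rewrite modulus_real gtr0_norm.
exfalso; apply: (injective_germ_leading (m := m.+2) _ cm cm0 Hg Dpsi Ipsi e0 gpsi) => //.
by move=> r t /andP[r0 re] _; apply: HI; rewrite modr.
Qed.

(** For orders m >= 3 the arc up to 5 pi/(4m) <= 5 pi/12 fits into the sector; order 2 would require
    the angle 5 pi/8. *)
Lemma injective_germ_sector :
  (forall z, z != 0 -> modulus z < e ->
     cos (5 * pi / 12) * modulus z <= complex.Re z -> I z) ->
  c 1%N != 0 \/ c 2 != 0.
Proof.
move=> HI; have pi0 := pi_gt0 R.
have modr (r : R) t : 0 < r -> modulus (r%:C * expi t) = r.
  by move=> r0; rewrite modulusM modulus_expi mulr1 modulus_real gtr0_norm.
have cos12 : cos (5 * pi / 12) <= 1 :> R by exact: cos_le1.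
have [|[|[|[|m]]] [//= _ cm cm0]] := injective_germ_nonconstant.
- move=> r /andP[r0 re]; apply: HI.
  + by rewrite -modulus_eq0 modulus_real normr_eq0 gt_eqF.
  + by rewrite modulus_real gtr0_norm.
  + by rewrite modulus_real gtr0_norm //= ler_piMl // ltW.
- by left.
- by right.
exfalso; apply: (injective_germ_leading (m := m.+3) _ cm cm0 Hg Dpsi Ipsi e0 gpsi) => //.
move=> r t /andP[r0 re] /andP[_ tm]; apply: HI; rewrite ?modr //.
  by rewrite -modulus_eq0 modr // gt_eqF.
have -> : complex.Re (r%:C * expi t) = cos `|t| * r.
  by rewrite cos_norm /= mul0r subr0 mulrC.
have t12 : `|t| <= 5 * pi / 12.
  apply: le_trans tm _; rewrite ler_pM2l ?mulr_gt0 //.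
  by rewrite lef_pV2 ?posrE ?mulr_gt0 ?ltr0n // -natrM ler_nat; lia.
have t_in : `|t| \in `[0, pi] by rewrite in_itv /= normr_ge0 (le_trans t12) //; lra.
have a_in : (5 * pi / 12 : R) \in `[0, pi] by rewrite in_itv /=; apply/andP; split; lra.
by rewrite ler_pM2r // leNgt ltr_cos // -leNgt.
Qed.

(** Near g(0), an order-two germ covers, on the positive half-line, the real direction given by the
    sign of [A]. Two germs with the same value at 0 and the same [A] must therefore share values. *)
Lemma injective_germ_real_values (A : R) : c 1%N = 0 -> c 2 = A -> A != 0 ->
  (forall r : R, 0 < r < e -> I r%:C) ->
  exists2 d : R, 0 < d & forall w, 0 < w < d ->
    exists2 x : R, I x%:C & psi x%:C = g 0 + (A * w)%:C.
Proof.
move=> c1 c2 A0 HI.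
have [e1 e10 Hconj] := has_seriesJ Hg.
have [|C [e2 [C0 e20 Hlead]]] := has_series_lead (k := 2) Hg.
  by move=> [|[|i]].
rewrite c2 in Hlead.
have A0' : 0 < `|A| by rewrite normr_gt0.
(* For x < b the cubic error is at most half of the quadratic term, which gives x^2/2 <= phi(x) <= 2
   x^2. *)
pose b := `|A| / (2 * (C + 1)).
have b0 : 0 < b by rewrite divr_gt0 // mulr_gt0 // ltr_wpDl.
have [x1 x10 [x1e x1e1 x1e2 x1b x11]] : exists2 r : R, 0 < r &
    [/\ r < e, r < e1, r < e2, r < b & r < 1].
  exists (Num.min (Num.min (Num.min e e1) (Num.min e2 b)) 1 / 2).
    by rewrite divr_gt0 // !lt_min e0 e10 e20 b0 ltr01.
  have mn (x y : R) : 0 < x -> x <= y -> x / 2 < y by lra.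
  by split; apply: mn; rewrite ?ge_min ?lt_min ?lexx ?orbT ?e0 ?e10 ?e20 ?b0 ?ltr01.
pose phi (x : R) := complex.Re (psi (x +i* 0) - g 0) / A.
have psiE (x : R) : 0 < x <= x1 -> psi x%:C = g 0 + (A * phi x)%:C.
  move=> /andP[x0 xx1]; have xm : modulus x%:C = x by rewrite modulus_real gtr0_norm.
  have Ix : I x%:C by apply: HI; rewrite x0 (le_lt_trans xx1).
  have : psi x%:C - g 0 = (psi x%:C - g 0)^*%C.
    rewrite -gpsi ?xm ?(le_lt_trans xx1) //.
    by rewrite -Hconj ?xm ?(le_lt_trans xx1) // conjc_real.
  rewrite /phi mulrCA divff // mulr1 -[x +i* 0]/(x%:C).
  case: (psi x%:C) => u v; case: (g 0) => u' v' /= [vE].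
  apply/eqP; rewrite eq_complex /= addr0 addrC subrK eqxx /=.
  apply/eqP; lra.
have phi_bounds (x : R) : 0 < x <= x1 -> x ^+ 2 / 2 <= phi x <= 2 * x ^+ 2.
  move=> /andP[x0 xx1]; have xm : modulus x%:C = x by rewrite modulus_real gtr0_norm.
  have Ix : I x%:C by apply: HI; rewrite x0 (le_lt_trans xx1).
  have := Hlead x%:C; rewrite xm (le_lt_trans xx1) // => /(_ isT).
  rewrite gpsi ?xm ?(le_lt_trans xx1) // psiE ?x0 // [_ + _ - g 0]addrC addKr.
  rewrite -rmorphXn -rmorphM -rmorphB /= modulus_real -mulrBr normrM exprS.
  have x2 : 0 < x ^+ 2 by rewrite exprn_gt0.
  have Cx : C * (x * x ^+ 2) <= `|A| * (x ^+ 2 / 2).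
    rewrite mulrA [X in _ <= X]mulrCA [X in _ <= X]mulrC ler_pM2r //.
    have : x < b by exact: le_lt_trans x1b.
    rewrite /b ltr_pdivlMr ?mulr_gt0 ?ltr_wpDl // => xb.
    have xC : x * C <= x * (C + 1) by rewrite ler_pM2l // lerDl.
    rewrite ler_pdivlMr // ; lra.
  move=> /le_trans/(_ Cx); rewrite ler_pM2l // ler_distl => /andP[? ?].
  by apply/andP; split; lra.
exists (x1 ^+ 2 / 2); first by rewrite divr_gt0 // exprn_gt0.
move=> w /andP[w0 wd].
have x12 : x1 ^+ 2 <= x1 by rewrite expr2 ler_piMl // ltW.
(* Chosen so that 2 x0^2 <= w; thus phi(x0) <= w, while w < x1^2/2 <= phi(x1). *)
pose x0 := Num.min w 2^-1.
have x00 : 0 < x0 by rewrite lt_min w0 invr_gt0 ltr0n.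
have x0w : 2 * x0 ^+ 2 <= w.
  have h1 : x0 <= w by rewrite ge_min lexx.
  have h2 : x0 <= 2^-1 by rewrite ge_min lexx orbT.
  rewrite expr2; apply: (@le_trans _ _ (2 * (2^-1 * w))); last by rewrite mulrA divff ?mul1r.
  by rewrite ler_pM2l // ler_pM // ltW.
have x01 : x0 <= x1 by apply: (@le_trans _ _ w); [rewrite ge_min lexx|lra].
have [x xI phix] : exists2 x, x \in `[x0, x1] & phi x = w.
  apply: IVT => //.
    apply: continuous_in_subspaceT => x; rewrite inE /= in_itv /= => /andP[xx0 xx1].
    have Ix : I x%:C by apply: HI; rewrite (lt_le_trans x00 xx0) (le_lt_trans xx1).
    apply: (@continuousM _ _ (fun x => complex.Re (psi (x +i* 0) - g 0)) (fun=> A^-1));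
      last exact: cst_continuous.
    apply: (@continuous_path_component _ (@complex.Re R) (fun z => psi z - g 0) id (fun=> 0)).
    - exact: normRe_modulus.
    - by move=> [? ?] [? ?].
    - move=> d /(derivable_continuous_modulus (Dpsi Ix))[d' d'0 Hd].
      by exists d' => // z /Hd; rewrite (_ : psi z - psi _ = psi z - g 0 - (psi x%:C - g 0)) //; ring.
    - exact: cvg_id.
    - exact: cst_continuous.
  have /andP[_ p0] := phi_bounds x0 ltac:(by rewrite x00).
  have /andP[p1 _] := phi_bounds x1 ltac:(by rewrite x10 lexx).
  by rewrite ge_min le_max (le_trans p0 x0w) (le_trans (ltW wd) p1) orbT.
move: xI; rewrite in_itv /= => /andP[xx0 xx1].
have xpos : 0 < x := lt_le_trans x00 xx0.
exists x; first by apply: HI; rewrite xpos (le_lt_trans xx1).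
by rewrite psiE ?xpos // phix.
Qed.

End Germs.

(** * The isomorphism *)

(** Every step would satisfy k + l <= 0, and zero drift would force l = - k. Then the sum of - p k l
    equals that of p k^2, which (K2) excludes. *)
Lemma small_jump_gt0 (R : realType) (p : int -> int -> R) :
  admissible_weights p -> covariance_condition p ->
  p 1 1 = 0 -> p 1 0 = 0 -> p 0 1 = 0 -> False.
Proof.
move=> Hp HK2 p11 p10 p01.
have p_ge0 := weights_ge0 Hp.
have Hsum := has_usumN (has_usumD (weights_drift1 Hp) (weights_drift2 Hp)).
rewrite addr0 oppr0 in Hsum.
pose f := fun kl : int * int => - (kl.1%:~R * p kl.1 kl.2 + kl.2%:~R * p kl.1 kl.2).
have supp k l : p k l != 0 -> [/\ k <= 1, l <= 1 & k + l <= 0].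
  move=> pkl.
  have k1 : k <= 1.
    by rewrite leNgt; apply: contra pkl => k2; rewrite (weights_small_pos_jumps Hp) //; left; lia.
  have l1 : l <= 1.
    by rewrite leNgt; apply: contra pkl => l2; rewrite (weights_small_pos_jumps Hp) //; right; lia.
  split=> //.
  have n11 : ~ (k = 1 /\ l = 1) by move=> [ek el]; move: pkl; rewrite ek el p11 eqxx.
  have n10 : ~ (k = 1 /\ l = 0) by move=> [ek el]; move: pkl; rewrite ek el p10 eqxx.
  have n01 : ~ (k = 0 /\ l = 1) by move=> [ek el]; move: pkl; rewrite ek el p01 eqxx.
  lia.
have f_ge0 kl : 0 <= f kl.
  rewrite /f -mulrDl -intrD oppr_ge0.
  have [->|/supp[_ _ kl0]] := eqVneq (p kl.1 kl.2) 0; first by rewrite mulr0.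
  by rewrite mulr_le0_ge0 // lerz0.
have f0 k l : p k l != 0 -> k + l = 0.
  move=> pkl; have := has_usum_ge0_sum_le [fset (k, l)]%fset f_ge0 Hsum.
  rewrite big_seq_fset1 => fle.
  have : f (k, l) = 0 by apply/le_anti; rewrite fle f_ge0.
  rewrite /f /= -mulrDl -intrD => /eqP.
  by rewrite oppr_eq0 mulf_eq0 (negbTE pkl) orbF intr_eq0 => /eqP.
pose B := [fset ((1 : int), (-1 : int)); (0, 0); (-1, 1)]%fset.
have HB kl : kl \notin B -> p kl.1 kl.2 * kl.1%:~R * kl.2%:~R = 0.
  case: kl => k l; rewrite !inE /= => /norP[/norP[/eqP n1 /eqP n2] /eqP n3].
  have [->|pkl] := eqVneq (p k l) 0; first by rewrite !mul0r.
  have [k1 l1 _] := supp _ _ pkl; have kl0 := f0 _ _ pkl.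
  exfalso; have lE : l = - k by lia.
  have [k1'|[k0|km]] : k = 1 \/ (k = 0 \/ k = -1) by lia.
  - by apply: n1; rewrite lE k1'.
  - by apply: n2; rewrite lE k0.
  - by apply: n3; rewrite lE km.
have H1 := has_usum_fin HB.
have E : (fun kl : int * int => - (p kl.1 kl.2 * kl.1%:~R * kl.2%:~R)) =
         (fun kl : int * int => p kl.1 kl.2 * kl.1%:~R ^+ 2).
  apply/funext => -[k l] /=.
  have [->|/f0 kl0] := eqVneq (p k l) 0; first by rewrite !mul0r oppr0.
  have -> : l = - k by lia.
  by rewrite rmorphN /= mulrN opprK expr2 mulrA.
have [+ _] := HK2.
have := has_usum_unique (has_usumN H1); rewrite E => ->.
by rewrite (has_usum_unique H1) ltxx.
Qed.

Section Main.
Variables (R : realType) (p : int -> int -> R).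
Variables (eta psi1 psi2 g1 g2 : R[i] -> R[i]) (r1 r2 : R).
Variable h : nat -> int -> int -> R.
Hypothesis Hp : admissible_weights p.
Hypothesis Heta : root_branch p eta.
Hypothesis HK1 : jordan_condition p eta.
Hypothesis HK2 : covariance_condition p.
Let I1 := curve_int (S1 eta).
Let I2 := curve_int (S2 eta).
Hypothesis r1I : I1 r1%:C.
Hypothesis r2I : I2 r2%:C.
Variables (Lp Lm : set R[i]).
Hypothesis Lpm : Lp `&` Lm = set0.
Hypothesis conf1 : conformal I1 Lp psi1.
Hypothesis conf2 : conformal I2 Lm psi2.
Hypothesis Hg : germs_at_0 p eta psi1 psi2 g1 g2.
Hypothesis Hh : forall n, (0 < n)%N -> harmonic_expansion p g1 g2 n (h n).

Let psi1_inj : {in I1 &, injective psi1}. Proof. by have [_ []] := conf1. Qed.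
Let psi2_inj : {in I2 &, injective psi2}. Proof. by have [_ []] := conf2. Qed.
Let Dpsi1 z : I1 z -> derivable psi1 z (1 : R[i]). Proof. by have [+ _] := conf1; apply. Qed.
Let Dpsi2 z : I2 z -> derivable psi2 z (1 : R[i]). Proof. by have [+ _] := conf2; apply. Qed.

Lemma images_disjoint z w : I1 z -> I2 w -> psi1 z <> psi2 w.
Proof.
move=> zI wI E; have [_ [f1 _ _]] := conf1; have [_ [f2 _ _]] := conf2.
have : (Lp `&` Lm) (psi1 z) by split; [exact: f1|rewrite E; exact: f2].
by rewrite Lpm.
Qed.

Lemma germ1_coef1_neq0 (d : R) : 0 < d -> (forall z, S1 eta z -> d <= modulus z) ->
  I1 0 -> (\forall z \near 0, g1 z = psi1 z) -> germ1_coef p h 1 != 0.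
Proof.
move=> d0 Sd I10 /nearCP[e e0 He].
have ed0 : 0 < Num.min e d by rewrite lt_min e0.
apply: (@injective_germ_disk _ psi1 g1 I1 (germ1_coef p h) (Num.min e d)) => //.
- exact: (germ1_series Hp Hh).
- by move=> z; rewrite lt_min => /andP[ze _] _; apply: He; rewrite subr0.
- by move=> z; rewrite lt_min => /andP[_ zd]; apply: (curve_int_disk Sd).
Qed.

Lemma germ2_coef1_neq0 (d : R) : 0 < d -> (forall z, S2 eta z -> d <= modulus z) ->
  I2 0 -> (\forall z \near 0, g2 z = psi2 z) -> germ2_coef p h 1 != 0.
Proof.
move=> d0 Sd I20 /nearCP[e e0 He].
have ed0 : 0 < Num.min e d by rewrite lt_min e0.
apply: (@injective_germ_disk _ psi2 g2 I2 (germ2_coef p h) (Num.min e d)) => //.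
- exact: (germ2_series Hp Hh).
- by move=> z; rewrite lt_min => /andP[ze _] _; apply: He; rewrite subr0.
- by move=> z; rewrite lt_min => /andP[_ zd]; apply: (curve_int_disk Sd).
Qed.

Lemma sector_in_interior (gam : R[i] -> R[i]) (r C : R) : p 1 1 = 0 ->
  (forall s, circle s -> gam s^*%C = (gam s)^*%C) ->
  (forall s, circle s -> gam (- s) = gam s) -> gam 1 = 1 ->
  (forall s t, circle s -> circle t -> gam s = gam t -> t = s \/ t = - s) ->
  (gam @` circle) 0 -> curve_int (gam @` circle) r%:C -> 0 <= C ->
  (forall s, circle s -> `|complex.Re (gam s)| <= C * modulus (gam s) ^+ 2) ->
  exists2 e : R, 0 < e & forall z, z != 0 -> modulus z < e ->
    cos (5 * pi / 12) * modulus z <= complex.Re z -> curve_int (gam @` circle) z.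
Proof.
move=> p11 gJ gN g_1 gI S0 rI C0 HC.
have pi0 := pi_gt0 R.
have k0 : 0 < cos (5 * pi / 12) :> R.
  by apply: cos_gt0_pihalf; apply/andP; split; lra.
have S1' : (gam @` circle) 1 by exists 1; [apply: modulus_circle; exact: modulus1|].
apply: (curve_int_sector rI S0 S1' C0 _ _ k0).
  move=> _ [s cs <-]; case: S0 => s0 cs0 gs0.
  by apply: curve_real_points => //; exists s0.
by move=> _ [s cs <-]; exact: HC.
Qed.

Lemma boundary_germ_coef1_neq0 : p 1 1 = 0 -> p 1 0 = p 0 1 -> 0 < p 0 1 ->
  germ1_coef p h 1 != 0.
Proof.
move=> p11 p10 q0; have [_ /(_ p11 p10)[[S10 S20] _ _ E1 E2] _ _] := Hg.
have [[simple1 simple2] _ _] := HK1.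
have [C C0 HC] := root_cone Hp Heta p11 p10 q0.
have etaJ := root_branchJ Hp Heta p11; have etaN := root_branchN Heta p11.
have eta1 := root_branch1 Heta.
have [e1 e10 He1] : exists2 e : R, 0 < e & forall z, z != 0 -> modulus z < e ->
    cos (5 * pi / 12) * modulus z <= complex.Re z -> I1 z.
  apply: (@sector_in_interior (gamma1 eta) r1 C) => //.
  - by move=> s cs; rewrite /gamma1 etaJ // conjcM.
  - by move=> s cs; rewrite /gamma1 etaN // mulrNN.
  - by rewrite /gamma1 eta1 mulr1.
  - by move=> s t cs ct /simple1[]// => [->|[_ ->]]; [left|right].
  - by move=> s /HC[].
have [e2 e20 He2] : exists2 e : R, 0 < e & forall z, z != 0 -> modulus z < e ->
    cos (5 * pi / 12) * modulus z <= complex.Re z -> I2 z.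
  apply: (@sector_in_interior (gamma2 eta) r2 C) => //.
  - by move=> s cs; rewrite /gamma2 etaJ // conjcM (circle_inv cs) (circle_inv (circleJ cs)).
  - by move=> s cs; rewrite /gamma2 etaN // invrN mulrNN.
  - by rewrite /gamma2 eta1 invr1 mulr1.
  - by move=> s t cs ct /simple2[]// => [->|[_ ->]]; [left|right].
  - by move=> s /HC[].
have [d1 d10 Hd1] := (nearCP _ _).1 E1; have [d2 d20 Hd2] := (nearCP _ _).1 E2.
pose e := Num.min (Num.min e1 e2) (Num.min d1 d2).
have e0 : 0 < e by rewrite !lt_min e10 e20 d10 d20.
have cos12 : cos (5 * pi / 12) <= 1 :> R by exact: cos_le1.
have real_sector (r : R) : 0 < r < e -> [/\ r%:C != 0 :> R[i], modulus r%:C < e &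
    cos (5 * pi / 12) * modulus r%:C <= complex.Re r%:C].
  move=> /andP[r0 re]; split.
  - by rewrite -modulus_eq0 modulus_real normr_eq0 gt_eqF.
  - by rewrite modulus_real gtr0_norm.
  - by rewrite modulus_real gtr0_norm //= ler_piMl // ltW.
have g1psi z : modulus z < e -> I1 z -> g1 z = psi1 z.
  by rewrite /e !lt_min => /andP[_ /andP[zd _]]; apply: Hd1; rewrite subr0.
have g2psi z : modulus z < e -> I2 z -> g2 z = psi2 z.
  by rewrite /e !lt_min => /andP[_ /andP[_ zd]]; apply: Hd2; rewrite subr0.
have sec1 z : z != 0 -> modulus z < e ->
    cos (5 * pi / 12) * modulus z <= complex.Re z -> I1 z.
  by move=> z0; rewrite /e !lt_min => /andP[/andP[ze _] _]; exact: He1.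
have sec2 z : z != 0 -> modulus z < e ->
    cos (5 * pi / 12) * modulus z <= complex.Re z -> I2 z.
  by move=> z0; rewrite /e !lt_min => /andP[/andP[_ ze] _]; exact: He2.
have Hs1 := germ1_series Hp Hh; have Hs2 := germ2_series Hp Hh.
have [//|c2] := injective_germ_sector erefl Hs1 Dpsi1 psi1_inj e0 g1psi sec1.
apply/eqP => c1.
pose H := shifted (h 1); pose kap := kernel_coef p.
have kap00 : kap 0%N 0%N = 0 by rewrite /kap /kernel_coef /= jump00 p11 subrr.
have kap10 : kap 1%N 0%N = - p 0 1 by rewrite /kap /kernel_coef /= jump10 sub0r.
have kap01 : kap 0%N 1%N = - p 0 1 by rewrite /kap /kernel_coef /= jump01 p10 sub0r.
have [hq _ _] := harmonic_expansion_series Hp (Hh (n := 1) isT).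
have c1E : germ1_coef p h 1 = kap 0%N 0%N * H 1%N 0%N + kap 1%N 0%N * H 0%N 0%N.
  by rewrite /germ1_coef conv2_first_axis /cauchy_product !big_ord_recl big_ord0 addr0.
have c2E : germ1_coef p h 2 =
    kap 0%N 0%N * H 2 0%N + (kap 1%N 0%N * H 1%N 0%N + kap 2 0%N * H 0%N 0%N).
  by rewrite /germ1_coef conv2_first_axis /cauchy_product !big_ord_recl big_ord0 addr0.
have b1E : germ2_coef p h 1 = - (kap 0%N 0%N * H 0%N 1%N + kap 0%N 1%N * H 0%N 0%N).
  by rewrite /germ2_coef conv2_second_axis /cauchy_product !big_ord_recl big_ord0 addr0.
have b2E : germ2_coef p h 2 =
    - (kap 0%N 0%N * H 0%N 2 + (kap 0%N 1%N * H 0%N 1%N + kap 0%N 2 * H 0%N 0%N)).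
  by rewrite /germ2_coef conv2_second_axis /cauchy_product !big_ord_recl big_ord0 addr0.
(* Without linear term in [g1], h_1 vanishes at the corner; this also removes the linear term of
   [g2]. *)
have h00 : H 0%N 0%N = 0.
  move/eqP: c1; rewrite c1E kap00 kap10 mul0r add0r mulNr oppr_eq0 mulf_eq0.
  by rewrite gt_eqF //= => /eqP.
have b1 : germ2_coef p h 1 = 0 by rewrite b1E kap00 h00 mul0r mulr0 addr0 oppr0.
(* Harmonicity of h_1 at (1, 1): only the two neighbouring cells on the axes survive, with the equal
   weights p_{1,0} = p_{0,1}. This makes the quadratic coefficients of the germs agree. *)
have hsym : H 0%N 1%N = - H 1%N 0%N.
  have [_ h0] := hq.
  have := (harmonic_quadrantP Hp h0).1 hq 1%N 1%N isT isT.
  rewrite /conv2 !big_ord_recl !big_ord0 /=.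
  rewrite -/kap -/H /bump /= kap00 kap10 kap01 h00.
  rewrite !(subn0, addn0, subnn) mul0r mulr0 !addr0 add0r => E.
  apply: (mulfI (_ : p 0 1 != 0)); first by rewrite gt_eqF.
  by rewrite mulrN; lra.
have A2 : germ2_coef p h 2 = germ1_coef p h 2.
  rewrite c2E b2E kap00 kap10 kap01 h00 hsym; ring.
have [dl1 dl10 W1] := injective_germ_real_values erefl Hs1 Dpsi1 e0 g1psi c1 erefl c2
  (fun r hr => let: And3 a b c := real_sector r hr in sec1 _ a b c).
have [dl2 dl20 W2] := injective_germ_real_values erefl Hs2 Dpsi2 e0 g2psi b1 A2 c2
  (fun r hr => let: And3 a b c := real_sector r hr in sec2 _ a b c).
pose w := Num.min dl1 dl2 / 2.
have wlt : 0 < w < Num.min dl1 dl2.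
  have m0 : 0 < Num.min dl1 dl2 by rewrite lt_min dl10.
  by rewrite /w; apply/andP; split; lra.
move: wlt; rewrite lt_min => /and3P[w0 w1 w2].
have [x xI1 Ex] := W1 w ltac:(by rewrite w0). 
have [y yI2 Ey] := W2 w ltac:(by rewrite w0).
apply: (images_disjoint xI1 yI2); rewrite Ex Ey; congr (_ + _).
by apply/subr0_eq; rewrite (germ1_at0 Hp Hh) -/kap kap00 mul0r.
Qed.

(** If p_{1,1} is non-zero, 0 is inside both curves and both axes serve. Otherwise one axis
    suffices: that of a germ equal to psi around 0 if the weights p_{1,0} and p_{0,1} differ, and
    the first one, with 0 on both curves, if they agree. *)
Lemma harmonic_basis :
  [/\ forall i j : int, finite_set [set n | (0 < n)%N /\ h n i j != 0],
      forall (c : R) (a b : nat -> R), series0 a -> series0 b ->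
        Phi h (fun n => c * a n + b n) =
        (fun i j => c * Phi h a i j + Phi h b i j) &
      set_bij series0 (harmonic_quadrant p) (Phi h)].
Proof.
have [G0 G1 G2 G3] := Hg.
have kap00 : kernel_coef p 0 0 = - p 1 1 by rewrite /kernel_coef /= jump00 sub0r.
have kap10 : kernel_coef p 1 0 = - p 0 1 by rewrite /kernel_coef /= jump10 sub0r.
have kap01 : kernel_coef p 0 1 = - p 1 0 by rewrite /kernel_coef /= jump01 sub0r.
have [p11|p11] := eqVneq (p 1 1) 0; last first.
  have [I10 I20 E1 E2] := G0 p11.
  have p11pos : 0 < p 1 1 / 2 by rewrite divr_gt0 // lt_neqAle eq_sym p11 (weights_ge0 Hp).
  apply: (basis_order12 Hp Hh).
  - by rewrite kap00 oppr_eq0.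
  - rewrite (nbhs_singleton E1) (nbhs_singleton E2).
    by apply/eqP; exact: images_disjoint.
  - apply: (germ1_coef1_neq0 p11pos _ I10 E1) => _ [s cs <-].
    rewrite modulus_gamma1 // ler_pdivrMr // mulrC.
    exact: root_modulus_ge0.
  - apply: (germ2_coef1_neq0 p11pos _ I20 E2) => _ [s cs <-].
    rewrite modulus_gamma2 // ler_pdivrMr // mulrC.
    exact: root_modulus_ge0.
rewrite p11 oppr0 in kap00.
have eta_neq0 s (gam : R[i] -> R[i]) : circle s -> modulus (gam s) = modulus (eta s) ->
    ~ (gam @` circle) 0 -> eta s != 0.
  move=> cs gs; apply: contra_notN => /eqP es0; exists s => //.
  by apply/eqP; rewrite -modulus_eq0 gs es0 modulus0.
have [p10|p01|peq] := ltgtP (p 1 0) (p 0 1).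
- have [I10 _ E1 _] := G2 p11 p10.
  have p01 : 0 < p 0 1 by apply: le_lt_trans p10; exact: weights_ge0 Hp _ _.
  apply: (basis_order1 Hp Hh kap00); first by rewrite kap10 oppr_eq0 gt_eqF.
  have d0 : 0 < (p 0 1 - p 1 0) / 2 by rewrite divr_gt0 // subr_gt0.
  apply: (germ1_coef1_neq0 d0 _ I10 E1) => _ [s cs <-].
  have es := eta_neq0 s (gamma1 eta) cs (modulus_gamma1 eta cs) I10.1.
  rewrite modulus_gamma1 // ler_pdivrMr // mulrC.
  by apply: le_trans (root_modulus_ge Hp Heta p11 cs es); exact: ler_norm.
- have [_ I20 _ E2] := G3 p11 p01.
  have p10 : 0 < p 1 0 by apply: le_lt_trans p01; exact: weights_ge0 Hp _ _.
  apply: (basis_order2 Hp Hh kap00); first by rewrite kap01 oppr_eq0 gt_eqF.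
  have d0 : 0 < (p 1 0 - p 0 1) / 2 by rewrite divr_gt0 // subr_gt0.
  apply: (germ2_coef1_neq0 d0 _ I20 E2) => _ [s cs <-].
  have es := eta_neq0 s (gamma2 eta) cs (modulus_gamma2 eta cs) I20.1.
  rewrite modulus_gamma2 // ler_pdivrMr // mulrC.
  by apply: le_trans (root_modulus_ge Hp Heta p11 cs es); rewrite distrC ler_norm.
- have q0 : 0 < p 0 1.
    rewrite lt_neqAle (weights_ge0 Hp) andbT eq_sym; apply/eqP => p01.
    by apply: (small_jump_gt0 Hp HK2 p11 _ p01); rewrite peq.
  apply: (basis_order1 Hp Hh kap00); first by rewrite kap10 oppr_eq0 gt_eqF.
  exact: boundary_germ_coef1_neq0.
Qed.

End Main.

Theorem theorem3 (R : realType) (p : int -> int -> R)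
    (eta X pi1 pi2 pi2inv psi1 psi2 g1 g2 : R[i] -> R[i]) (r1 r2 : R)
    (h : nat -> int -> int -> R)
    (Hp : admissible_weights p)
    (Heta : root_branch p eta)
    (HK1 : jordan_condition p eta)
    (HX : boundary_bijection eta X)
    (HK2 : covariance_condition p)
    (Hpi1 : riemann_map (S1 eta) r1 pi1)
    (Hpi2 : riemann_map (S2 eta) r2 pi2)
    (Hpi2inv : riemann_inverse (S2 eta) pi2 pi2inv)
    (HK3 : growth_condition (alpha pi1 X pi2inv))
    (Hpsi : gluing_pair eta X psi1 psi2)
    (Hg : germs_at_0 p eta psi1 psi2 g1 g2)
    (Hh : forall n, (0 < n)%N -> harmonic_expansion p g1 g2 n (h n)) :
  [/\ forall i j : int, finite_set [set n | (0 < n)%N /\ h n i j != 0],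
      forall (c : R) (a b : nat -> R), series0 a -> series0 b ->
        Phi h (fun n => c * a n + b n) =
        (fun i j => c * Phi h a i j + Phi h b i j) &
      set_bij series0 (harmonic_quadrant p) (Phi h)].
Proof.
have [L [Lp [Lm [psi1b [psi2b [[_ _ _ Lpm _] [conf1 conf2] _ _ _]]]]]] := Hpsi.
have [r1I _ _ _ _] := Hpi1; have [r2I _ _ _ _] := Hpi2.
exact: (harmonic_basis Hp Heta HK1 HK2 r1I r2I Lpm conf1 conf2 Hg Hh).
Qed.
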